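(* Let $A,C\in\mathbb{R}^{n\times n}$ and $B\in\mathbb{R}^{n\times m}$, and consider the system $$dx(t)=(Ax(t)+Bu(t))\,dt+Cx(t)\,dw(t),\quad x(0)=x_0\in\mathbb{R}^n$$ (the case $D=0$ of $dx=(Ax+Bu)\,dt+(Cx+Du)\,dw$). If there exists a matrix $C_1\in\mathbb{R}^{n\times n}$ such that $C'XC=XC_1+C_1'X$ for every $X\in\mathcal{S}_n$, then the system is stabilizable if and only if all its unremovable spectra belong to $\mathcal{C}^-$, i.e. if and only if there does not exist a nonzero $X\in\mathcal{S}_n$ such that $$XA+A'X+C'XC=\lambda X,\qquad XB=0,\qquad \mathrm{Re}(\lambda)\ge0$$ for some $\lambda\in\mathbb{C}$.
   Context: $w$ is a standard one-dimensional Wiener process with $w(0)=0$. $M'$ denotes the transpose of $M$. $\mathcal{S}_n$ is the set of all $n\times n$ symmetric matrices ($X=X'$), with entries allowed to be complex. $\mathcal{C}^-$ is the open left half of the complex plane. The system is stabilizable if there exists a constant matrix $K\in\mathbb{R}^{m\times n}$ such that for every $x_0\in\mathbb{R}^n$ the solution of $dx=(A+BK)x\,dt+Cx\,dw$, $x(0)=x_0$, satisfies $\lim_{t\to\infty}E[x(t)x'(t)]=0$. $\lambda\in\mathbb{C}$ is an unremovable spectrum of the system (with state feedback $u=Kx$) if there exists $0\ne X\in\mathcal{S}_n$ such that for every $K\in\mathbb{R}^{m\times n}$, $X(A+BK)+(A+BK)'X+C'XC=\lambda X$. *)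

(* Defs.v *)
(* MathComp / MathComp-Analysis *)
From HB Require Import structures.
From mathcomp Require Import all_boot all_order all_algebra.
From mathcomp Require Import all_classical all_reals all_analysis.
From mathcomp Require Import complex.

Set Implicit Arguments.
Unset Strict Implicit.
Unset Printing Implicit Defensive.

Import Order.TTheory GRing.Theory Num.Theory.
Import numFieldNormedType.Exports.

Local Open Scope classical_set_scope.
Local Open Scope ring_scope.

(** Processes are indexed by all of [R]; only the times [t >= 0] are ever
    constrained. *)
Section Wiener.
Context {R : realType} {d : measure_display} {Omega : measurableType d}.
Context (P : probability Omega R).

Definition past_events (w : R -> {RV P >-> R}) (t : R) : set (set Omega) :=
  [set E | exists (s : R) (D : set R),
     [/\ 0 <= s <= t, measurable D & E = w s @^-1` D]].

Definition increment (w : R -> {RV P >-> R}) (s t : R) (omega : Omega) : R :=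
  w t omega - w s omega.

(** The second parameter of [normal_prob] is the standard deviation. *)
Record standard_wiener (w : R -> {RV P >-> R}) : Prop := StandardWiener {
  wiener_start : {ae P, forall omega, w 0 omega = 0};
  wiener_continuous : {ae P, forall omega,
    {within `[0, +oo[, continuous (fun t : R => w t omega)}};
  wiener_normal : forall s t : R, 0 <= s < t ->
    forall D : set R, measurable D ->
      P (increment w s t @^-1` D)
      = normal_prob 0 (Num.sqrt (t - s)) D;
  wiener_indep : forall s t : R, 0 <= s < t ->
    forall (E : set Omega) (D : set R),
      <<s past_events w s >> E -> measurable D ->
      P (E `&` (increment w s t @^-1` D))
      = (P E * P (increment w s t @^-1` D))%E }.

(** The filtration generated by [w], augmented by the [P]-null events. *)
Definition wiener_filtration (w : R -> {RV P >-> R}) (t : R) :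
    set (set Omega) :=
  <<s past_events w t `|` [set N | measurable N /\ P N = 0%E] >>.

Definition known_at (w : R -> {RV P >-> R}) (t : R) (X : Omega -> R) : Prop :=
  forall D : set R, measurable D -> wiener_filtration w t (X @^-1` D).

(** Elementary integrands on [0, T]: the value is [step_val i] on
    [[step_time i, step_time i.+1[], and is known at time [step_time i]. *)
Record step_process (w : R -> {RV P >-> R}) (T : R) := StepProcess {
  step_num : nat;
  step_time : nat -> R;
  step_val : nat -> Omega -> R;
  step_time_first : step_time 0 = 0;
  step_time_last : step_time step_num = T;
  step_time_mono : forall i, (i < step_num)%N ->
    step_time i <= step_time i.+1;
  step_val_known : forall i, (i < step_num)%N ->
    known_at w (step_time i) (step_val i);
  step_val_square_integrable : forall i, (i < step_num)%N ->
    P.-integrable [set: Omega] (fun omega => (step_val i omega ^+ 2)%:E) }.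

Definition step_fun w T (phi : step_process w T) (s : R) (omega : Omega) : R :=
  \sum_(i < step_num phi)
    step_val phi i omega * \1_`[step_time phi i, step_time phi i.+1[ s.

Definition step_integral w T (phi : step_process w T) (omega : Omega) : R :=
  \sum_(i < step_num phi)
    step_val phi i omega *
    increment w (step_time phi i) (step_time phi i.+1) omega.

(** [J] is (a version of) the Ito integral of [f] with respect to [w] over
    [[0, T]]: elementary integrands converge to [f] in [L^2(dt x P)] and their
    integrals converge to [J] in [L^2(P)]. *)
Definition is_ito_integral (w : R -> {RV P >-> R}) (f : R -> Omega -> R)
    (T : R) (J : {RV P >-> R}) : Prop :=
  exists phi : nat -> step_process w T,
    (fun k => \int[P]_omega \int[lebesgue_measure]_(s in `[0%R, T])
       ((f s omega - step_fun (phi k) s omega) ^+ 2)%:E)%E @ \oo --> 0%E /\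
    (fun k => \int[P]_omega
       ((J omega - step_integral (phi k) omega) ^+ 2)%:E)%E @ \oo --> 0%E.

(** Strong solutions of [dx = F x dt + G x dw], [x(0) = x0]. *)
Record linear_sde_solution (w : R -> {RV P >-> R}) (n : nat) (F G : 'M[R]_n)
    (x0 : 'cV[R]_n) (x : R -> Omega -> 'cV[R]_n) : Prop := LinearSdeSolution {
  sde_adapted : forall (t : R) i, 0 <= t ->
    known_at w t (fun omega => x t omega i 0);
  sde_continuous : forall omega i,
    {within `[0, +oo[, continuous (fun t : R => x t omega i 0)};
  sde_square_integrable : forall (T : R) i, 0 <= T ->
    (\int[P]_omega \int[lebesgue_measure]_(s in `[0%R, T])
       ((x s omega i 0) ^+ 2)%:E < +oo)%E;
  sde_equation : forall (t : R) i, 0 <= t ->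
    exists2 J : {RV P >-> R},
      is_ito_integral w (fun s omega => (G *m x s omega) i 0) t J &
      {ae P, forall omega,
        x t omega i 0 = x0 i 0
          + \int[lebesgue_measure]_(s in `[0, t]) (F *m x s omega) i 0
          + J omega} }.

(** Mean-square stabilizability of [dx = (A x + B u) dt + C x dw] by a
    feedback [u = K x]. *)
Definition stabilizable (w : R -> {RV P >-> R}) (n m : nat)
    (A : 'M[R]_n) (B : 'M[R]_(n, m)) (C : 'M[R]_n) : Prop :=
  exists K : 'M[R]_(m, n), forall x0 : 'cV[R]_n,
    (exists x, linear_sde_solution w (A + B *m K) C x0 x) /\
    (forall x, linear_sde_solution w (A + B *m K) C x0 x ->
       forall i j,
         'E_P[fun omega => (x t omega *m (x t omega)^T) i j]%E
           @[t --> +oo] --> 0%E).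

End Wiener.

Definition complexify {R : realType} {p q : nat} (M : 'M[R]_(p, q)) :
    'M[R[i]]_(p, q) :=
  map_mx (real_complex R) M.

(** [X^T] is the plain transpose: the matrices are symmetric, not Hermitian. *)
Definition unremovable_spectrum {R : realType} {n m : nat} (A : 'M[R]_n)
    (B : 'M[R]_(n, m)) (C : 'M[R]_n) (lambda : R[i]) : Prop :=
  exists X : 'M[R[i]]_n,
    [/\ X^T = X, X != 0 &
        forall K : 'M[R]_(m, n),
          X *m complexify (A + B *m K) + (complexify (A + B *m K))^T *m X
          + (complexify C)^T *m X *m complexify C = lambda *: X].

(* Main.v *)
Require Import Defs.
From HB Require Import structures.
From mathcomp Require Import all_boot all_order all_algebra.
From mathcomp Require Import all_classical all_reals all_analysis.
From mathcomp Require Import complex.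
From mathcomp Require Import measurable_realfun.
From mathcomp Require Import spectral sesquilinear mxred.
From mathcomp Require Import ring lra.
Set Implicit Arguments.
Unset Strict Implicit.
Unset Printing Implicit Defensive.
Import Order.TTheory GRing.Theory Num.Theory.
Import numFieldNormedType.Exports.
Local Open Scope classical_set_scope.
Local Open Scope ring_scope.

(** The hypothesis on [C] forces [C = c%:M] ([intertwining_scalar]): tested on
    symmetrized matrix units, it says that [C] is diagonal and that
    [c_i c_j = (c_i ^ 2 + c_j ^ 2) / 2], so that all the [c_i] agree.

    A linear equation with scalar noise, [dx = F x dt + c x dw], is solved by
    [x t = y t *: phi t], where [phi' = F phi] and
    [y t = exp (c w t - c ^ 2 t / 2)].  Since [E (y t ^ 2) = exp (c ^ 2 t)], the
    second moments are [E (x_i x_j) = z_i z_j], where [z' = (F + c ^ 2 / 2) z].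
    Mean-square stabilizability is therefore the deterministic stabilizability
    of the pair [(A + c ^ 2 / 2, B)] ([stabilizable_flow]).

    Two facts about Ito integrals are needed, both obtained from the isometry
    for elementary integrands ([step_isometry]).  Stabilizability speaks of
    every solution, so solutions must be unique up to null events
    ([sde_unique]): the mean square of the difference of two solutions is
    bounded by a constant times its own time integral, and so vanishes on one
    short interval after the other.  And [y t *: phi t] must be a solution
    ([flow_mart_solution]): when the integrand [c y phi] is frozen on a grid of
    mesh [h], the error committed on one cell has conditional mean zero and
    mean square [O (h ^ 2)]; errors of different cells are orthogonal, so their
    sum has mean square [O (h)] ([exp_mart_ito_integral]).

    On the deterministic side, the condition of the theorem is the Hautus test.
    A left eigenvector [v] of [A + c ^ 2 / 2], for an eigenvalue [mu] with
    nonnegative real part, that is orthogonal to the range of [B], yields the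
    symmetric matrix [X = v^T v] with [lambda = 2 mu]
    ([no_bad_spectrum_hautus]).  If there is no such [v], a quadratic Lyapunov
    function and a feedback are built by induction on the dimension, splitting
    off one mode of a triangular form at a time ([hautus_stable_feasible]); the
    real part of this complex solution is a solution over the reals
    ([hautus_feedback]), and it forces [z] to tend to 0 ([certificate_decay]).
    Conversely, a feedback does not affect the equations satisfied by [X].
    They say that [g = z^T X z] satisfies [g' = lambda g], so that [|g| ^ 2]
    does not decrease; if [z] tends to 0 then [g] vanishes for every initial
    value, whence [X = 0] ([unstable_form_eq0]). *)

(** * Gaussian variables and independence *)

Section density.
Context {R : realType}.
Notation mu := (@lebesgue_measure R).

(** Both the Radon-Nikodym derivative of the normal law and its density
    integrate to the law on every measurable set, hence they agree almost
    everywhere. *)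
Lemma ge0_integral_normal_prob (m s : R) (f : R -> \bar R) :
  measurable_fun [set: R] f -> (forall x, 0 <= f x)%E ->
  (\int[normal_prob m s]_x f x = \int[mu]_x (f x * (normal_pdf m s x)%:E))%E.
Proof.
move=> mf f0.
have dom := normal_prob_dominates m s.
rewrite -(Radon_Nikodym_SigmaFinite.change_of_variables dom)//.
have mpdf : measurable_fun [set: R] (fun x => (normal_pdf m s x)%:E).
  by apply/measurable_EFinP; exact: measurable_normal_pdf.
have iRN := Radon_Nikodym_SigmaFinite.f_integrable dom.
have [mRN _] := integrableP _ _ _ iRN.
apply: ge0_ae_eq_integral => //.
- exact: emeasurable_funM.
- exact: emeasurable_funM.
- by move=> x _; rewrite mule_ge0 ?f0 ?Radon_Nikodym_SigmaFinite.f_ge0.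
- by move=> x _; rewrite mule_ge0 ?f0// lee_fin normal_pdf_ge0.
- apply: ae_eqe_mul2l.
  apply: integral_ae_eq => // E _ mE.
  by rewrite -Radon_Nikodym_SigmaFinite.f_integral.
Qed.

(** Completing the square turns the integrand into the density of the normal
    law centred at [a * s ^+ 2]. *)
Lemma normal_mgf (s a : R) : s != 0 ->
  (\int[normal_prob 0 s]_x (expR (a * x))%:E = (expR (a ^+ 2 * s ^+ 2 / 2))%:E)%E.
Proof.
move=> s0; rewrite ge0_integral_normal_prob; last first.
- by move=> x; rewrite lee_fin expR_ge0.
- by apply/measurable_EFinP; apply: measurableT_comp => //; exact: measurable_funM.
transitivity (\int[mu]_x ((expR (a ^+ 2 * s ^+ 2 / 2))%:E * (normal_pdf (a * s ^+ 2) s x)%:E))%E.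
  apply: eq_integral => x _; rewrite -!EFinM; congr EFin.
  rewrite !normal_pdfE// mulrCA [RHS]mulrCA; congr (_ * _).
  rewrite /normal_fun -!expRD; congr expR.
  by field; rewrite s0.
rewrite integralZl//; last exact: integrable_normal_pdf.
by rewrite integral_normal_pdf mule1.
Qed.

End density.

Section independence.
Context {R : realType} {d : measure_display} {T : measurableType d}.
Variable P : probability T R.

Definition indep (X Y : T -> R) := forall A B : set R, measurable A -> measurable B ->
  P ((X @^-1` A) `&` (Y @^-1` B)) = (P (X @^-1` A) * P (Y @^-1` B))%E.

Variables (X Y : T -> R).
Hypotheses (mX : measurable_fun setT X) (mY : measurable_fun setT Y).
Hypothesis XY : indep X Y.

HB.instance Definition _ := isMeasurableFun.Build _ _ _ _ X mX.
HB.instance Definition _ := isMeasurableFun.Build _ _ _ _ Y mY.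

Let mXY : measurable_fun setT (fun w => (X w, Y w)).
Proof. exact/measurable_fun_pairP. Qed.

Definition rv_pair (w : T) := (X w, Y w).
HB.instance Definition _ := isMeasurableFun.Build _ _ _ _ rv_pair mXY.

Let dX := distribution P X.
Let dY := distribution P Y.

(** Independence says that the law of the pair is the product of the laws, by
    uniqueness of the product measure. *)
Lemma ge0_indep_prod (f : R * R -> \bar R) :
  measurable_fun [set: R * R] f -> (forall z, 0 <= f z)%E ->
  (\int[P]_w f (X w, Y w) = \int[dX]_x \int[dY]_y f (x, y))%E.
Proof.
move=> mf f0.
rewrite -(fubini_tonelli1 f mf f0).
rewrite (eq_measure_integral (distribution P rv_pair)); last first.
  by move=> A mA _; apply: product_measure_unique.
by rewrite ge0_integral_distribution.
Qed.

Lemma indep_integrable_mul :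
  P.-integrable setT (EFin \o X) -> P.-integrable setT (EFin \o Y) ->
  P.-integrable setT (EFin \o (fun w => X w * Y w)).
Proof.
move=> iX iY; have [_ fX] := integrableP _ _ _ iX; have [_ fY] := integrableP _ _ _ iY.
apply/integrableP; split; first by apply/measurable_EFinP; exact: measurable_funM.
have mabs : measurable_fun [set: R * R] (fun z : R * R => `|z.1 * z.2|%:E).
  apply/measurable_EFinP; apply: measurableT_comp => //.
  by apply: measurable_funM; [exact: measurable_fst|exact: measurable_snd].
have mn : measurable_fun [set: R] (fun y : R => `|y|%:E).
  by apply/measurable_EFinP; exact: normr_measurable.
rewrite (ge0_indep_prod mabs)//=.
rewrite (_ : (fun x : R => _) = (fun x : R => (`|x|%:E * \int[dY]_y `|y|%:E)%E)); last first.
  apply/funext => x.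
  transitivity (\int[dY]_y (`|x|%:E * `|y|%:E))%E.
    by apply: eq_integral => y _; rewrite normrM EFinM.
  by rewrite ge0_integralZl.
rewrite ge0_integralZr//; last exact: integral_ge0.
have tr (Z : {mfun T >-> R}) : (\int[P]_w `|(EFin \o Z) w| < +oo)%E ->
   (\int[distribution P Z]_y `|y|%:E < +oo)%E.
  by move=> h; rewrite ge0_integral_distribution.
by rewrite lte_mul_pinfty// ?integral_ge0// ?tr// ge0_fin_numE ?integral_ge0// tr.
Qed.

(** Fubini for the product of the two laws; [indep_integrable_mul] provides
    the integrability. *)
Lemma indep_expectation_mul :
  P.-integrable setT (EFin \o X) -> P.-integrable setT (EFin \o Y) ->
  \int[P]_w (X w * Y w) = (\int[P]_w X w) * (\int[P]_w Y w).
Proof.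
move=> iX iY; have iXY := indep_integrable_mul iX iY.
rewrite /Rintegral -fineM; try exact: integrable_fin_num.
congr fine.
have mmul : measurable_fun [set: R * R] (fun z : R * R => (z.1 * z.2)%:E).
  apply/measurable_EFinP.
  by apply: measurable_funM; [exact: measurable_fst|exact: measurable_snd].
have mid : measurable_fun [set: R] (EFin : R -> \bar R).
  exact/measurable_EFinP.
have tr (Z : {mfun T >-> R}) : P.-integrable setT (EFin \o Z) ->
    (distribution P Z).-integrable setT (EFin : R -> \bar R).
  by move=> iZ; apply: integrable_pushforward.
have prE A : measurable A -> A `<=` [set: R * R] -> (dX \x dY)%E A = distribution P rv_pair A.
  by move=> mA _; apply: product_measure_unique.
have ipr : (dX \x dY)%E.-integrable setT (fun z : R * R => (z.1 * z.2)%:E).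
  have : (distribution P rv_pair).-integrable setT (fun z : R * R => (z.1 * z.2)%:E).
    exact: integrable_pushforward.
  move=> /integrableP[m1 m2]; apply/integrableP; split => //.
  by rewrite (eq_measure_integral (distribution P rv_pair)).
transitivity (\int[distribution P rv_pair]_z (z.1 * z.2)%:E)%E.
  by rewrite integral_distribution.
rewrite -(eq_measure_integral _ prE) -(integral12_prod_meas1 ipr) /fubini_F/=.
rewrite -[X in (_ = X * _)%E](integral_distribution (X := X) (f := EFin))//.
rewrite -[X in (_ = _ * X)%E](integral_distribution (X := Y) (f := EFin))//.
rewrite -/dX -/dY.
have fY : (\int[dY]_y y%:E)%E \is a fin_num by apply: integrable_fin_num => //; exact: tr.
rewrite -[in RHS](fineK fY) -integralZr//; last exact: tr.
apply: eq_integral => x _; rewrite fineK//.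
rewrite -integralZl//; last exact: tr.
Qed.

End independence.

Section moments.
Context {R : realType} {d : measure_display} {T : measurableType d}.
Variable P : probability T R.
Variables (D : T -> R) (tau : R).
Hypothesis mD : measurable_fun setT D.
Hypothesis mgf : forall a, (\int[P]_w (expR (a * D w))%:E = (expR (a ^+ 2 * tau / 2))%:E)%E.

Lemma mgf_integrable a : P.-integrable setT (EFin \o (fun w => expR (a * D w))).
Proof.
apply/integrableP; split.
  apply/measurable_EFinP; apply: measurableT_comp => //; exact: measurable_funM.
under eq_integral do rewrite /= ger0_norm ?expR_ge0//.
by rewrite mgf ltry.
Qed.

Lemma mgf_expectation a : \int[P]_w expR (a * D w) = expR (a ^+ 2 * tau / 2).
Proof. by rewrite /Rintegral mgf. Qed.

Let G (M x : R) := 4 * (expR ((M + 1) * x) + expR (- (M + 1) * x)).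

(** The dominating function [G] is uniform in the parameter [a], which is what
    differentiation under the integral sign requires. *)
Lemma poly_exp_bound (M a x : R) k : `|a| <= M -> (k <= 2)%N ->
  `|x ^+ k * expR (a * x)| <= G M x.
Proof.
move=> aM k2.
have h (y : R) : 0 <= y -> y ^+ k <= 4 * expR y.
  move=> y0; have e1 := expR_ge1Dx (y / 2).
  have e2 : expR y = expR (y / 2) ^+ 2 by rewrite -expRM_natl; congr expR; field.
  by case: k k2 => [|[|[|//]]] _; rewrite e2 ?expr0 ?expr1; nra.
rewrite normrM normrX (ger0_norm (expR_ge0 _)).
apply: (@le_trans _ _ (4 * expR `|x| * expR (M * `|x|))).
  apply: ler_pM; rewrite ?exprn_ge0 ?expR_ge0 ?h//.
  rewrite ler_expR (le_trans (ler_norm _))// normrM ler_wpM2r//.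
rewrite -mulrA -expRD /G ler_pM2l// (_ : `|x| + M * `|x| = (M + 1) * `|x|); last by ring.
have [x0|x0] := leP 0 x; first by rewrite ger0_norm// lerDl expR_ge0.
by rewrite ltr0_norm// mulrN mulNr lerDr expR_ge0.
Qed.

Let G_integrable M : P.-integrable setT (EFin \o (G M \o D)).
Proof.
rewrite /G /comp; under eq_fun do rewrite EFinM.
apply: integrableZl => //; under eq_fun do rewrite EFinD.
by apply: integrableD => //; exact: mgf_integrable.
Qed.

Lemma poly_exp_integrable a k : (k <= 2)%N ->
  P.-integrable setT (EFin \o (fun w => D w ^+ k * expR (a * D w))).
Proof.
move=> k2; apply: (@le_integrable _ _ _ P _ measurableT _ (EFin \o (fun w => G `|a| (D w)))) => //.
- apply/measurable_EFinP; apply: measurable_funM; first exact: measurable_funX.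
  apply: measurableT_comp => //; exact: measurable_funM.
- move=> w _; rewrite /= lee_fin [leRHS]ger0_norm; first exact: poly_exp_bound.
  by rewrite mulr_ge0// addr_ge0 ?expR_ge0.
- exact: G_integrable.
Qed.

(** The moments of [D] are read off from its moment generating function by
    differentiating it. *)
Lemma poly_exp_derive a k : (k <= 1)%N ->
  derive1 (fun a => \int[P]_w (D w ^+ k * expR (a * D w))) a =
  \int[P]_w (D w ^+ k.+1 * expR (a * D w)).
Proof.
move=> k1; pose M := `|a| + 1.
have Ia : `]- M, M[%classic a.
  by rewrite /= in_itv/= -ltr_norml /M ltrDl.
have dE (x : R) y : is_derive x 1 (fun a => D y ^+ k * expR (a * D y)) (D y ^+ k.+1 * expR (x * D y)).
  apply: is_derive_eq; by rewrite /GRing.scale/= exprS; ring.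
have pE (x : R) y : partial1of2 (fun a w => D w ^+ k * expR (a * D w)) x y =
    D y ^+ k.+1 * expR (x * D y).
  by rewrite /partial1of2 derive1E; have := dE x y => /@derive_val ->.
rewrite (@differentiation_under_integral R _ T P (fun a w => D w ^+ k * expR (a * D w)) setT
  measurableT a (- M) M Ia _ _ (G M \o D)).
- by apply: eq_Rintegral => w _; rewrite pE.
- by move=> x _; apply: poly_exp_integrable; rewrite (leq_trans k1).
- by move=> x y _ _; have /@ex_derive := dE x y.
- by move=> w; rewrite /G/= mulr_ge0// addr_ge0 ?expR_ge0.
- exact: G_integrable.
- move=> x y /=; rewrite in_itv/= -ltr_norml => /ltW xM _.
  by rewrite pE poly_exp_bound.
Qed.

Lemma gauss_expectation_mul_exp a : \int[P]_w (D w * expR (a * D w)) = a * tau * expR (a ^+ 2 * tau / 2).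
Proof.
have := @poly_exp_derive a 0 isT.
under eq_fun do under eq_Rintegral do rewrite expr0 mul1r.
under eq_fun do rewrite mgf_expectation.
under [X in _ = X]eq_Rintegral do rewrite expr1.
move=> <-; rewrite derive1E.
have : is_derive a 1 (fun a => expR (a ^+ 2 * tau / 2)) (a * tau * expR (a ^+ 2 * tau / 2)).
  by apply: is_derive_eq; rewrite /GRing.scale/=; field.
by move=> /@derive_val ->.
Qed.

Lemma gauss_expectation : \int[P]_w D w = 0.
Proof.
have := gauss_expectation_mul_exp 0; rewrite !mul0r => <-.
by apply: eq_Rintegral => w _; rewrite mul0r expR0 mulr1.
Qed.

Lemma gauss_variance : \int[P]_w (D w ^+ 2) = tau.
Proof.
have := @poly_exp_derive 0 1 isT.
under eq_fun do under eq_Rintegral do rewrite expr1.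
under eq_fun do rewrite gauss_expectation_mul_exp.
under [X in _ = X]eq_Rintegral do rewrite mul0r expR0 mulr1.
move=> <-; rewrite derive1E.
have : is_derive (0:R) 1 (fun a => a * tau * expR (a ^+ 2 * tau / 2)) tau.
  by apply: is_derive_eq; rewrite /GRing.scale/= ?expr0n/= ?mul0r expR0; ring.
by move=> /@derive_val ->.
Qed.

End moments.

(** * The augmented Wiener filtration *)

Section filtration.
Context {R : realType} {d : measure_display} {Omega : measurableType d}.
Variable P : probability Omega R.
Variable w : R -> {RV P >-> R}.
Hypothesis hw : standard_wiener w.

Lemma past_events_measurable t E : past_events w t E -> measurable E.
Proof.
move=> [s [D [_ mD ->]]].
by rewrite -[X in measurable X]setTI; exact: measurable_funPT.
Qed.

Lemma wiener_filtration_measurable t E : wiener_filtration w t E -> measurable E.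
Proof.
apply: smallest_sub; first exact: sigma_algebra_measurable.
by move=> A [/past_events_measurable//|[]].
Qed.

Lemma wiener_filtration_le s t : s <= t ->
  wiener_filtration w s `<=` wiener_filtration w t.
Proof.
move=> st; apply: sub_sigma_algebra2 => A [|]; last by right.
move=> [u [D [/andP[u0 us] mD ->]]]; left; exists u, D; split => //.
by rewrite u0 (le_trans us).
Qed.

Definition equal_mod_null (E E' : set Omega) := exists N,
  [/\ measurable N, P N = 0%E & E `|` N = E' `|` N].

(** The events that agree with an event of the past up to a null set form a
    sigma-algebra that contains both the past and the null sets. *)
Lemma wiener_filtration_mod_null t E : wiener_filtration w t E ->
  exists2 E', <<s past_events w t >> E' & equal_mod_null E E'.
Proof.
apply: (smallest_sub (X := [set E | exists2 E', <<s past_events w t >> E' & equal_mod_null E E'])).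
- split.
  + exists set0; first exact: sigma_algebra0.
    by exists set0; split => //; rewrite measure0.
  + move=> A [E' sE' [N [mN N0 AN]]]; exists (~` E').
      by rewrite -setTD; exact: sigma_algebraCD.
    exists N; split => //; rewrite setTD.
    apply/seteqP; split => x [Ax|Nx]; try by right.
      have [Nx|nNx] := pselect (N x); [by right|left => E'x].
      have : (E' `|` N) x by left.
      by rewrite -AN => -[].
    have [Nx|nNx] := pselect (N x); [by right|left => E'x].
    have : (A `|` N) x by left.
    by rewrite AN => -[].
  + move=> A /(_ _)/cid2 /= h; pose E' n := s2val (h n).
    have sE' n : <<s past_events w t >> (E' n) by exact: (s2valP (h n)).
    have eE' n : equal_mod_null (A n) (E' n) by exact: (s2valP' (h n)).
    exists (\bigcup_n E' n); first exact: sigma_algebra_bigcup.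
    pose N n := projT1 (cid (eE' n)).
    have NP n : [/\ measurable (N n), P (N n) = 0%E & A n `|` N n = E' n `|` N n].
      exact: (projT2 (cid (eE' n))).
    exists (\bigcup_n N n); split.
    * by apply: bigcupT_measurable => n; have [] := NP n.
    * apply/negligibleP; first by apply: bigcupT_measurable => n; have [] := NP n.
      by apply: negligible_bigcup => n; apply/negligibleP; have [] := NP n.
    * rewrite -!bigcupU; apply: eq_bigcupr => n _.
      by have [] := NP n.
- move=> A [pA|[mA A0]].
  + exists A; first exact: sub_sigma_algebra.
    by exists set0; split => //; rewrite measure0.
  + exists set0; first exact: sigma_algebra0.
    by exists A; split => //; rewrite setUid set0U.
Qed.

Lemma measurable_increment s t : measurable_fun setT (increment w s t).
Proof. by rewrite /increment; apply: measurable_funB. Qed.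

Lemma increment_self t : increment w t t = cst 0.
Proof. by apply/funext => x; rewrite /increment subrr. Qed.

(** Null sets do not affect probabilities, so independence of the past extends
    to the augmented filtration. *)
Lemma wiener_filtration_indep s t E D : 0 <= s -> s < t ->
  wiener_filtration w s E -> measurable D ->
  P (E `&` (increment w s t @^-1` D)) = (P E * P (increment w s t @^-1` D))%E.
Proof.
move=> s0 st FE mD; have mE := wiener_filtration_measurable FE.
have [E' sE' [N [mN N0 EN]]] := wiener_filtration_mod_null FE.
have mE' : measurable E'.
  apply: (smallest_sub (sigma_algebra_measurable Omega) _ sE').
  exact: past_events_measurable.
have mI : measurable (increment w s t @^-1` D).
  by rewrite -[X in measurable X]setTI; exact: measurable_increment.
have PE : P E = P E' by rewrite -(measureU0 mE mN N0) EN measureU0.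
rewrite PE -(wiener_indep hw _ sE' mD) ?s0//.
have mNI : measurable (N `&` (increment w s t @^-1` D)) by exact: measurableI.
have NI0 : P (N `&` (increment w s t @^-1` D)) = 0%E.
  by apply: (subset_measure0 _ _ _ N0) => //; exact: subIsetl.
rewrite -(measureU0 _ mNI NI0)//; last exact: measurableI.
rewrite -[RHS](measureU0 _ mNI NI0)//; last exact: measurableI.
by rewrite -!setIUl EN.
Qed.

Lemma known_at_measurable t X : known_at w t X -> measurable_fun setT X.
Proof.
by move=> kX _ D mD; rewrite setTI; exact: wiener_filtration_measurable (kX _ mD).
Qed.

Definition filtration_gen t : set (set Omega) :=
  past_events w t `|` [set N | measurable N /\ P N = 0%E].

(** Being known at [t] is measurability for the sigma-algebra generated by
    [filtration_gen t]; the closure properties of measurable functions then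
    apply. *)
Lemma known_atP t (X : Omega -> R) : known_at w t X <->
  measurable_fun setT (X : g_sigma_algebraType (filtration_gen t) -> R).
Proof.
split => [kX _ D mD|mX D mD]; first by rewrite setTI; exact: kX.
by have := mX measurableT D mD; rewrite setTI.
Qed.

Lemma known_at_le s t X : s <= t -> known_at w s X -> known_at w t X.
Proof. by move=> st kX D mD; apply: (wiener_filtration_le st); exact: kX. Qed.

Lemma known_at_comp t (g : R -> R) X : measurable_fun [set: R] g ->
  known_at w t X -> known_at w t (g \o X).
Proof. by move=> mg /known_atP kX; apply/known_atP; exact: measurableT_comp. Qed.

Lemma known_at_cst t c : known_at w t (cst c).
Proof. by apply/known_atP. Qed.

Lemma known_atM t X Y : known_at w t X -> known_at w t Y ->
  known_at w t (fun x => X x * Y x).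
Proof.
by move=> /known_atP kX /known_atP kY; apply/known_atP; exact: measurable_funM.
Qed.

Lemma known_atB t X Y : known_at w t X -> known_at w t Y ->
  known_at w t (fun x => X x - Y x).
Proof.
by move=> /known_atP kX /known_atP kY; apply/known_atP; exact: measurable_funB.
Qed.

Lemma known_at_wiener s t : 0 <= s <= t -> known_at w t (w s).
Proof.
by move=> st D mD; apply: sub_sigma_algebra; left; exists s, D.
Qed.

Lemma known_at_increment s t : 0 <= s -> s <= t -> known_at w t (increment w s t).
Proof.
move=> s0 st; rewrite /increment; apply: known_atB; apply: known_at_wiener.
  by rewrite (le_trans s0)//= lexx.
by rewrite s0.
Qed.

(** This is where the augmentation by null sets is used: paths can be modified
    on a null event without losing adaptedness. *)
Lemma known_at_indicC t N : measurable N -> P N = 0%E -> known_at w t (\1_(~` N)).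
Proof.
move=> mN N0; apply/known_atP; apply: measurable_indic; apply: measurableC.
by apply: sub_sigma_algebra; right.
Qed.

Lemma known_increment_indep s t X (g : R -> R) : 0 <= s -> s <= t ->
  known_at w s X -> measurable_fun [set: R] g -> indep P X (g \o increment w s t).
Proof.
move=> s0; rewrite le_eqVlt => /orP[/eqP<-|st] kX mg A B mA mB.
  rewrite increment_self.
  have -> : (g \o cst 0) @^-1` B = if g 0 \in B then [set: Omega] else set0.
    case: ifPn => [/set_mem gB|/negP gB]; apply/seteqP; split => x //=.
    by move/mem_set.
  case: ifP => _; first by rewrite setIT probability_setT mule1.
  by rewrite setI0 measure0 mule0.
rewrite comp_preimage wiener_filtration_indep//; first exact: kX.
by rewrite -[X in measurable X]setTI; exact: mg.
Qed.

Lemma increment_mgf s t : 0 <= s -> s <= t -> forall a,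
  (\int[P]_x (expR (a * increment w s t x))%:E = (expR (a ^+ 2 * (t - s) / 2))%:E)%E.
Proof.
move=> s0; rewrite le_eqVlt => /orP[/eqP<-|st] a.
  under eq_integral do rewrite increment_self /= mulr0 expR0.
  by rewrite integral_cst//= probability_setT mule1 subrr mulr0 mul0r expR0.
have ts : 0 < t - s by rewrite subr_gt0.
have mexp : measurable_fun [set: R] (fun x : R => (expR (a * x))%:E).
  by apply/measurable_EFinP; apply: measurableT_comp => //; exact: measurable_funM.
pose I : {mfun Omega >-> measurableTypeR R} :=
  HB.pack (increment w s t)
    (@isMeasurableFun.Build _ _ Omega (measurableTypeR R) _ (measurable_increment s t)).
transitivity (\int[distribution P I]_x (expR (a * x))%:E)%E.
  by rewrite ge0_integral_distribution// => y; rewrite lee_fin expR_ge0.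
transitivity (\int[normal_prob 0 (Num.sqrt (t - s))]_x (expR (a * x))%:E)%E.
  apply: eq_measure_integral => D mD _.
  by apply: (wiener_normal hw) => //; rewrite s0.
rewrite normal_mgf; last by rewrite sqrtr_eq0 -ltNge.
by rewrite sqr_sqrtr ?ltW.
Qed.

End filtration.

(** * The Ito isometry *)

Section integral_finite_sum.
Context {R : realType} {d : measure_display} {T : measurableType d}.
Variables (mu : {measure set T -> \bar R}) (D : set T).
Hypothesis mD : measurable D.
Variables (I : Type) (F : I -> T -> R).
Hypothesis iF : forall i, mu.-integrable D (EFin \o F i).

Lemma integrable_sum_EFin (s : seq I) :
  mu.-integrable D (EFin \o (fun x => \sum_(i <- s) F i x)).
Proof.
rewrite (_ : _ \o _ = (fun x => \sum_(i <- s) (F i x)%:E)%E); last first.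
  by apply/funext => x /=; rewrite -sumEFin.
by apply: integrable_sum => // i _; exact: iF.
Qed.

Lemma Rintegral_sum (s : seq I) :
  \int[mu]_(x in D) (\sum_(i <- s) F i x) = \sum_(i <- s) \int[mu]_(x in D) F i x.
Proof.
elim: s => [|i s ih].
  under eq_Rintegral do rewrite big_nil.
  by rewrite big_nil Rintegral_cst// mul0r.
under eq_Rintegral do rewrite big_cons.
by rewrite RintegralD ?big_cons ?ih//; exact: integrable_sum_EFin.
Qed.

End integral_finite_sum.

Section square_integrable.
Context {R : realType} {d : measure_display} {T : measurableType d}.
Variable P : probability T R.
Implicit Types X Y : T -> R.

Definition L1 X := P.-integrable setT (EFin \o X).
Definition L2 X := measurable_fun setT X /\ L1 (fun w => X w ^+ 2).

Lemma L1_measurable X : L1 X -> measurable_fun setT X.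
Proof. by move=> /integrableP[/measurable_EFinP]. Qed.

Lemma L1D X Y : L1 X -> L1 Y -> L1 (fun w => X w + Y w).
Proof.
by move=> iX iY; rewrite /L1 /comp; under eq_fun do rewrite EFinD; exact: integrableD.
Qed.

Lemma L1B X Y : L1 X -> L1 Y -> L1 (fun w => X w - Y w).
Proof.
by move=> iX iY; rewrite /L1 /comp; under eq_fun do rewrite EFinB; exact: integrableB.
Qed.

Lemma L1Z c X : L1 X -> L1 (fun w => c * X w).
Proof.
by move=> iX; rewrite /L1 /comp; under eq_fun do rewrite EFinM; exact: integrableZl.
Qed.

Lemma L1_cst c : L1 (fun=> c).
Proof. exact: (finite_measure_integrable_cst P). Qed.

Lemma expectation_const c : \int[P]_w (c : R) = c.
Proof.
rewrite Rintegral_cst// [X in fine X](_ : _ = 1%E) ?mulr1//.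
exact: probability_setT.
Qed.

Lemma L1_sum (I : Type) (s : seq I) (F : I -> T -> R) : (forall i, L1 (F i)) ->
  L1 (fun w => \sum_(i <- s) F i w).
Proof. by move=> h; exact: integrable_sum_EFin. Qed.

Lemma expectation_sum_L1 (I : Type) (s : seq I) (F : I -> T -> R) : (forall i, L1 (F i)) ->
  \int[P]_w (\sum_(i <- s) F i w) = \sum_(i <- s) \int[P]_w F i w.
Proof. by move=> h; exact: Rintegral_sum. Qed.

Lemma le_L1 X Y : measurable_fun setT X -> (forall w, `|X w| <= Y w) -> L1 Y -> L1 X.
Proof.
move=> mX XY iY; apply: (le_integrable measurableT _ _ iY) => /=.
  exact/measurable_EFinP.
by move=> w _; rewrite lee_fin (le_trans (XY w)) ?ler_norm.
Qed.

(** [|X Y| <= X ^ 2 + Y ^ 2]. *)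
Lemma L2_mul X Y : L2 X -> L2 Y -> L1 (fun w => X w * Y w).
Proof.
move=> [mX iX] [mY iY].
apply: (le_L1 (Y := fun w => X w ^+ 2 + Y w ^+ 2)); last exact: L1D.
  exact: measurable_funM.
move=> w; rewrite -real_normK ?num_real// -[in leRHS](real_normK (num_real (Y w))).
rewrite normrM; have := normr_ge0 (X w); have := normr_ge0 (Y w); nra.
Qed.

Lemma L2_cst c : L2 (fun=> c).
Proof. by split => //; exact: L1_cst. Qed.

Lemma L2_L1 X : L2 X -> L1 X.
Proof.
move=> h; have := L2_mul h (L2_cst 1).
by rewrite /L1 /comp; under eq_fun do rewrite mulr1.
Qed.

Lemma L2D X Y : L2 X -> L2 Y -> L2 (fun w => X w + Y w).
Proof.
move=> hX hY; split; first by apply: measurable_funD; [exact: hX.1|exact: hY.1].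
rewrite (_ : (fun w => _) = (fun w => X w ^+ 2 + 2 * (X w * Y w) + Y w ^+ 2)).
  apply: L1D; last exact: hY.2.
  by apply: L1D; [exact: hX.2|apply: L1Z; exact: L2_mul].
by apply/funext => w; ring.
Qed.

Lemma L2Z c X : L2 X -> L2 (fun w => c * X w).
Proof.
move=> hX; split; first by apply: measurable_funM => //; exact: hX.1.
rewrite (_ : (fun w => _) = (fun w => c ^+ 2 * X w ^+ 2)); first by apply: L1Z; exact: hX.2.
by apply/funext => w; ring.
Qed.

Lemma L2B X Y : L2 X -> L2 Y -> L2 (fun w => X w - Y w).
Proof.
move=> hX hY; have := L2D hX (L2Z (-1) hY).
by congr L2; apply/funext => w; rewrite mulN1r.
Qed.

Lemma L2_sum (I : Type) (s : seq I) (F : I -> T -> R) : (forall i, L2 (F i)) ->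
  L2 (fun w => \sum_(i <- s) F i w).
Proof.
move=> h; elim: s => [|i s ih].
  by under eq_fun do rewrite big_nil; exact: L2_cst.
by under eq_fun do rewrite big_cons; exact: L2D.
Qed.

Lemma EFin_expectation X : L1 X -> (\int[P]_w (X w)%:E)%E = (\int[P]_w X w)%:E.
Proof. by move=> iX; rewrite /Rintegral fineK//; exact: integrable_fin_num. Qed.

End square_integrable.

Section ito_isometry.
Context {R : realType} {d : measure_display} {Omega : measurableType d}.
Variable P : probability Omega R.
Variable w : R -> {RV P >-> R}.
Hypothesis hw : standard_wiener w.
Local Notation L1 := (L1 P).
Local Notation L2 := (L2 P).
Local Notation inc := (increment w).

Section increment_moments.
Variables (s t : R).
Hypotheses (s0 : 0 <= s) (st : s <= t).

Let mI := measurable_increment w s t.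
Let mgf := increment_mgf hw s0 st.

Lemma increment_expectation : \int[P]_x inc s t x = 0.
Proof. exact: (gauss_expectation mI mgf). Qed.

Lemma increment_variance : \int[P]_x (inc s t x ^+ 2) = t - s.
Proof. exact: (gauss_variance mI mgf). Qed.

Lemma increment_exp_L1 a : L1 (fun x => expR (a * inc s t x)).
Proof. exact: (mgf_integrable mI mgf). Qed.

Lemma increment_exp_expectation a :
  \int[P]_x expR (a * inc s t x) = expR (a ^+ 2 * (t - s) / 2).
Proof. exact: (mgf_expectation mgf). Qed.

Lemma increment_mul_exp_expectation a :
  \int[P]_x (inc s t x * expR (a * inc s t x)) = a * (t - s) * expR (a ^+ 2 * (t - s) / 2).
Proof. exact: (gauss_expectation_mul_exp mI mgf). Qed.

Lemma increment_mul_exp_L1 a : L1 (fun x => inc s t x * expR (a * inc s t x)).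
Proof. exact: (@poly_exp_integrable _ _ _ P _ _ mI mgf a 1 isT). Qed.

Lemma increment_L2 : L2 (inc s t).
Proof.
split => //.
have := @poly_exp_integrable _ _ _ P _ _ mI mgf 0 2 isT.
by rewrite /L1 /comp; under eq_fun do rewrite mul0r expR0 mulr1.
Qed.

Variable z : Omega -> R.
Hypotheses (kz : known_at w s z) (iz : L1 z).

Lemma known_mul_L1 g : measurable_fun [set: R] g -> L1 (g \o inc s t) ->
  L1 (fun x => z x * g (inc s t x)).
Proof.
move=> mg ig; apply: (@indep_integrable_mul _ _ _ P z (g \o inc s t)) => //.
- exact: known_at_measurable kz.
- exact: measurableT_comp.
- exact: known_increment_indep.
Qed.

Lemma known_mul_expectation g : measurable_fun [set: R] g -> L1 (g \o inc s t) ->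
  \int[P]_x (z x * g (inc s t x)) = (\int[P]_x z x) * \int[P]_x g (inc s t x).
Proof.
move=> mg ig; apply: (@indep_expectation_mul _ _ _ P z (g \o inc s t)) => //.
- exact: known_at_measurable kz.
- exact: measurableT_comp.
- exact: known_increment_indep.
Qed.

Lemma known_mul_increment_L1 : L1 (fun x => z x * inc s t x).
Proof. by apply: (known_mul_L1 (g := id)) => //; exact: L2_L1 increment_L2. Qed.

Lemma known_mul_increment_expectation : \int[P]_x (z x * inc s t x) = 0.
Proof.
rewrite (known_mul_expectation (g := id))//; last exact: L2_L1 increment_L2.
by rewrite increment_expectation mulr0.
Qed.

Lemma known_mul_sqr_increment_L1 : L1 (fun x => z x * inc s t x ^+ 2).
Proof.
apply: (known_mul_L1 (g := fun x => x ^+ 2)); last exact: increment_L2.2.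
exact: exprn_measurable.
Qed.

Lemma known_mul_sqr_increment_expectation :
  \int[P]_x (z x * inc s t x ^+ 2) = (\int[P]_x z x) * (t - s).
Proof.
rewrite (known_mul_expectation (g := fun x => x ^+ 2)) ?increment_variance//.
exact: increment_L2.2.
Qed.

End increment_moments.

Lemma known_mul_L2 s t z g : 0 <= s -> s <= t -> known_at w s z -> L2 z ->
  measurable_fun [set: R] g -> L2 (g \o inc s t) ->
  L2 (fun x => z x * g (inc s t x)).
Proof.
move=> s0 st kz iz mg ig; split.
  apply: measurable_funM; first exact: iz.1.
  exact: ig.1.
rewrite (_ : (fun x => _) = (fun x => z x ^+ 2 * (fun y => g y ^+ 2) (inc s t x))).
  apply: (@known_mul_L1 s t s0 st _ _ _ (fun y => g y ^+ 2)).
  - by apply: (known_at_comp (g := fun x => x ^+ 2)) => //; exact: exprn_measurable.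
  - exact: iz.2.
  - exact: measurable_funX.
  - exact: ig.2.
by apply/funext => x; rewrite exprMn.
Qed.

Definition overlap (a b c e : R) := Num.max 0 (Num.min b e - Num.max a c).

Lemma overlapC a b c e : overlap a b c e = overlap c e a b.
Proof. by rewrite /overlap (minC b) (maxC a). Qed.

Lemma increment_chain a b c x : inc a c x = inc a b x + inc b c x.
Proof. by rewrite /increment; ring. Qed.

(** With [a <= c], if the intervals are disjoint then the later increment is
    independent of everything else and centred. Otherwise the two increments
    are cut at [c] and at [min b e]: in the product, every term but the square
    of the increment over the common part contains a centred increment that
    lies after all the other factors. *)
Lemma isometry_pair a b c e xi eta : 0 <= a -> a <= b -> 0 <= c -> c <= e ->
  known_at w a xi -> known_at w c eta -> L2 xi -> L2 eta ->
  \int[P]_x ((xi x * inc a b x) * (eta x * inc c e x)) =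
  (\int[P]_x (xi x * eta x)) * overlap a b c e.
Proof.
wlog ac : a b c e xi eta / a <= c.
  move=> h a0 ab c0 ce kx ke ix ie; have [ac|/ltW ca] := leP a c; first exact: h.
  under eq_Rintegral do rewrite mulrC.
  rewrite h// overlapC; congr (_ * _).
  by under eq_Rintegral do rewrite mulrC.
move=> a0 ab c0 ce kx ke ix ie.
have kxc : known_at w c xi by exact: known_at_le kx.
have [bc|/ltW cb] := leP b c.
  rewrite (_ : overlap _ _ _ _ = 0) ?mulr0.
    under eq_Rintegral do rewrite mulrA.
    apply: known_mul_increment_expectation => //.
      apply: known_atM => //; apply: known_atM => //.
      by apply: (known_at_le bc); exact: known_at_increment.
    apply: L2_mul => //.
    by apply: (known_mul_L2 (g := id)) => //; exact: increment_L2.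
  rewrite /overlap; apply/max_idPl.
  by rewrite subr_le0 ge_min (le_trans bc)// le_max lexx orbT.
pose m := Num.min b e; pose M := Num.max b e.
have mc : c <= m by rewrite le_min cb.
have mM : m <= M by rewrite ge_min le_max lexx.
have m0 : 0 <= m by exact: le_trans mc.
have -> : overlap a b c e = m - c.
  by rewrite /overlap (max_r ac) max_r// subr_ge0.
have izeta : L1 (fun x => xi x * eta x) by exact: L2_mul.
have kzeta : known_at w c (fun x => xi x * eta x) by exact: known_atM.
have iz2 : L1 (fun x => (xi x * eta x) * inc c m x) by exact: known_mul_increment_L1.
have kz2 : known_at w m (fun x => (xi x * eta x) * inc c m x).
  by apply: known_atM; [exact: known_at_le kzeta|exact: known_at_increment].
have iz1 : L1 (fun x => xi x * inc a c x * eta x).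
  apply: L2_mul => //.
  by apply: (known_mul_L2 (g := id)) => //; exact: increment_L2.
have kz1 : known_at w c (fun x => xi x * inc a c x * eta x).
  by do 2!apply: known_atM => //; exact: known_at_increment.
transitivity (\int[P]_x (xi x * inc a c x * eta x * inc c e x +
    ((xi x * eta x) * inc c m x ^+ 2 + (xi x * eta x) * inc c m x * inc m M x))).
  apply: eq_Rintegral => x _.
  rewrite /m /M (increment_chain a c b); case: (leP b e) => h.
    by rewrite (increment_chain c b e); ring.
  by rewrite (increment_chain c e b); ring.
rewrite RintegralD//; last 2 first.
- exact: known_mul_increment_L1.
- apply: L1D; [exact: known_mul_sqr_increment_L1|exact: known_mul_increment_L1].
rewrite RintegralD//; last 2 first.
- exact: known_mul_sqr_increment_L1.
- exact: known_mul_increment_L1.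
rewrite known_mul_increment_expectation// known_mul_sqr_increment_expectation//.
by rewrite known_mul_increment_expectation// add0r addr0.
Qed.

Lemma indic_itvM (a b c e s : R) : \1_`[a, b[ s * \1_`[c, e[ s =
  \1_(`[Num.max a c, Num.min b e[%classic : set R) s :> R.
Proof.
rewrite !indicE -natrM mulnb; congr (_ %:R); congr nat_of_bool.
rewrite !mem_setE !in_itv/= ge_max lt_min.
by case: (a <= s); case: (c <= s); case: (s < b); case: (s < e).
Qed.

Lemma integral_overlap T a b c e : 0 <= a -> b <= T -> 0 <= c -> e <= T ->
  (\int[lebesgue_measure]_(s in `[0%R, T]) (\1_`[a, b[ s * \1_`[c, e[ s)%:E =
   (overlap a b c e)%:E)%E.
Proof.
move=> a0 bT c0 eT; under eq_integral do rewrite indic_itvM.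
rewrite integral_indic//= setIidl; last first.
  move=> s /=; rewrite !in_itv/= ge_max lt_min => /andP[/andP[as_ _] /andP[sb _]].
  by rewrite (le_trans a0 as_) ltW// (lt_le_trans sb).
rewrite lebesgue_measure_itv/= lte_fin /overlap.
case: ltP => h; first by rewrite -EFinB [Num.max 0 _]max_r// subr_ge0 ltW.
by rewrite [Num.max 0 _]max_l// subr_le0.
Qed.

Section finite_families.
Variables (I : finType) (a b : I -> R) (xi : I -> Omega -> R) (T : R).
Hypotheses (a0 : forall i, 0 <= a i) (ab : forall i, a i <= b i) (bT : forall i, b i <= T).
Hypotheses (kxi : forall i, known_at w (a i) (xi i)) (ixi : forall i, L2 (xi i)).

(** Both sides are expanded into double sums, which [isometry_pair] and
    [integral_overlap] match term by term. The intervals are arbitrary, so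
    this applies to two subdivisions at once. *)
Lemma family_isometry :
  (\int[P]_x ((\sum_i xi i x * inc (a i) (b i) x) ^+ 2)%:E =
   \int[P]_x \int[lebesgue_measure]_(s in `[0%R, T])
     ((\sum_i xi i x * \1_`[a i, b i[ s) ^+ 2)%:E)%E.
Proof.
have inner x : (\int[lebesgue_measure]_(s in `[0%R, T])
     ((\sum_i xi i x * \1_`[a i, b i[ s) ^+ 2)%:E)%E =
   (\sum_i \sum_j xi i x * xi j x * overlap (a i) (b i) (a j) (b j))%:E.
  have iind i j : lebesgue_measure.-integrable `[0, T]%classic
      (fun s : R => (\1_`[a i, b i[ s * \1_`[a j, b j[ s)%:E).
    rewrite (_ : (fun s => _) = EFin \o (\1_(`[Num.max (a i) (a j), Num.min (b i) (b j)[%classic) : R -> R)).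
      by apply: (integrableS measurableT) => //; exact: integrable_indic_itv.
    by apply/funext => s /=; rewrite -indic_itvM.
  transitivity (\int[lebesgue_measure]_(s in `[0%R, T])
     (\sum_i \sum_j (xi i x * xi j x)%:E * (\1_`[a i, b i[ s * \1_`[a j, b j[ s)%:E))%E.
    apply: eq_integral => s _; rewrite expr2 big_distrlr/=.
    rewrite -sumEFin; apply: eq_bigr => i _; rewrite -sumEFin; apply: eq_bigr => j _.
    by rewrite -EFinM; congr EFin; ring.
  rewrite integral_sum//; last first.
    by move=> i; apply: integrable_sum => // j _; exact: integrableZl.
  rewrite -sumEFin; apply: eq_bigr => i _.
  rewrite integral_sum//; last by move=> j; exact: integrableZl.
  rewrite -sumEFin; apply: eq_bigr => j _.
  by rewrite integralZl// integral_overlap.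
under [RHS]eq_integral do rewrite inner.
have i2 i : L2 (fun x => xi i x * inc (a i) (b i) x).
  by apply: (known_mul_L2 (g := id)) => //; exact: increment_L2.
rewrite EFin_expectation; last by have [] := L2_sum (index_enum I) i2.
rewrite EFin_expectation; last first.
  apply: L1_sum => i; apply: L1_sum => j.
  by under eq_fun do rewrite mulrC; apply: L1Z; exact: L2_mul.
congr EFin.
transitivity (\int[P]_x (\sum_i \sum_j (xi i x * inc (a i) (b i) x) * (xi j x * inc (a j) (b j) x))).
  by apply: eq_Rintegral => x _; rewrite expr2 big_distrlr.
rewrite expectation_sum_L1; last by move=> i; apply: L1_sum => j; exact: L2_mul.
rewrite expectation_sum_L1; last first.
  move=> i; apply: L1_sum => j.
  by under eq_fun do rewrite mulrC; apply: L1Z; exact: L2_mul.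
apply: eq_bigr => i _.
rewrite expectation_sum_L1; last by move=> j; exact: L2_mul.
rewrite expectation_sum_L1; last first.
  by move=> j; under eq_fun do rewrite mulrC; apply: L1Z; exact: L2_mul.
apply: eq_bigr => j _; rewrite isometry_pair//.
rewrite -RintegralZr//; exact: L2_mul.
Qed.

End finite_families.

Lemma step_process_bounds T (phi : step_process w T) i : (i <= step_num phi)%N ->
  0 <= step_time phi i <= T.
Proof.
have mono k j : (j + k <= step_num phi)%N -> step_time phi j <= step_time phi (j + k)%N.
  elim: k => [|k ih]; first by rewrite addn0.
  rewrite addnS => jk; exact: le_trans (ih (ltnW jk)) (step_time_mono jk).
move=> iN; apply/andP; split.
  by have := mono i 0; rewrite add0n step_time_first; exact.
apply: (@le_trans _ _ (step_time phi (step_num phi))); last by rewrite step_time_last.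
by have := mono (step_num phi - i)%N i; rewrite subnKC//; exact.
Qed.

Lemma step_val_L2 T (phi : step_process w T) i : (i < step_num phi)%N -> L2 (step_val phi i).
Proof.
move=> iN; split; first exact: known_at_measurable (step_val_known iN).
exact: step_val_square_integrable.
Qed.

(** The difference of two elementary integrands on different subdivisions is
    handled as a single family indexed by the disjoint union of the cells,
    without a common refinement. *)
Lemma step_isometry T (phi psi : step_process w T) :
  (\int[P]_x ((step_integral phi x - step_integral psi x) ^+ 2)%:E =
   \int[P]_x \int[lebesgue_measure]_(s in `[0%R, T])
     ((step_fun phi s x - step_fun psi s x) ^+ 2)%:E)%E.
Proof.
pose I := ('I_(step_num phi) + 'I_(step_num psi))%type.
pose a (k : I) := match k with inl i => step_time phi i | inr j => step_time psi j end.
pose b (k : I) := match k with inl i => step_time phi i.+1 | inr j => step_time psi j.+1 end.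
pose xi (k : I) x := match k with inl i => step_val phi i x | inr j => (-1) * step_val psi j x end.
have := @family_isometry I a b xi T.
have -> : (fun x => ((\sum_i xi i x * inc (a i) (b i) x) ^+ 2)%:E) =
  (fun x => ((step_integral phi x - step_integral psi x) ^+ 2)%:E).
  apply/funext => x; congr (_ ^+ 2)%:E; rewrite big_sumType/=; congr (_ + _).
  by rewrite /step_integral -sumrN; apply: eq_bigr => i _; rewrite mulN1r mulNr.
have -> : (fun x => \int[lebesgue_measure]_(s in `[0%R, T])
     ((\sum_i xi i x * \1_`[a i, b i[ s) ^+ 2)%:E)%E =
  (fun x => \int[lebesgue_measure]_(s in `[0%R, T])
     ((step_fun phi s x - step_fun psi s x) ^+ 2)%:E)%E.
  apply/funext => x; apply: eq_integral => s _; congr (_ ^+ 2)%:E.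
  rewrite big_sumType/=; congr (_ + _).
  by rewrite /step_fun -sumrN; apply: eq_bigr => i _; rewrite mulN1r mulNr.
apply.
- by case=> i /=; have /andP[] := step_process_bounds (ltnW (ltn_ord i)).
- by case=> i /=; exact: step_time_mono.
- by case=> i /=; have /andP[] := step_process_bounds (ltn_ord i).
- case=> i /=; first exact: step_val_known.
  by apply: known_atM; [exact: known_at_cst|exact: step_val_known].
- case=> i /=; first exact: step_val_L2.
  by apply: L2Z; exact: step_val_L2.
Qed.

Lemma step_integral_L2 T (phi : step_process w T) : L2 (step_integral phi).
Proof.
rewrite /step_integral; apply: L2_sum => i.
apply: (known_mul_L2 (s := step_time phi i) (t := step_time phi i.+1) (g := id)) => //.
- by have /andP[] := step_process_bounds (ltnW (ltn_ord i)).
- exact: step_time_mono.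
- exact: step_val_known.
- exact: step_val_L2.
- apply: increment_L2 => //; last exact: step_time_mono.
  by have /andP[] := step_process_bounds (ltnW (ltn_ord i)).
Qed.

End ito_isometry.

(** * Continuous processes *)

Section processes.
Context {R : realType} {d : measure_display} {Omega : measurableType d}.
Variable P : probability Omega R.
Implicit Types X Y : R -> Omega -> R.
Local Notation mu := (@lebesgue_measure R).

Definition continuous_process X :=
  (forall t, 0 <= t -> measurable_fun setT (X t)) /\
  (forall omega, {within `[0, +oo[, continuous (fun t : R => X t omega)}).

Definition jointly_measurable X :=
  measurable_fun [set: (measurableTypeR R * Omega)%type] (fun z => X z.1 z.2).

Lemma continuous_processP X omega : continuous_process X ->
  forall t : R, 0 <= t -> X s omega @[s --> within `[0, +oo[ (nbhs t)] --> X t omega.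
Proof.
move=> [_ cX] t t0; have /subspace_continuousP := cX omega; apply.
by rewrite /= in_itv/= t0.
Qed.

Lemma mk_continuous_process X : (forall t, 0 <= t -> measurable_fun setT (X t)) ->
  (forall omega (t : R), 0 <= t -> X s omega @[s --> within `[0, +oo[ (nbhs t)] --> X t omega) ->
  continuous_process X.
Proof.
move=> mX cX; split => // omega; apply/subspace_continuousP => t.
by rewrite /= in_itv/= andbT => t0; exact: cX.
Qed.

Lemma continuous_processB X Y : continuous_process X -> continuous_process Y ->
  continuous_process (fun t omega => X t omega - Y t omega).
Proof.
move=> cX cY; apply: mk_continuous_process => [t t0|omega t t0].
  by apply: measurable_funB; [exact: cX.1|exact: cY.1].
by apply: cvgB; exact: continuous_processP.
Qed.

Lemma continuous_processM X Y : continuous_process X -> continuous_process Y ->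
  continuous_process (fun t omega => X t omega * Y t omega).
Proof.
move=> cX cY; apply: mk_continuous_process => [t t0|omega t t0].
  by apply: measurable_funM; [exact: cX.1|exact: cY.1].
by apply: cvgM; exact: continuous_processP.
Qed.

Lemma continuous_process_fun (f : R -> R) : {within `[0, +oo[, continuous f} ->
  continuous_process (fun t _ => f t).
Proof. by []. Qed.

Lemma continuous_process_sum (I : Type) (r : seq I) (F : I -> R -> Omega -> R) :
  (forall i, continuous_process (F i)) ->
  continuous_process (fun t omega => \sum_(i <- r) F i t omega).
Proof.
move=> cF; apply: mk_continuous_process => [t t0|omega t t0].
  by apply: measurable_sum => i; exact: (cF i).1.
elim: r => [|i r ih].
  by under eq_fun do rewrite big_nil; rewrite big_nil; exact: cvg_cst.
under eq_fun do rewrite big_cons; rewrite big_cons.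
by apply: cvgD => //; exact: continuous_processP.
Qed.

Lemma continuous_process_mulmx m n (M : 'M[R]_(m, n)) (x : R -> Omega -> 'cV[R]_n) i :
  (forall j, continuous_process (fun t omega => x t omega j 0)) ->
  continuous_process (fun t omega => (M *m x t omega) i 0).
Proof.
move=> cx; under eq_fun do under eq_fun do rewrite mxE.
apply: continuous_process_sum => j; apply: continuous_processM => //.
by apply: continuous_process_fun => ?; exact: cvg_cst.
Qed.

Lemma continuous_process_path X omega T : continuous_process X ->
  {within `[0, T], continuous (fun t : R => X t omega)}.
Proof.
move=> [_ cX]; apply: continuous_subspaceW (cX omega) => s /=.
by rewrite !in_itv/= => /andP[->].
Qed.

Lemma continuous_process_integrable X omega T : continuous_process X ->
  mu.-integrable `[0, T] (EFin \o (fun s => X s omega)).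
Proof.
move=> cX; apply: continuous_compact_integrable; first exact: segment_compact.
exact: continuous_process_path.
Qed.

Let grid (k : nat) (s : R) : R := (Num.truncn (k.+1%:R * s))%:R / k.+1%:R.

Let grid_ge0 k s : 0 <= grid k s.
Proof. by rewrite divr_ge0. Qed.

Let grid_cvg s : grid k s @[k --> \oo] --> Num.max 0 s.
Proof.
have h k : Num.max 0 s - k.+1%:R^-1 <= grid k s <= Num.max 0 s.
  have k0 : (0 : R) < k.+1%:R by [].
  have [s0|s0] := leP 0 s.
    have /truncn_itv/andP[h1 h2] : 0 <= k.+1%:R * s by rewrite mulr_ge0.
    rewrite /grid; apply/andP; split; last by rewrite ler_pdivrMr// [leRHS]mulrC.
    by rewrite lerBlDr -[X in _ / _ + X]mul1r -mulrDl natr1 ler_pdivlMr// [leLHS]mulrC ltW.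
  rewrite /grid (_ : Num.truncn _ = 0%N) ?mul0r ?lexx ?andbT ?sub0r ?oppr_le0//.
  by apply/truncn0Pn; rewrite -ltNge (lt_trans _ ltr01)// pmulr_rlt0.
apply: (squeeze_cvgr (f := fun k => Num.max 0 s - k.+1%:R^-1) (h := cst (Num.max 0 s))).
- by apply: nearW => k; exact: h.
- rewrite -[X in _ --> X]subr0; apply: cvgB; first exact: cvg_cst.
  exact: cvg_harmonic.
- exact: cvg_cst.
Qed.

(** The process is the pointwise limit of its discretizations on finer and
    finer grids. Negative times are sent to 0 because nothing is known about
    the process there. *)
Lemma continuous_process_measurable X : continuous_process X ->
  jointly_measurable (fun s => X (Num.max 0 s)).
Proof.
move=> cX; rewrite /jointly_measurable.
apply: (measurable_fun_cvg (h := fun k z => X (grid k z.1) z.2)); last first.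
  move=> [s omega] _ /=.
  apply: (cvg_comp (fun k => grid k s) (fun s => X s omega)
    (G := within `[0, +oo[ (nbhs (Num.max 0 s)))); last first.
    by apply: continuous_processP => //; rewrite le_max lexx.
  move=> U /= nU; near=> k.
  have : grid k s \in `[0, +oo[ -> U (grid k s) by near: k; exact: grid_cvg nU.
  by apply; rewrite in_itv/= grid_ge0.
move=> k _ B mB; rewrite setTI.
rewrite (_ : _ @^-1` B = \bigcup_j ([set s | Num.truncn (k.+1%:R * s) = j] `*`
    (X (j%:R / k.+1%:R) @^-1` B))); last first.
  apply/seteqP; split => [[s omega] /= XB|[s omega] [j _ []] /= <- //].
  by exists (Num.truncn (k.+1%:R * s)).
apply: bigcupT_measurable => j; apply: measurableX.
  apply: is_interval_measurable => x y /= xj yj z /andP[xz zy].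
  apply/eqP; rewrite eqn_leq; apply/andP; split.
    by rewrite -[leqRHS]yj le_truncn// ler_pM2l.
  by rewrite -[leqLHS]xj le_truncn// ler_pM2l.
by rewrite -[X in measurable X]setTI; apply: cX.1 => //; rewrite divr_ge0.
Unshelve. all: by end_near. Qed.

Lemma step_fun_measurable (w : R -> {RV P >-> R}) T (phi : step_process w T) :
  jointly_measurable (step_fun phi).
Proof.
rewrite /jointly_measurable /step_fun; apply: measurable_sum => i.
apply: measurable_funM.
  apply: measurableT_comp; last exact: measurable_snd.
  exact: known_at_measurable (step_val_known (ltn_ord i)).
by apply: measurableT_comp; last exact: measurable_fst; exact: measurable_indic.
Qed.

Section tonelli.
Variables (g : R -> Omega -> R) (T : R).
Hypotheses (mg : jointly_measurable g) (g0 : forall s omega, 0 <= g s omega).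

Let h (z : measurableTypeR R * Omega) : \bar R := (g z.1 z.2 * \1_`[0, T] z.1)%:E.

Let mh : measurable_fun setT h.
Proof.
apply/measurable_EFinP; apply: measurable_funM => //.
by apply: measurableT_comp; last exact: measurable_fst; exact: measurable_indic.
Qed.

Let h0 z : (0 <= h z)%E.
Proof. by rewrite lee_fin mulr_ge0// indicE. Qed.

Let inner omega : (\int[mu]_(s in `[0%R, T]) (g s omega)%:E = \int[mu]_s h (s, omega))%E.
Proof.
rewrite integral_mkcond; apply: eq_integral => s _.
by rewrite /h/= patchE indicE; case: ifP => _; rewrite ?mulr1 ?mulr0.
Qed.

Lemma process_tonelli :
  (\int[P]_omega \int[mu]_(s in `[0%R, T]) (g s omega)%:E =
   \int[mu]_(s in `[0%R, T]) \int[P]_omega (g s omega)%:E)%E.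
Proof.
under eq_integral do rewrite inner.
rewrite -(fubini_tonelli h mh h0) [RHS]integral_mkcond; apply: eq_integral => s _.
rewrite patchE /h/= indicE; case: ifP => _ /=.
  by under eq_integral do rewrite mulr1.
by under eq_integral do rewrite mulr0; rewrite integral0.
Qed.

Lemma measurable_time_integral :
  measurable_fun setT (fun omega => \int[mu]_(s in `[0%R, T]) (g s omega)%:E)%E.
Proof.
under eq_fun do rewrite inner.
exact: (measurable_fun_fubini_tonelli_G h mh h0).
Qed.

Lemma measurable_expectation_process :
  measurable_fun [set: R] (fun s => \int[P]_omega (g s omega)%:E)%E.
Proof.
apply: (measurable_fun_fubini_tonelli_F (fun z : measurableTypeR R * Omega => (g z.1 z.2)%:E)).
  exact/measurable_EFinP.
by move=> z; rewrite lee_fin.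
Qed.

End tonelli.

Definition mean_sq (Z : Omega -> R) := (\int[P]_omega (Z omega ^+ 2)%:E)%E.

Definition time_mean_sq T X :=
  (\int[P]_omega \int[mu]_(s in `[0%R, T]) ((X s omega) ^+ 2)%:E)%E.

Lemma eq_time_mean_sq T X Y :
  (forall s omega, 0 <= s -> s <= T -> X s omega = Y s omega) ->
  time_mean_sq T X = time_mean_sq T Y.
Proof.
move=> XY; apply: eq_integral => omega _; apply: eq_integral => s.
by rewrite inE/= in_itv/= => /andP[s0 sT]; rewrite XY.
Qed.

End processes.

(** * Mean-square estimates *)

Section squares.
Context {R : realType} {d : measure_display} {T : measurableType d}.
Variable mu : {measure set T -> \bar R}.

Lemma integral_sqr_add3 (D : set T) (X Y Z : T -> R) : measurable D ->
  measurable_fun D X -> measurable_fun D Y -> measurable_fun D Z ->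
  (\int[mu]_(x in D) ((X x + Y x + Z x) ^+ 2)%:E <=
   3%:E * (\int[mu]_(x in D) (X x ^+ 2)%:E + \int[mu]_(x in D) (Y x ^+ 2)%:E +
           \int[mu]_(x in D) (Z x ^+ 2)%:E))%E.
Proof.
move=> mD mX mY mZ.
have msq (f : T -> R) : measurable_fun D f -> measurable_fun D (fun x => (f x ^+ 2)%:E).
  by move=> mf; apply/measurable_EFinP; exact: measurable_funX.
have sq0 (f : T -> R) x : D x -> (0 <= (f x ^+ 2)%:E)%E by rewrite lee_fin sqr_ge0.
rewrite -ge0_integralD//; [|exact: sq0|exact: msq|exact: sq0|exact: msq].
rewrite -ge0_integralD//; last 4 first.
- by move=> x Dx; rewrite adde_ge0 ?sq0.
- by apply: emeasurable_funD; exact: msq.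
- exact: sq0.
- exact: msq.
rewrite -ge0_integralZl//; last 2 first.
- by apply: emeasurable_funD; [apply: emeasurable_funD|]; exact: msq.
- by move=> x Dx; rewrite !adde_ge0 ?sq0.
apply: ge0_le_integral => //.
- by move=> x Dx; rewrite lee_fin sqr_ge0.
- by apply: msq; do 2?apply: measurable_funD.
- by apply: measurable_funeM; apply: emeasurable_funD; [apply: emeasurable_funD|]; exact: msq.
- move=> x Dx; rewrite -!EFinD -EFinM lee_fin.
  have := sqr_ge0 (X x - Y x); have := sqr_ge0 (X x - Z x); have := sqr_ge0 (Y x - Z x).
  nra.
Qed.

End squares.

Section time_squares.
Context {R : realType} {d : measure_display} {Omega : measurableType d}.
Variable P : probability Omega R.
Local Notation mu := (@lebesgue_measure R).

Lemma jointly_measurable_section (X : R -> Omega -> R) omega :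
  jointly_measurable X -> measurable_fun [set: R] (X ^~ omega).
Proof.
move=> mX.
exact: (measurableT_comp (f := fun z : (measurableTypeR R * Omega)%type => X z.1 z.2)
  (g := fun s : measurableTypeR R => (s, omega)) mX (measurable_pair2 omega)).
Qed.

Lemma jointly_measurableB (X Y : R -> Omega -> R) : jointly_measurable X ->
  jointly_measurable Y -> jointly_measurable (fun s omega => X s omega - Y s omega).
Proof. by move=> mX mY; exact: measurable_funB. Qed.

Lemma jointly_measurable_sqr (X : R -> Omega -> R) : jointly_measurable X ->
  jointly_measurable (fun s omega => X s omega ^+ 2).
Proof. by move=> mX; exact: measurable_funX. Qed.

Lemma time_mean_sq_add3 T (X Y Z : R -> Omega -> R) :
  jointly_measurable X -> jointly_measurable Y -> jointly_measurable Z ->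
  (time_mean_sq P T (fun s omega => X s omega + Y s omega + Z s omega)%R <=
   3%:E * (time_mean_sq P T X + time_mean_sq P T Y + time_mean_sq P T Z))%E.
Proof.
move=> mX mY mZ; rewrite /time_mean_sq.
have msq (X' : R -> Omega -> R) : jointly_measurable X' ->
    measurable_fun setT (fun omega => \int[mu]_(s in `[0%R, T]) (X' s omega ^+ 2)%:E)%E.
  move=> mX'; apply: (measurable_time_integral (g := fun s omega => X' s omega ^+ 2)) => //.
  - exact: jointly_measurable_sqr.
  - by move=> s omega; exact: sqr_ge0.
have sq0 (X' : R -> Omega -> R) omega : (0 <= \int[mu]_(s in `[0%R, T]) (X' s omega ^+ 2)%:E)%E.
  by apply: integral_ge0 => s _; rewrite lee_fin sqr_ge0.
rewrite -ge0_integralD//; [|exact: msq|exact: msq].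
rewrite -ge0_integralD//; last 3 first.
- by move=> omega _; apply: adde_ge0; exact: sq0.
- by apply: emeasurable_funD; exact: msq.
- exact: msq.
rewrite -ge0_integralZl//; last 2 first.
- by apply: emeasurable_funD; [apply: emeasurable_funD|]; exact: msq.
- by move=> omega _; apply: adde_ge0; [apply: adde_ge0|]; exact: sq0.
apply: ge0_le_integral => //.
- by move=> omega _; exact: (sq0 (fun s omega => X s omega + Y s omega + Z s omega)).
- apply: (msq (fun s omega => X s omega + Y s omega + Z s omega)).
  by apply: measurable_funD => //; exact: measurable_funD.
- by apply: measurable_funeM; apply: emeasurable_funD; [apply: emeasurable_funD|]; exact: msq.
- move=> omega _; apply: integral_sqr_add3 => //;
  by apply: measurable_funTS; exact: jointly_measurable_section.
Qed.

(** Cauchy-Schwarz against the constant 1, from the nonnegativity of the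
    variance of [g] over [[0, t]]. *)
Lemma sqr_time_integral_le (g : R -> R) (t : R) : 0 <= t ->
  mu.-integrable `[0, t] (EFin \o g) ->
  mu.-integrable `[0, t] (EFin \o (fun s => g s ^+ 2)) ->
  (((\int[mu]_(s in `[0, t]) g s) ^+ 2)%:E <=
    t%:E * \int[mu]_(s in `[0%R, t]) (g s ^+ 2)%:E)%E.
Proof.
move=> t0 ig ig2.
have -> : (\int[mu]_(s in `[0%R, t]) (g s ^+ 2)%:E)%E = (\int[mu]_(s in `[0, t]) (g s ^+ 2))%:E.
  by rewrite /Rintegral fineK//; exact: integrable_fin_num.
rewrite -EFinM lee_fin.
have mt : mu `[0%R, t]%classic = t%:E.
  rewrite lebesgue_measure_itv/= lte_fin; case: ltP => [_|t0']; first by rewrite oppr0 adde0.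
  by rewrite (_ : t = 0)//; apply/eqP; rewrite eq_le t0' t0.
set I := \int[mu]_(s in `[0, t]) g s; set I2 := \int[mu]_(s in `[0, t]) (g s ^+ 2).
have [t0'|tpos] := leP t 0.
  have tz : t = 0 by apply/eqP; rewrite eq_le t0' t0.
  rewrite tz mul0r (_ : I = 0) ?expr0n// /I tz set_itv1 Rintegral_set1//.
have icst c : mu.-integrable `[0, t] (EFin \o (fun=> c)).
  apply: continuous_compact_integrable; first exact: segment_compact.
  by move=> s; exact: cvg_cst.
have : 0 <= \int[mu]_(s in `[0, t]) ((g s - I / t) ^+ 2).
  by apply: Rintegral_ge0 => s _; exact: sqr_ge0.
have -> : \int[mu]_(s in `[0, t]) ((g s - I / t) ^+ 2) = I2 - (2 * (I / t)) * I + (I / t) ^+ 2 * t.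
  transitivity (\int[mu]_(s in `[0, t]) ((g s ^+ 2 - (2 * (I / t)) * g s) + (I / t) ^+ 2)).
    by apply: eq_Rintegral => s _; ring.
  have i2g : mu.-integrable `[0, t] (EFin \o (fun s => (2 * (I / t)) * g s)).
    exact: (integrableZl _ (2 * (I / t)) ig).
  rewrite RintegralD//; last first.
    exact: (integrableB _ ig2 i2g).
  rewrite RintegralB// RintegralZl// Rintegral_cst//.
  by congr (_ + _ * _); rewrite -[RHS]/(fine t%:E); congr fine; exact: mt.
move=> h; have : 0 <= t * (I2 - 2 * (I / t) * I + (I / t) ^+ 2 * t) by rewrite mulr_ge0.
rewrite (_ : t * _ = t * I2 - I ^+ 2); last by field; rewrite gt_eqF.
by rewrite subr_ge0.
Qed.

(** The integral splits into those of the positive and the negative part, to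
    which Tonelli applies. *)
Lemma measurable_Rintegral_time (X : R -> Omega -> R) T : continuous_process X ->
  measurable_fun setT (fun omega => \int[mu]_(s in `[0, T]) X s omega).
Proof.
move=> cX; rewrite /Rintegral.
apply: (measurableT_comp (f := fine)); first exact: fine_measurable.
have mX := continuous_process_measurable cX.
pose Xp s omega := Num.max (X (Num.max 0 s) omega) 0.
pose Xn s omega := Num.max (- X (Num.max 0 s) omega) 0.
have mXp : jointly_measurable Xp by exact: measurable_maxr.
have mXn : jointly_measurable Xn.
  by apply: measurable_maxr => //; exact: measurable_funN.
rewrite (_ : (fun omega => _) = (fun omega => \int[mu]_(s in `[0%R, T]) (Xp s omega)%:E -
    \int[mu]_(s in `[0%R, T]) (Xn s omega)%:E)%E); last first.
  apply/funext => omega; rewrite integralE; congr (_ - _)%E; apply: eq_integral => s;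
    rewrite inE/= in_itv/= => /andP[s0 _].
    by rewrite /Xp (max_r s0) funeposE EFin_max.
  by rewrite /Xn (max_r s0) funenegE EFin_max.
apply: emeasurable_funB.
  by apply: measurable_time_integral => // s omega; rewrite le_max lexx orbT.
by apply: measurable_time_integral => // s omega; rewrite le_max lexx orbT.
Qed.

Lemma mulmx_sqr_bound m n (M : 'M[R]_(m, n)) i : exists2 c : R, 0 <= c &
  forall z : 'cV[R]_n, ((M *m z) i 0) ^+ 2 <= c * \sum_j (z j 0) ^+ 2.
Proof.
suff [c c0 h] : exists2 c : R, 0 <= c & forall z : 'cV[R]_n,
    (\sum_(j <- index_enum 'I_n) M i j * z j 0) ^+ 2 <= c * \sum_(j <- index_enum 'I_n) (z j 0) ^+ 2.
  by exists c => // z; rewrite mxE.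
elim: (index_enum _) => [|j s [c c0 ih]].
  by exists 0 => // z; rewrite !big_nil expr0n mulr0.
exists (2 * (M i j ^+ 2 + c)) => [|z]; first by rewrite mulr_ge0// addr_ge0// sqr_ge0.
rewrite !big_cons; have := ih z.
set S := \sum_(_ <- _) _; set Q := \sum_(_ <- _) _ => SQ.
have Q0 : 0 <= Q by apply: sumr_ge0 => k _; exact: sqr_ge0.
have h0 := sqr_ge0 (M i j * z j 0 - S).
have h1 : 0 <= c * z j 0 ^+ 2 by rewrite mulr_ge0// sqr_ge0.
have h2 : 0 <= M i j ^+ 2 * Q by rewrite mulr_ge0// sqr_ge0.
nra.
Qed.

End time_squares.

Section ito_contraction.
Context {R : realType} {d : measure_display} {Omega : measurableType d}.
Variable P : probability Omega R.
Variable w : R -> {RV P >-> R}.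
Hypothesis hw : standard_wiener w.
Local Notation mu := (@lebesgue_measure R).
Local Notation tms := (time_mean_sq P).
Local Notation ms := (mean_sq P).

Lemma cvge0_le (u : nat -> \bar R) (e : R) : 0 < e -> u @ \oo --> 0%E ->
  \forall k \near \oo, (u k <= e%:E)%E.
Proof.
move=> e0 /fine_cvgP[uf /cvgr0_norm_le/(_ _ e0) ue].
near=> k; have kf : u k \is a fin_num by near: k.
rewrite -(fineK kf) lee_fin (le_trans (ler_norm _))//.
by near: k.
Unshelve. all: by end_near. Qed.

(** The isometry passes to the limit. The factor 9, instead of 1, comes from
    applying [(a + b + c) ^ 2 <= 3 (a ^ 2 + b ^ 2 + c ^ 2)] twice; for
    uniqueness any constant will do. *)
Lemma ito_integral_contraction f g T (J J' : {RV P >-> R}) :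
  continuous_process f -> continuous_process g ->
  is_ito_integral w f T J -> is_ito_integral w g T J' ->
  (ms (fun omega => (J omega - J' omega)%R) <=
   9%:E * tms T (fun s omega => f s omega - g s omega)%R)%E.
Proof.
move=> cf cg [phi [phif phiJ]] [psi [psig psiJ]].
have mf := continuous_process_measurable cf.
have mg := continuous_process_measurable cg.
pose V := tms T (fun s omega => f s omega - g s omega).
pose a k := tms T (fun s omega => f s omega - step_fun (phi k) s omega).
pose b k := tms T (fun s omega => g s omega - step_fun (psi k) s omega).
pose c k := ms (fun omega => J omega - step_integral (phi k) omega).
pose e k := ms (fun omega => J' omega - step_integral (psi k) omega).
have V0 : (0 <= V)%E.
  by apply: integral_ge0 => omega _; apply: integral_ge0 => s _; rewrite lee_fin sqr_ge0.
have main k : (ms (fun omega => (J omega - J' omega)%R) <=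
    3%:E * (c k + 3%:E * (a k + V + b k) + e k))%E.
  rewrite (_ : ms _ = \int[P]_omega (((J omega - step_integral (phi k) omega)%R +
      (step_integral (phi k) omega - step_integral (psi k) omega) +
      (step_integral (psi k) omega - J' omega)) ^+ 2)%:E)%E; last first.
    by apply: eq_integral => omega _; congr (_ ^+ 2)%:E; ring.
  have mI (phi' : step_process w T) : measurable_fun setT (step_integral phi').
    exact: (step_integral_L2 hw phi').1.
  apply: (le_trans (integral_sqr_add3 _ _ _ _ _)) => //; try exact: measurable_funB.
  rewrite lee_pmul2l// step_isometry// leeD//; last first.
    rewrite /e /mean_sq le_eqVlt; apply/orP; left; apply/eqP.
    by apply: eq_integral => omega _; congr EFin; rewrite -sqrrN opprB.
  rewrite leeD2l//.
  pose f' s := f (Num.max 0 s); pose g' s := g (Num.max 0 s).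
  have -> : a k = tms T (fun s omega => step_fun (phi k) s omega - f' s omega).
    apply: eq_integral => omega _; apply: eq_integral => s.
    rewrite inE/= in_itv/= => /andP[s0 _]; rewrite /f' max_r//.
    by congr EFin; rewrite -sqrrN opprB.
  have -> : b k = tms T (fun s omega => g' s omega - step_fun (psi k) s omega).
    by apply: eq_time_mean_sq => s omega s0 _; rewrite /g' max_r.
  have -> : V = tms T (fun s omega => f' s omega - g' s omega).
    by apply: eq_time_mean_sq => s omega s0 _; rewrite /f' /g' max_r.
  have m1 : jointly_measurable (fun s omega => step_fun (phi k) s omega - f' s omega).
    by apply: jointly_measurableB => //; exact: step_fun_measurable.
  have m3 : jointly_measurable (fun s omega => g' s omega - step_fun (psi k) s omega).
    by apply: jointly_measurableB => //; exact: step_fun_measurable.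
  apply: (le_trans _ (time_mean_sq_add3 P T m1 (jointly_measurableB mf mg) m3)).
  rewrite le_eqVlt; apply/orP; left; apply/eqP.
  by apply: eq_time_mean_sq => s omega _ _; rewrite /f' /g'; ring.
have {phif} ca : a @ \oo --> 0%E := phif.
have {psig} cb : b @ \oo --> 0%E := psig.
have {phiJ} cc : c @ \oo --> 0%E := phiJ.
have {psiJ} ce : e @ \oo --> 0%E := psiJ.
rewrite -/V; clearbody a b c e V; have [Vy|Vy] := eqVneq V +oo%E.
  by rewrite Vy gt0_muley ?leey.
have Vf : V \is a fin_num by rewrite ge0_fin_numE// lt_neqAle Vy leey.
apply/lee_addgt0Pr => eps eps0.
(* 24 = 3 * (1 + 3 * (1 + 1) + 1) is the total weight of the four errors in [main] *)
have d0 : 0 < eps / 24 by rewrite divr_gt0.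
have ea := cvge0_le d0 ca; have eb := cvge0_le d0 cb.
have ec := cvge0_le d0 cc; have ee := cvge0_le d0 ce.
near \oo => k.
apply: (le_trans (main k)).
apply: (@le_trans _ _ (3%:E * ((eps / 24)%:E +
    3%:E * ((eps / 24)%:E + V + (eps / 24)%:E) + (eps / 24)%:E))%E).
  have ha : (a k <= (eps / 24)%:E)%E by near: k.
  have hb : (b k <= (eps / 24)%:E)%E by near: k.
  have hc : (c k <= (eps / 24)%:E)%E by near: k.
  have he : (e k <= (eps / 24)%:E)%E by near: k.
  rewrite lee_pmul2l//; apply: leeD => //; apply: leeD => //.
  by rewrite lee_pmul2l//; apply: leeD => //; exact: leeD.
rewrite -(fineK Vf) -!EFinD -!EFinM -?EFinD -?EFinM -?EFinD lee_fin.
by rewrite le_eqVlt; apply/orP; left; apply/eqP; field.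
Unshelve. all: by end_near. Qed.

End ito_contraction.

(** * Uniqueness of solutions *)

Section uniqueness.
Context {R : realType} {d : measure_display} {Omega : measurableType d}.
Variable P : probability Omega R.
Variable w : R -> {RV P >-> R}.
Hypothesis hw : standard_wiener w.
Variables (n : nat) (F G : 'M[R]_n) (x0 : 'cV[R]_n).
Local Notation mu := (@lebesgue_measure R).
Local Notation tms := (time_mean_sq P).
Local Notation ms := (mean_sq P).

Lemma sde_continuous_process (x : R -> Omega -> 'cV[R]_n) i :
  linear_sde_solution w F G x0 x -> continuous_process (fun t omega => x t omega i 0).
Proof.
move=> sx; split => [t t0|omega]; last exact: sde_continuous sx omega i.
exact: known_at_measurable (sde_adapted sx i t0).
Qed.

Variables (x y : R -> Omega -> 'cV[R]_n).
Hypotheses (sx : linear_sde_solution w F G x0 x) (sy : linear_sde_solution w F G x0 y).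

Let z t omega : 'cV[R]_n := x t omega - y t omega.
Let q t omega : R := \sum_i (z t omega i 0) ^+ 2.
Let v T := (\int[P]_omega \int[mu]_(s in `[0%R, T]) (q s omega)%:E)%E.

Let zE t omega i : z t omega i 0 = x t omega i 0 - y t omega i 0.
Proof. by rewrite /z !mxE. Qed.

Let cz i : continuous_process (fun t omega => z t omega i 0).
Proof.
under eq_fun do under eq_fun do rewrite zE.
by apply: continuous_processB; exact: sde_continuous_process.
Qed.

Let cq : continuous_process q.
Proof. by apply: continuous_process_sum => i; exact: continuous_processM. Qed.

Let q0 t omega : 0 <= q t omega.
Proof. by apply: sumr_ge0 => i _; exact: sqr_ge0. Qed.

(* [q] extended to negative times by its value at 0 *)
Let qp s := q (Num.max 0 s).

Let mqp : jointly_measurable qp.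
Proof. exact: continuous_process_measurable. Qed.

Let qpE s : 0 <= s -> qp s = q s.
Proof. by move=> s0; rewrite /qp max_r. Qed.

Let v_qp T : v T = (\int[P]_omega \int[mu]_(s in `[0%R, T]) (qp s omega)%:E)%E.
Proof.
apply: eq_integral => omega _; apply: eq_integral => s.
by rewrite inE/= in_itv/= => /andP[s0 _]; rewrite qpE.
Qed.

Let time_integral_measurable (g : R -> Omega -> R) T : continuous_process g ->
  (forall s omega, 0 <= g s omega) ->
  measurable_fun setT (fun omega => \int[mu]_(s in `[0%R, T]) (g s omega)%:E)%E.
Proof.
move=> cg g0.
rewrite (_ : (fun omega => _) =
    (fun omega => \int[mu]_(s in `[0%R, T]) (g (Num.max 0 s) omega)%:E)%E); last first.
  apply/funext => omega; apply: eq_integral => s.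
  by rewrite inE/= in_itv/= => /andP[s0 _]; rewrite max_r.
by apply: measurable_time_integral => //; exact: continuous_process_measurable.
Qed.

Let path_measurable (g : R -> Omega -> R) T omega : continuous_process g ->
  measurable_fun (`[0, T]%classic : set (measurableTypeR R)) (fun s => (g s omega)%:E).
Proof.
by move=> cg; exact: measurable_int (continuous_process_integrable omega T cg).
Qed.

Let cz2 i : continuous_process (fun t omega => (z t omega i 0) ^+ 2).
Proof. exact: continuous_processM. Qed.

Let v_sum T : v T = (\sum_i tms T (fun t omega => z t omega i 0%R))%E.
Proof.
rewrite /v /tms.
rewrite -ge0_integral_sum//; last 2 first.
- move=> i; apply: (time_integral_measurable T (cz2 i)) => s omega; exact: sqr_ge0.
- by move=> i omega _; apply: integral_ge0 => s _; rewrite lee_fin sqr_ge0.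
apply: eq_integral => omega _.
rewrite -ge0_integral_sum//; last 2 first.
- by move=> i; exact: (path_measurable omega (cz2 i)).
- by move=> i s _; rewrite lee_fin; exact: sqr_ge0.
by apply: eq_integral => s _; rewrite sumEFin.
Qed.

Let v_ge0 T : (0 <= v T)%E.
Proof. by apply: integral_ge0 => omega _; apply: integral_ge0 => s _; rewrite lee_fin. Qed.

Let v_lty T : 0 <= T -> (v T < +oo)%E.
Proof.
move=> T0; rewrite v_sum; apply: lte_sum_pinfty => i _.
have cx := sde_continuous_process i sx; have cy := sde_continuous_process i sy.
have m0 : jointly_measurable (fun (s : R) (omega : Omega) => 0 : R) by exact: measurable_cst.
have mx := continuous_process_measurable cx.
have my : jointly_measurable (fun s omega => - y (Num.max 0 s) omega i 0).
  by apply: measurable_funN; exact: continuous_process_measurable cy.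
rewrite (@eq_time_mean_sq _ _ _ P T _ (fun s omega => x (Num.max 0 s) omega i 0 +
    - y (Num.max 0 s) omega i 0 + 0)); last first.
  by move=> s omega s0 _; rewrite zE (max_r s0) addr0.
apply: (le_lt_trans (time_mean_sq_add3 P T mx my m0)).
rewrite lte_mul_pinfty//; apply: lte_add_pinfty; first apply: lte_add_pinfty.
- rewrite (@eq_time_mean_sq _ _ _ P T _ (fun s omega => x s omega i 0)) ?(sde_square_integrable sx)//.
  by move=> s omega s0 _; rewrite (max_r s0).
- have -> : tms T (fun s omega => - y (Num.max 0 s) omega i 0) =
      tms T (fun s omega => y s omega i 0).
    apply: eq_integral => omega _; apply: eq_integral => s.
    by rewrite inE/= in_itv/= => /andP[s0 _]; rewrite (max_r s0) sqrrN.
  exact: sde_square_integrable sy T i T0.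
- rewrite /time_mean_sq [X in (X < _)%E](_ : _ = 0%E)//.
  by apply: integral0_eq => omega _; apply: integral0_eq => s _; rewrite expr0n.
Qed.

Let v_mono a b : a <= b -> (v a <= v b)%E.
Proof.
move=> ab; apply: ge0_le_integral => //.
- by move=> omega _; apply: integral_ge0 => s _; rewrite lee_fin.
- exact: time_integral_measurable.
- exact: time_integral_measurable.
- move=> omega _; apply: ge0_subset_integral => //.
  + exact: path_measurable.
  + by move=> s _; rewrite lee_fin.
  + by move=> s /=; rewrite !in_itv/= => /andP[-> /le_trans->].
Qed.

Let mulmx_le (M : 'M[R]_n) i : exists2 c : R, 0 <= c & forall T,
  (tms T (fun s omega => (M *m z s omega) i 0%R) <= c%:E * v T)%E.
Proof.
have [c c0 h] := mulmx_sqr_bound M i; exists c => // T.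
have cM : continuous_process (fun s omega => (M *m z s omega) i 0).
  exact: continuous_process_mulmx.
have cM2 : continuous_process (fun s omega => ((M *m z s omega) i 0) ^+ 2).
  exact: continuous_processM.
rewrite /v -ge0_integralZl//; last 2 first.
- exact: time_integral_measurable.
- by move=> omega _; apply: integral_ge0 => s _; rewrite lee_fin.
apply: ge0_le_integral => //.
- by move=> omega _; apply: integral_ge0 => s _; rewrite lee_fin sqr_ge0.
- by apply: (time_integral_measurable T cM2) => s omega; exact: sqr_ge0.
- by apply: measurable_funeM; exact: time_integral_measurable.
move=> omega _; rewrite -ge0_integralZl//; last 2 first.
- exact: path_measurable.
- by move=> s _; rewrite lee_fin.
apply: ge0_le_integral => //.
- by move=> s _; rewrite lee_fin sqr_ge0.
- exact: (path_measurable omega cM2).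
- by apply: measurable_funeM; exact: (path_measurable omega cq).
- by move=> s _; rewrite -EFinM lee_fin.
Qed.

(** The initial value cancels in the difference of the two equations. The
    drift is estimated by Cauchy-Schwarz and the noise by
    [ito_integral_contraction]. *)
Let coord_le i T : 0 <= T -> exists2 K : R, 0 <= K & forall t, 0 <= t -> t <= T ->
  (ms (fun omega => z t omega i 0%R) <= K%:E * v t)%E.
Proof.
move=> T0; have [cF cF0 hF] := mulmx_le F i; have [cG cG0 hG] := mulmx_le G i.
exists (3 * (T * cF + 9 * cG)); first by rewrite !(mulr_ge0, addr_ge0).
move=> t t0 tT.
have [J IJ Jx] := sde_equation sx i t0; have [J' IJ' J'y] := sde_equation sy i t0.
have cx M := @continuous_process_mulmx _ _ _ _ _ M x i (fun j => sde_continuous_process j sx).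
have cy M := @continuous_process_mulmx _ _ _ _ _ M y i (fun j => sde_continuous_process j sy).
have cM M : continuous_process (fun s omega => (M *m z s omega) i 0).
  exact: continuous_process_mulmx.
have JJ : (ms (fun omega => (J omega - J' omega)%R) <= 9%:E * (cG%:E * v t))%E.
  apply: (le_trans (ito_integral_contraction hw (cx G) (cy G) IJ IJ')).
  rewrite lee_pmul2l//; apply: le_trans (hG t).
  rewrite le_eqVlt; apply/orP; left; apply/eqP; apply: eq_time_mean_sq => s omega _ _.
  by rewrite /z mulmxBr !mxE.
pose I omega := \int[mu]_(s in `[0, t]) (F *m z s omega) i 0.
have mI : measurable_fun setT I by exact: measurable_Rintegral_time.
have II : (ms I <= t%:E * (cF%:E * v t))%E.
  apply: (@le_trans _ _ (t%:E * tms t (fun s omega => (F *m z s omega) i 0%R))%E); last first.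
    by rewrite lee_wpmul2l.
  have cF2 : continuous_process (fun s omega => ((F *m z s omega) i 0) ^+ 2).
    exact: continuous_processM.
  rewrite -ge0_integralZl//; last 2 first.
  - by apply: (time_integral_measurable t cF2) => s omega; exact: sqr_ge0.
  - by move=> omega _; apply: integral_ge0 => s _; rewrite lee_fin sqr_ge0.
  apply: ge0_le_integral => //.
  - by move=> omega _; rewrite lee_fin sqr_ge0.
  - by apply/measurable_EFinP; exact: measurable_funX.
  - by apply: measurable_funeM; apply: (time_integral_measurable t cF2) => s omega; exact: sqr_ge0.
  - by move=> omega _; apply: (@sqr_time_integral_le _ (fun s => (F *m z s omega) i 0) t t0);
      [exact: (continuous_process_integrable omega t (cM F))|
       exact: (continuous_process_integrable omega t cF2)].
have m0 : measurable_fun setT (fun _ : Omega => 0 : R) by exact: measurable_cst.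
have mJJ : measurable_fun setT (fun omega => J omega - J' omega) by exact: measurable_funB.
have -> : ms (fun omega => z t omega i 0) =
    (\int[P]_omega ((I omega + (J omega - J' omega) + 0)%R ^+ 2)%:E)%E.
  apply: ge0_ae_eq_integral => //.
  - by apply/measurable_EFinP; apply: measurable_funX; exact: (cz i).1.
  - apply/measurable_EFinP; apply: measurable_funX.
    by apply: measurable_funD => //; exact: measurable_funD.
  - by move=> omega _; rewrite lee_fin sqr_ge0.
  - by move=> omega _; rewrite lee_fin sqr_ge0.
  apply: filterS2 Jx J'y => omega Jx J'y _; congr (_ ^+ 2)%:E.
  rewrite zE Jx J'y /I.
  under [X in _ = X + _ + _]eq_Rintegral do rewrite /z mulmxBr mxE [X in _ + X]mxE.
  rewrite RintegralB//; last 2 first.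
  - exact: (continuous_process_integrable omega t (cx F)).
  - exact: (continuous_process_integrable omega t (cy F)).
  by ring.
apply: (le_trans (integral_sqr_add3 P measurableT (measurable_funTS mI) mJJ m0)).
rewrite [X in (_ + _ + X)%E](_ : _ = 0%E); last first.
  by apply: integral0_eq => omega _; rewrite expr0n.
rewrite adde0 EFinM -muleA lee_pmul2l//.
rewrite EFinD ge0_muleDl ?lee_fin ?mulr_ge0//; apply: leeD.
  apply: (le_trans II); rewrite muleA -EFinM lee_wpmul2r// lee_fin ler_wpM2r//.
by apply: (le_trans JJ); rewrite muleA EFinM.
Qed.

Let exp_q_le T : 0 <= T -> exists2 K : R, 0 <= K & forall t, 0 <= t -> t <= T ->
  (\int[P]_omega (q t omega)%:E <= K%:E * v t)%E.
Proof.
move=> T0.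
have /choice[K hK] : forall i, exists K : R, 0 <= K /\ forall t, 0 <= t -> t <= T ->
    (ms (fun omega => z t omega i 0%R) <= K%:E * v t)%E.
  by move=> i; have [K K0 h] := coord_le i T0; exists K.
exists (\sum_i K i); first by apply: sumr_ge0 => i _; have [] := hK i.
move=> t t0 tT.
have -> : (\int[P]_omega (q t omega)%:E = \sum_i ms (fun omega => z t omega i 0%R))%E.
  rewrite -ge0_integral_sum//; last 2 first.
  - by move=> i; apply/measurable_EFinP; apply: (cz2 i).1.
  - by move=> i omega _; rewrite lee_fin sqr_ge0.
  by apply: eq_integral => omega _; rewrite sumEFin.
rewrite -sumEFin ge0_sume_distrl; last by move=> i _; rewrite lee_fin; have [] := hK i.
by apply: lee_sum => i _; have [_ h] := hK i; exact: h.
Qed.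

(** The mean square of the difference is at most [K * v b] on [[a, b]] and
    vanishes before [a], so that [v b <= K * (b - a) * v b <= v b / 2]; [v b]
    is finite. *)
Let v_step T K a b : (forall t, 0 <= t -> t <= T -> (\int[P]_omega (q t omega)%:E <= K%:E * v t)%E) ->
  0 <= K -> 0 <= a -> a <= b -> b <= T -> (b - a) * K <= 1 / 2 -> v a = 0%E -> v b = 0%E.
Proof.
move=> hK K0 a0 ab bT small va.
have b0 : 0 <= b by exact: le_trans ab.
have vbf : v b \is a fin_num by rewrite ge0_fin_numE ?v_lty ?v_ge0.
have fv0 : 0 <= fine (v b) by rewrite fine_ge0 ?v_ge0.
have : (v b <= (K * fine (v b) * (b - a))%:E)%E.
  rewrite [in leLHS]v_qp process_tonelli//; last by move=> s omega; exact: q0.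
  apply: (@le_trans _ _ (\int[mu]_(s in `[0%R, b]) ((K * fine (v b)) * \1_`[a, b] s)%:E)%E).
    apply: ge0_le_integral => //.
    - by move=> s _; apply: integral_ge0 => omega _; rewrite lee_fin q0.
    - by apply: measurable_funTS; apply: measurable_expectation_process => // s omega; exact: q0.
    - apply: measurable_funTS; apply/measurable_EFinP; exact: measurable_funM.
    - move=> s /=; rewrite in_itv/= => /andP[s0 sb].
      rewrite qpE//; apply: (le_trans (hK _ s0 (le_trans sb bT))).
      rewrite indicE mem_setE in_itv/= sb andbT.
      have [as_|sa] := leP a s; rewrite ?mulr1 ?mulr0.
        by rewrite EFinM (fineK vbf); apply: lee_wpmul2l; [rewrite lee_fin|exact: v_mono].
      have -> : v s = 0%E by apply/eqP; rewrite eq_le v_ge0 andbT -va v_mono// ltW.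
      by rewrite mule0.
  under eq_integral do rewrite EFinM.
  rewrite ge0_integralZl//; last 2 first.
  - by apply/measurable_EFinP; apply: measurable_indic; exact: measurable_itv.
  - by rewrite lee_fin mulr_ge0.
  rewrite [in leRHS]EFinM lee_wpmul2l ?lee_fin ?mulr_ge0//.
  rewrite integral_indic//= setIidl; last first.
    by move=> s /=; rewrite !in_itv/= => /andP[/(le_trans a0)->].
  rewrite lebesgue_measure_itv/= lte_fin; case: ifP => _; first by rewrite -EFinB.
  by rewrite lee_fin subr_ge0.
rewrite -[in X in (X <= _)%E -> _](fineK vbf) lee_fin => h.
rewrite -(fineK vbf); congr EFin.
have : (b - a) * K * fine (v b) <= 1 / 2 * fine (v b) by rewrite ler_wpM2r.
move: h; set f := fine _ in fv0 *; nra.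
Qed.

(** [T] is reached in [N] steps, each short enough for [v_step]. *)
Let v_eq0 T : 0 <= T -> v T = 0%E.
Proof.
move=> T0; have [K K0 hK] := exp_q_le T0.
pose N := (Num.truncn (2 * T * K)).+1.
have N0 : (0 : R) < N%:R by [].
have hN : 2 * T * K < N%:R by exact: truncnS_gt.
suff h k : (k <= N)%N -> v (k%:R * (T / N%:R)) = 0%E.
  by have := h N (leqnn _); rewrite mulrC divfK// gt_eqF.
elim: k => [_|k ih kN].
  rewrite mul0r /v; apply: integral0_eq => omega _.
  by rewrite set_itv1 integral_set1.
have dT : 0 <= T / N%:R by rewrite divr_ge0.
apply: (v_step hK K0 _ _ _ _ (ih (ltnW kN))).
- by rewrite mulr_ge0.
- by rewrite ler_wpM2r// ler_nat.
- by rewrite mulrA ler_pdivrMr// [leRHS]mulrC ler_wpM2r// ler_nat.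
- rewrite (_ : _ * K = T * K / N%:R); last by rewrite -natr1; ring.
  rewrite ler_pdivrMr//.
  by have := ltW hN; lra.
Qed.

Lemma sde_unique t i : 0 <= t ->
  {ae P, forall omega, x t omega i 0 = y t omega i 0}.
Proof.
move=> t0; have [K K0 hK] := coord_le i t0.
have := hK t t0 (lexx t); rewrite v_eq0// mule0 => h.
have mz : measurable_fun setT (fun omega => ((z t omega i 0) ^+ 2)%:E).
  by apply/measurable_EFinP; apply: (cz2 i).1.
have : (\int[P]_omega `|((z t omega i 0) ^+ 2)%:E| = 0)%E.
  under eq_integral do rewrite gee0_abs ?lee_fin ?sqr_ge0//.
  apply/eqP; rewrite eq_le h integral_ge0// => omega _.
  by rewrite lee_fin sqr_ge0.
move=> /(ae_eq_integral_abs P measurableT mz); apply: filterS => omega /(_ I) [/eqP].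
by rewrite sqrf_eq0 zE subr_eq0 => /eqP.
Qed.

End uniqueness.

(** * The exponential martingale *)

Section exponential_martingale.
Context {R : realType} {d : measure_display} {Omega : measurableType d}.
Variable P : probability Omega R.
Variable w : R -> {RV P >-> R}.
Hypothesis hw : standard_wiener w.
Local Notation L1 := (L1 P).
Local Notation L2 := (L2 P).
Local Notation inc := (increment w).

Lemma known_mul_sqr_expectation s t z (g : R -> R) : 0 <= s -> s <= t ->
  known_at w s z -> L2 z -> measurable_fun [set: R] g -> L2 (g \o inc s t) ->
  \int[P]_x ((z x * g (inc s t x)) ^+ 2) =
  (\int[P]_x (z x ^+ 2)) * \int[P]_x (g (inc s t x) ^+ 2).
Proof.
move=> s0 st kz iz mg ig; under eq_Rintegral do rewrite exprMn.
apply: (@known_mul_expectation _ _ _ P w hw s t s0 st (fun x => z x ^+ 2) _ _ (fun u => g u ^+ 2)).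
- by apply: (known_at_comp (g := fun x => x ^+ 2)) => //; exact: exprn_measurable.
- exact: iz.2.
- exact: measurable_funX.
- exact: ig.2.
Qed.

Lemma wiener_exceptional_set : exists N : set Omega, [/\ measurable N, P N = 0%E &
  forall omega, ~ N omega -> w 0 omega = 0 /\
    {within `[0, +oo[, continuous (fun t : R => w t omega)}].
Proof.
have [N1 [mN1 N10 h1]] := wiener_start hw.
have [N2 [mN2 N20 h2]] := wiener_continuous hw.
exists (N1 `|` N2); split.
- exact: measurableU.
- by rewrite measureU0.
- move=> omega nN; split.
    by apply: contrapT => h; apply: nN; left; exact: h1.
  by apply: contrapT => h; apply: nN; right; exact: h2.
Qed.

Variable N : set Omega.
Hypotheses (mN : measurable N) (N0 : P N = 0%E).
Hypothesis good : forall omega, ~ N omega -> w 0 omega = 0 /\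
    {within `[0, +oo[, continuous (fun t : R => w t omega)}.
Variable c : R.

(** Solutions are required to have continuous paths everywhere, hence the
    factor that kills the null event [N] where the paths of [w] may be bad. *)
Definition exp_mart (t : R) (omega : Omega) : R :=
  \1_(~` N) omega * expR (c * w t omega - c ^+ 2 / 2 * t).

Local Notation y := exp_mart.

Lemma exp_mart_known t : 0 <= t -> known_at w t (y t).
Proof.
move=> t0; apply: known_atM; first exact: known_at_indicC.
apply: (known_at_comp (g := fun x => expR (c * x - c ^+ 2 / 2 * t))).
  apply: measurableT_comp => //; apply: measurable_funB => //; exact: measurable_funM.
by apply: known_at_wiener; rewrite t0 lexx.
Qed.

Lemma exp_mart_process : continuous_process y.
Proof.
apply: mk_continuous_process => [t t0|omega t t0].
  exact: known_at_measurable (exp_mart_known t0).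
have [nN|Nw] := pselect (~ N omega); last first.
  rewrite /y; under eq_fun do rewrite indicE memNset ?mul0r//.
  rewrite indicE memNset ?mul0r//; exact: cvg_cst.
have [_ /subspace_continuousP/(_ t)] := good nN.
rewrite /= in_itv/= t0 => /(_ isT) cw.
apply: cvgM; first exact: cvg_cst.
apply: continuous_cvg; first exact: continuous_expR.
apply: cvgB; first by apply: cvgM => //; exact: cvg_cst.
apply: cvgM; first exact: cvg_cst.
exact: cvg_within.
Qed.

Lemma exp_mart0 omega : y 0 omega = \1_(~` N) omega.
Proof.
rewrite /y indicE; case: (boolP (omega \in _)) => [|_]; last by rewrite mul0r.
by rewrite inE => /good[-> _]; rewrite !mulr0 subr0 expR0 mulr1.
Qed.

Lemma exp_mart0_ae : {ae P, forall omega, y 0 omega = 1}.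
Proof.
exists N; split => // omega /= h; apply: contrapT => nN; apply: h.
by rewrite exp_mart0 indicE mem_set.
Qed.

(** The growth over [[s, t]] depends only on the increment; on [N] both sides
    vanish. *)
Lemma exp_martE s t omega : y t omega =
  y s omega * expR (c * inc s t omega - c ^+ 2 / 2 * (t - s)).
Proof. by rewrite /y -[RHS]mulrA -expRD /increment; congr (_ * expR _); ring. Qed.

Let growth h (x : R) := expR (c * x - c ^+ 2 / 2 * h).

Let growthE h x : growth h x = expR (- (c ^+ 2 / 2 * h)) * expR (c * x).
Proof. by rewrite /growth expRD mulrC. Qed.

Section one_step.
Variables (s t a b e : R).
Hypotheses (s0 : 0 <= s) (st : s <= t).

(** The discretization errors below are all of the form [y s] times such a
    combination of the growth factor and the increment over [[s, t]]; its mean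
    and variance are computed once and for all. *)
Definition growth_comb (x : R) := a * expR (c * x - c ^+ 2 / 2 * (t - s)) + b - e * x.

Lemma measurable_growth_comb : measurable_fun [set: R] growth_comb.
Proof.
apply: measurable_funB; last exact: measurable_funM.
apply: measurable_funD => //; apply: measurable_funM => //.
apply: measurableT_comp => //; apply: measurable_funB => //; exact: measurable_funM.
Qed.

Let g1 : L1 (fun x => growth (t - s) (inc s t x)).
Proof.
under eq_fun do rewrite growthE.
by apply: L1Z; exact: increment_exp_L1.
Qed.

Let g2 : L1 (fun x => growth (t - s) (inc s t x) ^+ 2).
Proof.
rewrite (_ : (fun x => _) = (fun x => expR (- (c ^+ 2 * (t - s))) * expR ((2 * c) * inc s t x))).
  by apply: L1Z; exact: increment_exp_L1.
by apply/funext => x; rewrite /growth -expRM_natl -expRD; congr expR; field.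
Qed.

Let g3 : L1 (fun x => growth (t - s) (inc s t x) * inc s t x).
Proof.
rewrite (_ : (fun x => _) =
   (fun x => expR (- (c ^+ 2 / 2 * (t - s))) * (inc s t x * expR (c * inc s t x)))).
  by apply: L1Z; exact: increment_mul_exp_L1.
by apply/funext => x; rewrite growthE; ring.
Qed.

Let E1 : \int[P]_x growth (t - s) (inc s t x) = 1.
Proof.
under eq_Rintegral do rewrite growthE.
rewrite RintegralZl//; last exact: increment_exp_L1.
by rewrite increment_exp_expectation// -expRD -[RHS]expR0; congr expR; field.
Qed.

Let E2 : \int[P]_x (growth (t - s) (inc s t x) ^+ 2) = expR (c ^+ 2 * (t - s)).
Proof.
transitivity (\int[P]_x (expR (- (c ^+ 2 * (t - s))) * expR ((2 * c) * inc s t x))).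
  by apply: eq_Rintegral => x _; rewrite /growth -expRM_natl -expRD; congr expR; field.
rewrite RintegralZl//; last exact: increment_exp_L1.
by rewrite increment_exp_expectation// -expRD; congr expR; field.
Qed.

Let E3 : \int[P]_x (growth (t - s) (inc s t x) * inc s t x) = c * (t - s).
Proof.
transitivity (\int[P]_x (expR (- (c ^+ 2 / 2 * (t - s))) * (inc s t x * expR (c * inc s t x)))).
  by apply: eq_Rintegral => x _; rewrite growthE; ring.
rewrite RintegralZl//; last exact: increment_mul_exp_L1.
rewrite increment_mul_exp_expectation// mulrCA -expRD.
by rewrite [expR _](_ : _ = 1) ?mulr1// -[RHS]expR0; congr expR; field.
Qed.

Let Linc : L1 (inc s t).
Proof. exact: L2_L1 (increment_L2 hw s0 st). Qed.

Lemma growth_comb_L2 : L2 (growth_comb \o inc s t).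
Proof.
apply: L2B; last by apply: L2Z; exact: increment_L2.
apply: L2D; last exact: L2_cst.
apply: L2Z; split; last exact: g2.
exact: L1_measurable g1.
Qed.

Lemma growth_comb_expectation : \int[P]_x growth_comb (inc s t x) = a + b.
Proof.
rewrite /growth_comb.
have i1 : L1 (fun x => a * growth (t - s) (inc s t x)) by exact: L1Z.
have i2 : L1 (fun x => e * inc s t x) by exact: L1Z.
rewrite RintegralB//; last by apply: L1D => //; exact: L1_cst.
rewrite RintegralD//; last exact: L1_cst.
rewrite RintegralZl// E1 RintegralZl// increment_expectation// expectation_const.
by ring.
Qed.

Lemma growth_comb_variance : \int[P]_x (growth_comb (inc s t x) ^+ 2) =
  a ^+ 2 * expR (c ^+ 2 * (t - s)) + 2 * a * b + b ^+ 2 - 2 * a * e * c * (t - s)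
  + e ^+ 2 * (t - s).
Proof.
pose G x := growth (t - s) (inc s t x).
transitivity (\int[P]_x (((((a ^+ 2 * G x ^+ 2 + (2 * a * b) * G x) + b ^+ 2)
   - (2 * a * e) * (G x * inc s t x)) + (e ^+ 2) * (inc s t x ^+ 2)) - (2 * b * e) * inc s t x)).
  by apply: eq_Rintegral => x _; rewrite /growth_comb /G /growth; ring.
have i1 : L1 (fun x => a ^+ 2 * G x ^+ 2) by exact: L1Z.
have i2 : L1 (fun x => (2 * a * b) * G x) by exact: L1Z.
have i3 : L1 (fun x => b ^+ 2) by exact: L1_cst.
have i4 : L1 (fun x => (2 * a * e) * (G x * inc s t x)) by exact: L1Z.
have i5 : L1 (fun x => e ^+ 2 * (inc s t x ^+ 2)) by apply: L1Z; exact: (increment_L2 hw s0 st).2.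
have i6 : L1 (fun x => (2 * b * e) * inc s t x) by exact: L1Z.
have i12 := L1D i1 i2; have i123 := L1D i12 i3; have i1234 := L1B i123 i4.
have i12345 := L1D i1234 i5.
rewrite RintegralB// RintegralD// RintegralB// RintegralD// RintegralD//.
rewrite expectation_const !RintegralZl//; last exact: (increment_L2 hw s0 st).2.
by rewrite E1 E2 E3 increment_expectation// increment_variance//; ring.
Qed.

End one_step.

Lemma exp_mart_L2_expectation t : 0 <= t -> L2 (y t) /\
  \int[P]_x (y t x ^+ 2) = expR (c ^+ 2 * t).
Proof.
move=> t0.
have y0L : L2 (y 0).
  split; first exact: (exp_mart_process.1 0 (lexx 0)).
  apply: (le_L1 (Y := fun=> 1)); last exact: L1_cst.
    by apply: measurable_funX; exact: (exp_mart_process.1 0 (lexx 0)).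
  by move=> x; rewrite exp_mart0 indicE; case: (_ \in _); rewrite ?expr0n ?expr1n ?normr0 ?normr1.
have E0 : \int[P]_x (y 0 x ^+ 2) = 1.
  transitivity (\int[P]_x (\1_(~` N) x : R)).
    by apply: eq_Rintegral => x _; rewrite exp_mart0 indicE; case: (_ \in _); rewrite ?expr0n ?expr1n.
  rewrite /Rintegral integral_indic//; last exact: measurableC.
  have PN : P (~` N) = 1%E by rewrite probability_setC// N0 sube0.
  by rewrite setIT -[RHS]/(fine 1%E); congr fine; exact: PN.
have gE x : y t x = y 0 x * growth_comb 0 t 1 0 0 (inc 0 t x).
  by rewrite (exp_martE 0) /growth_comb; ring.
have gL := growth_comb_L2 1 0 0 (lexx 0) t0.
have mg := measurable_growth_comb 0 t 1 0 0.
have k0 := exp_mart_known (lexx 0).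
split.
  rewrite (_ : y t = (fun x => y 0 x * growth_comb 0 t 1 0 0 (inc 0 t x))); last exact/funext.
  exact: known_mul_L2.
under eq_Rintegral do rewrite gE.
rewrite (known_mul_sqr_expectation (lexx 0) t0)//.
by rewrite E0 mul1r growth_comb_variance//; rewrite subr0; ring.
Qed.

Lemma exp_mart_L2 t : 0 <= t -> L2 (y t).
Proof. by move=> /exp_mart_L2_expectation[]. Qed.

Lemma exp_mart_sqr t : 0 <= t -> \int[P]_x (y t x ^+ 2) = expR (c ^+ 2 * t).
Proof. by move=> /exp_mart_L2_expectation[]. Qed.

End exponential_martingale.

(** * Ito integrals of the exponential martingale *)

Section calculus.
Context {R : realType}.
Local Notation mu := (@lebesgue_measure R).

Lemma expR_sub1_le (x : R) : expR x - 1 <= x * expR x.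
Proof.
have h : (1 - x) * expR x <= 1.
  have := expR_ge1Dx (- x); rewrite -(ler_pM2r (expR_gt0 x)) -expRD addNr expR0.
  by [].
by lra.
Qed.

Lemma expR_sub1_bound (x E : R) : 0 <= x -> expR x <= E -> expR x - 1 <= x * E.
Proof.
by move=> x0 xE; apply: (le_trans (expR_sub1_le x)); rewrite ler_wpM2l.
Qed.

Lemma expR_sub1x_bound (x E : R) : 0 <= x -> expR x <= E -> expR x - 1 - x <= x ^+ 2 * E.
Proof.
move=> x0 xE; have h1 := expR_sub1_le x.
have h2 : x * (expR x - 1) <= x * (x * E) by rewrite ler_wpM2l// expR_sub1_bound.
by nra.
Qed.

Variables (f g : R -> R) (T : R).
Hypotheses (df : forall t : R, is_derive t 1 f (g t)) (cg : continuous g).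

Lemma derive_continuous : continuous f.
Proof.
move=> t; apply/differentiable_continuous; rewrite -derivable1_diffP.
by have /@ex_derive := df t.
Qed.

Lemma continuous_bounded_on (h : R -> R) : continuous h -> exists M, forall s,
  0 <= s -> s <= T -> `|h s| <= M.
Proof.
move=> ch; have [T0|T0] := leP 0 T; last first.
  by exists 0 => s s0 sT; have := le_lt_trans (le_trans s0 sT) T0; rewrite ltxx.
have ch' : {within `[0, T], continuous (fun s => `|h s|)}.
  by apply: continuous_subspaceT => s; apply: cvg_norm; exact: ch.
have [c _ hc] := EVT_max T0 ch'.
by exists `|h c| => s s0 sT; apply: hc; rewrite in_itv/= s0.
Qed.

Lemma derive_bounds : exists2 M, 0 <= M & forall s u, 0 <= s -> s <= u -> u <= T ->
  [/\ `|f s| <= M, `|f u| <= M, `|g s| <= M & `|f u - f s| <= M * (u - s)].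
Proof.
have [M1 h1] := continuous_bounded_on derive_continuous.
have [M2 h2] := continuous_bounded_on cg.
exists (`|M1| + `|M2|) => [|s u s0 su uT]; first by rewrite addr_ge0.
have u0 := le_trans s0 su; have sT := le_trans su uT.
have hM1 x : x <= M1 -> x <= `|M1| + `|M2|.
  by move=> h; rewrite (le_trans h)// (le_trans (ler_norm _))// lerDl.
have hM2 x : x <= M2 -> x <= `|M1| + `|M2|.
  by move=> h; rewrite (le_trans h)// (le_trans (ler_norm _))// lerDr.
split.
- by apply/hM1/h1.
- by apply/hM1/h1.
- by apply/hM2/h2.
- have [|c cI ->] := MVT_segment su (fun x _ => df x).
    exact/continuous_subspaceT/derive_continuous.
  rewrite normrM [X in _ * X]ger0_norm ?subr_ge0// ler_wpM2r ?subr_ge0//.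
  move: cI; rewrite in_itv/= => /andP[sc cu].
  by apply/hM2/h2; rewrite ?(le_trans s0)// (le_trans cu).
Qed.

Lemma Rintegral_derive (a b : R) : a <= b -> \int[mu]_(s in `[a, b]) g s = f b - f a.
Proof.
rewrite le_eqVlt => /orP[/eqP->|ab].
  by rewrite set_itv1 Rintegral_set1 subrr.
rewrite /Rintegral (continuous_FTC2 (F := f) ab)//.
- exact/continuous_subspaceT.
- split; last 2 first.
  + by apply: cvg_at_right_filter; exact: derive_continuous.
  + by apply: cvg_at_left_filter; exact: derive_continuous.
  + by move=> x _; have /@ex_derive := df x.
- by move=> x _; rewrite derive1E; have /@derive_val-> := df x.
Qed.

Lemma Rintegral_derive_indic (a b : R) : 0 <= a -> a <= b -> b <= T ->
  \int[mu]_(s in `[0, T]) (g s * \1_`[a, b[ s) = f b - f a.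
Proof.
move=> a0 ab bT; rewrite -(Rintegral_derive ab).
rewrite -Rintegral_itv_bndo_bndc; last first.
  have iab : mu.-integrable `[a, b] (EFin \o g).
    apply: continuous_compact_integrable; first exact: segment_compact.
    exact/continuous_subspaceT.
  apply: (integrableS _ _ _ iab) => // s /=.
  by rewrite !in_itv/= => /andP[->/ltW].
transitivity (\int[mu]_(s in `[0, T]) (g \_ `[a, b[) s).
  apply: eq_Rintegral => s _; rewrite patchE indicE.
  by case: ifP => _; rewrite ?mulr1 ?mulr0.
rewrite -Rintegral_mkcondr setIidr// => s /=; rewrite !in_itv/= => /andP[sa sb].
by rewrite (le_trans a0 sa) ltW// (lt_le_trans sb).
Qed.

End calculus.

Section ito_of_exponential.
Context {R : realType} {d : measure_display} {Omega : measurableType d}.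
Variable P : probability Omega R.
Variable w : R -> {RV P >-> R}.
Hypothesis hw : standard_wiener w.
Variable N : set Omega.
Hypotheses (mN : measurable N) (N0 : P N = 0%E).
Hypothesis good : forall omega, ~ N omega -> w 0 omega = 0 /\
    {within `[0, +oo[, continuous (fun t : R => w t omega)}.
Variable c : R.
Local Notation mu := (@lebesgue_measure R).
Local Notation L1 := (L1 P).
Local Notation L2 := (L2 P).
Local Notation inc := (increment w).
Local Notation y := (exp_mart w N c).
Local Notation tms := (time_mean_sq P).
Local Notation ms := (mean_sq P).

Let yL2 t (t0 : 0 <= t) : L2 (y t) := exp_mart_L2 hw mN N0 good c t0.
Let yk t (t0 : 0 <= t) : known_at w t (y t) := exp_mart_known mN N0 c t0.
Let ysqr t (t0 : 0 <= t) : \int[P]_x (y t x ^+ 2) = expR (c ^+ 2 * t) :=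
  exp_mart_sqr hw mN N0 good c t0.
Let yproc : continuous_process y := exp_mart_process mN N0 good c.

Variable T : R.
Hypothesis T0 : 0 <= T.

Let E := expR (c ^+ 2 * T).

Let E0 : 0 <= E. Proof. exact: expR_ge0. Qed.

Let exp_le h : h <= T -> expR (c ^+ 2 * h) <= E.
Proof. by move=> hT; rewrite ler_expR ler_wpM2l// sqr_ge0. Qed.

Section grid_step.
Variables (f : R -> R) (k : nat).

Let h := T / k.+1%:R.

Let h0 : 0 <= h. Proof. by rewrite divr_ge0. Qed.

Definition grid_time (i : nat) : R := i%:R * h.

Lemma grid_time_ge0 i : 0 <= grid_time i.
Proof. by rewrite mulr_ge0. Qed.

Lemma grid_time_last : grid_time k.+1 = T.
Proof. by rewrite /grid_time /h mulrC divfK. Qed.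

Lemma grid_time_le i j : (i <= j)%N -> grid_time i <= grid_time j.
Proof. by move=> ij; rewrite ler_wpM2r// ler_nat. Qed.

Lemma grid_timeS i : grid_time i.+1 - grid_time i = h.
Proof. by rewrite /grid_time -mulrBl -natrB// subSnn mul1r. Qed.

Lemma grid_time_leT i : (i <= k.+1)%N -> grid_time i <= T.
Proof. by move=> ik; rewrite -grid_time_last grid_time_le. Qed.

Let val i omega := y (grid_time i) omega * f (grid_time i).

Let val_known i : known_at w (grid_time i) (val i).
Proof.
by apply: known_atM; [exact: yk (grid_time_ge0 i)|exact: known_at_cst].
Qed.

Let val_L2 i : L2 (val i).
Proof.
rewrite /val; under eq_fun do rewrite mulrC.
by apply: L2Z; exact: yL2 (grid_time_ge0 i).
Qed.

(** The integrand [y * f] frozen at the left ends of the cells of a uniform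
    grid. *)
Definition grid_step : step_process w T :=
  @StepProcess _ _ _ P w T k.+1 grid_time val (mul0r _) grid_time_last
    (fun i _ => grid_time_le (leqnSn i)) (fun i _ => @val_known i) (fun i _ => (val_L2 i).2).

Lemma grid_step_at s : 0 <= s -> s < T -> exists i, [/\ (i < k.+1)%N,
  grid_time i <= s, s - grid_time i <= h & forall omega,
  step_fun grid_step s omega = y (grid_time i) omega * f (grid_time i)].
Proof.
move=> s0 sT.
have hpos : 0 < h by rewrite divr_gt0// (le_lt_trans s0).
have sh0 : 0 <= s / h by rewrite divr_ge0.
pose i := Num.truncn (s / h).
have /andP[i1 i2] := truncn_itv sh0.
have iE j : (\1_`[grid_time j, grid_time j.+1[ s : R) = (j == i)%:R.
  rewrite indicE mem_setE in_itv/= /grid_time -ler_pdivlMr// -ltr_pdivrMr//.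
  by rewrite -truncn_eq// eq_sym.
have ik : (i < k.+1)%N.
  rewrite -(ltr_nat R) (le_lt_trans i1)// ltr_pdivrMr//.
  by rewrite -[X in _ < X]/(grid_time k.+1) grid_time_last.
exists i; split => //.
- by rewrite /grid_time -ler_pdivlMr.
- rewrite lerBlDr -[X in X + _](grid_timeS i) subrK.
  by rewrite /grid_time -ler_pdivrMr// ltW.
- move=> omega'; rewrite /step_fun /=.
  rewrite (bigD1 (Ordinal ik))//= iE eqxx mulr1 big1 ?addr0// => j ji.
  by rewrite iE (_ : (j == i :> nat) = false) ?mulr0//; apply/negbTE.
Qed.

End grid_step.
Arguments grid_time : clear implicits.

(** Within a cell the error is [y t] times a growth combination whose variance
    is [(f s - f t) ^ 2 + f s ^ 2 * (exp (c ^ 2 (s - t)) - 1)], which is of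
    the order of the mesh. *)
Lemma grid_step_approx (f : R -> R) (M : R) : 0 <= M ->
  (forall s u, 0 <= s -> s <= u -> u <= T ->
     `|f u| <= M /\ `|f u - f s| <= M * (u - s)) ->
  continuous f ->
  forall k, (tms T (fun s omega => (y s omega * f s - step_fun (grid_step f k) s omega)%R) <=
    (E * M ^+ 2 * (T + c ^+ 2 * E) * T * (T / k.+1%:R))%:E)%E.
Proof.
move=> M0 fM cf k; set h := T / k.+1%:R.
have h0 : 0 <= h by rewrite divr_ge0.
have yf : continuous_process (fun s omega => y s omega * f s).
  apply: continuous_processM => //; apply: continuous_process_fun.
  exact: continuous_subspaceT.
pose D s omega := (y (Num.max 0 s) omega * f (Num.max 0 s) - step_fun (grid_step f k) s omega) ^+ 2.
have mD : jointly_measurable D.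
  apply: measurable_funX; apply: measurable_funB; last exact: step_fun_measurable.
  exact: continuous_process_measurable yf.
have D0 s omega : 0 <= D s omega by exact: sqr_ge0.
rewrite [leLHS](_ : _ = \int[P]_omega \int[mu]_(s in `[0%R, T]) (D s omega)%:E)%E; last first.
  apply: eq_integral => omega _; apply: eq_integral => s.
  by rewrite inE/= in_itv/= => /andP[s0 _]; rewrite /D (max_r s0).
rewrite process_tonelli//.
have mED := measurable_expectation_process P mD D0.
rewrite -integral_itv_bndo_bndc; last exact: measurable_funTS.
pose C := E * M ^+ 2 * (T + c ^+ 2 * E).
apply: (@le_trans _ _ (\int[mu]_(s in `[0%R, T[) (C * h)%:E)%E); last first.
  rewrite integral_cst//= lebesgue_measure_itv/= lte_fin.
  case: ifP => [_|/negbT]; first by rewrite -EFinB -EFinM lee_fin subr0 /C mulrAC.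
  rewrite -leNgt => Tle; have -> : T = 0 by apply/eqP; rewrite eq_le Tle T0.
  by rewrite mule0 lee_fin !(mulr0, mul0r).
apply: ge0_le_integral => //.
- by move=> s _; apply: integral_ge0 => omega _; rewrite lee_fin.
- exact: measurable_funTS.
move=> s /=; rewrite in_itv/= => /andP[s0 sT].
have [i [ik ts sth stepE]] := grid_step_at f k s0 sT.
set t := grid_time k i in ts sth stepE.
have t0 : 0 <= t by exact: grid_time_ge0.
have DE omega : D s omega = (y t omega * growth_comb c t s (f s) (- f t) 0 (inc t s omega)) ^+ 2.
  rewrite /D (max_r s0) stepE (exp_martE w N c t s) /growth_comb; congr (_ ^+ 2); ring.
have gL := growth_comb_L2 hw c (f s) (- f t) 0 t0 ts.
have mg := measurable_growth_comb c t s (f s) (- f t) 0.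
under eq_integral do rewrite DE.
rewrite EFin_expectation; last exact: (known_mul_L2 hw t0 ts (yk t0) (yL2 t0) mg gL).2.
rewrite (known_mul_sqr_expectation hw t0 ts (yk t0) (yL2 t0) mg gL) ysqr//.
rewrite growth_comb_variance// lee_fin.
have [fsM fst] := fM _ _ t0 ts (ltW sT).
set x := c ^+ 2 * (s - t).
have x0 : 0 <= x by rewrite mulr_ge0 ?sqr_ge0 ?subr_ge0.
have tT : t <= T by exact: le_trans ts (ltW sT).
have eE : expR x - 1 <= x * E.
  apply: expR_sub1_bound => //; apply: exp_le.
  by rewrite lerBlDr (le_trans (ltW sT))// lerDl.
have e1 : 0 <= expR x - 1 by rewrite subr_ge0 -[leLHS]expR0 ler_expR.
have h1 : (f s - f t) ^+ 2 <= M ^+ 2 * h ^+ 2.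
  rewrite -real_normK ?num_real// -exprMn lerXn2r ?nnegrE ?mulr_ge0//.
  by rewrite (le_trans fst)// ler_wpM2l.
have h2 : f s ^+ 2 <= M ^+ 2.
  by rewrite -real_normK ?num_real// lerXn2r ?nnegrE.
have hT : h <= T by rewrite /h ler_pdivrMr// ler_peMr// ler1n.
have h3 : h ^+ 2 <= T * h by rewrite expr2 ler_wpM2r.
have h4 : x <= c ^+ 2 * h by rewrite ler_wpM2l// sqr_ge0.
rewrite (_ : _ + _ = (f s - f t) ^+ 2 + f s ^+ 2 * (expR x - 1)); last by ring.
rewrite (_ : C * h = E * (M ^+ 2 * (T + c ^+ 2 * E) * h)); last by rewrite /C; ring.
apply: ler_pM => //.
- by rewrite addr_ge0 ?sqr_ge0// mulr_ge0// sqr_ge0.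
- exact: exp_le.
apply: (@le_trans _ _ (M ^+ 2 * (T * h) + M ^+ 2 * (c ^+ 2 * h * E))).
  apply: lerD; first by rewrite (le_trans h1)// ler_wpM2l// sqr_ge0.
  apply: ler_pM => //; first exact: sqr_ge0.
  by rewrite (le_trans eE)// ler_wpM2r.
by rewrite le_eqVlt; apply/orP; left; apply/eqP; ring.
Qed.

Section ito_formula.
Variables (f g : R -> R) (M : R).
Hypotheses (df : forall t : R, is_derive t 1 f (g t)) (cg : continuous g).
Hypotheses (M0 : 0 <= M) (fgM : forall s u, 0 <= s -> s <= u -> u <= T ->
  [/\ `|f s| <= M, `|f u| <= M, `|g s| <= M & `|f u - f s| <= M * (u - s)]).

Section fixed_grid.
Variable k : nat.
Let h := T / k.+1%:R.
Let h0 : 0 <= h. Proof. by rewrite divr_ge0. Qed.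
Local Notation t_ := (grid_time k).

Let t0 i : 0 <= t_ i. Proof. exact: grid_time_ge0. Qed.
Let tS i : t_ i <= t_ i.+1. Proof. exact: grid_time_le. Qed.

(** The increment of [y * f] over a cell, minus [y] times the increment of
    [f], minus the frozen integrand times the increment of [w]. *)
Definition ito_error (i : nat) (omega : Omega) : R :=
  y (t_ i) omega * growth_comb c (t_ i) (t_ i.+1) (f (t_ i.+1)) (- f (t_ i.+1)) (c * f (t_ i))
    (inc (t_ i) (t_ i.+1) omega).

Lemma ito_error_L2 i : L2 (ito_error i).
Proof.
apply: (known_mul_L2 hw (t0 i) (tS i) (yk (t0 i)) (yL2 (t0 i))).
  exact: measurable_growth_comb.
exact: growth_comb_L2.
Qed.

Let error_known i : known_at w (t_ i.+1) (ito_error i).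
Proof.
apply: known_atM; first exact: known_at_le (yk (t0 i)).
apply: known_at_comp; last exact: known_at_increment.
exact: measurable_growth_comb.
Qed.

(** The terms of order [h] in the variance cancel: what is left is
    [a ^ 2 (exp x - 1 - x) + x (a - b) ^ 2], with [x = c ^ 2 h], and [|a - b|]
    is at most [M * h]. *)
Let error_sqr i : (i < k.+1)%N ->
  \int[P]_x (ito_error i x ^+ 2) <= E * (M ^+ 2 * (c ^+ 4 * E + c ^+ 2 * T) * h ^+ 2).
Proof.
move=> ik; have mg := measurable_growth_comb c (t_ i) (t_ i.+1) (f (t_ i.+1)) (- f (t_ i.+1)) (c * f (t_ i)).
have gL := growth_comb_L2 hw c (f (t_ i.+1)) (- f (t_ i.+1)) (c * f (t_ i)) (t0 i) (tS i).
rewrite /ito_error (known_mul_sqr_expectation hw (t0 i) (tS i) (yk (t0 i)) (yL2 (t0 i)) mg gL).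
rewrite ysqr// growth_comb_variance// grid_timeS -/h.
have [fs fu _ fus] := fgM (t0 i) (tS i) (grid_time_leT ik).
move: fus; rewrite grid_timeS -/h => fus.
set a := f (t_ i.+1) in fu fus *; set b := f (t_ i) in fs fus *.
set x := c ^+ 2 * h.
have x0 : 0 <= x by rewrite mulr_ge0 ?sqr_ge0.
have hT : h <= T by rewrite /h ler_pdivrMr// ler_peMr// ler1n.
have e2 : expR x - 1 - x <= x ^+ 2 * E by apply: expR_sub1x_bound => //; exact: exp_le.
have e1 : 0 <= expR x - 1 - x by have := expR_ge1Dx x; lra.
have ab2 : (a - b) ^+ 2 <= M ^+ 2 * h ^+ 2.
  by rewrite -real_normK ?num_real// -exprMn lerXn2r ?nnegrE ?mulr_ge0.
have a2 : a ^+ 2 <= M ^+ 2 by rewrite -real_normK ?num_real// lerXn2r ?nnegrE.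
rewrite (_ : _ + (c * b) ^+ 2 * h = a ^+ 2 * (expR x - 1 - x) + x * (a - b) ^+ 2); last first.
  by rewrite /x; ring.
apply: ler_pM.
- exact: expR_ge0.
- by rewrite addr_ge0// mulr_ge0// sqr_ge0.
- by apply: exp_le; apply: grid_time_leT; exact: ltnW.
apply: (@le_trans _ _ (M ^+ 2 * (x ^+ 2 * E) + x * (M ^+ 2 * h ^+ 2))).
  apply: lerD; last by rewrite ler_wpM2l.
  by apply: ler_pM => //; exact: sqr_ge0.
have -> : M ^+ 2 * (x ^+ 2 * E) + x * (M ^+ 2 * h ^+ 2) =
    M ^+ 2 * h ^+ 2 * (c ^+ 4 * E + c ^+ 2 * h) by rewrite /x; ring.
rewrite [leRHS]mulrAC ler_wpM2l//.
  by rewrite mulr_ge0 ?sqr_ge0.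
by rewrite lerD2l ler_wpM2l// sqr_ge0.
Qed.

(** The errors are orthogonal: each is [y] at the left end of its cell times a
    centred function of the increment, while the previous errors are known at
    that time. So their mean squares add up. *)
Let errors_sqr m : (m <= k.+1)%N ->
  \int[P]_x ((\sum_(0 <= i < m) ito_error i x) ^+ 2) <=
  m%:R * (E * (M ^+ 2 * (c ^+ 4 * E + c ^+ 2 * T) * h ^+ 2)).
Proof.
have sL2 j : L2 (fun x => \sum_(0 <= i < j) ito_error i x) by exact: L2_sum (fun i => ito_error_L2 i).
have sk j : known_at w (t_ j) (fun x => \sum_(0 <= i < j) ito_error i x).
  elim: j => [|j ih].
    rewrite (_ : (fun x => _) = cst 0); first exact: known_at_cst.
    by apply/funext => x; rewrite big_nil.
  rewrite (_ : (fun x => _) = (fun x => (\sum_(0 <= i < j) ito_error i x) - (-1) * ito_error j x)).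
    apply: known_atB; first exact: known_at_le ih.
    by apply: known_atM => //; exact: known_at_cst.
  by apply/funext => x; rewrite big_nat_recr//= mulN1r opprK.
elim: m => [_|m ih mk].
  by rewrite mul0r; under eq_Rintegral do rewrite big_nil expr0n; rewrite expectation_const.
pose S x := \sum_(0 <= i < m) ito_error i x.
rewrite [leLHS](_ : _ =
    \int[P]_x ((S x ^+ 2 + 2 * (S x * ito_error m x)) + ito_error m x ^+ 2)); last first.
  by apply: eq_Rintegral => x _; rewrite big_nat_recr//= -/(S x); ring.
have SL : L2 S := sL2 m.
have iSe := L2_mul SL (ito_error_L2 m).
rewrite RintegralD//; last 2 first.
- by apply: L1D; [exact: SL.2|exact: L1Z].
- exact: (ito_error_L2 m).2.
rewrite RintegralD//; last 2 first.
- exact: SL.2.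
- exact: L1Z.
rewrite RintegralZl//.
have -> : \int[P]_x (S x * ito_error m x) = 0.
  under eq_Rintegral do rewrite /ito_error mulrA.
  rewrite (known_mul_expectation hw (t0 m) (tS m)).
  - by rewrite growth_comb_expectation// subrr mulr0.
  - by apply: known_atM; [exact: sk|exact: yk].
  - by apply: L2_mul => //; exact: yL2.
  - exact: measurable_growth_comb.
  - by apply: L2_L1; exact: growth_comb_L2.
rewrite mulr0 addr0 -natr1 mulrDl mul1r; apply: lerD; first exact: ih (ltnW mk).
exact: error_sqr.
Qed.

Lemma ito_errors_mean_sq :
  (ms (fun x => \sum_(0 <= i < k.+1) ito_error i x)%R <=
   (E * (M ^+ 2 * (c ^+ 4 * E + c ^+ 2 * T)) * T * (T / k.+1%:R))%:E)%E.
Proof.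
have sL2 : L2 (fun x => \sum_(0 <= i < k.+1) ito_error i x) by exact: L2_sum (fun i => ito_error_L2 i).
rewrite /mean_sq EFin_expectation; last exact: sL2.2.
rewrite lee_fin (le_trans (errors_sqr (leqnn _)))//.
have hk : k.+1%:R * h = T by rewrite /h mulrC divfK.
rewrite -/h [leLHS](_ : _ =
  E * (M ^+ 2 * (c ^+ 4 * E + c ^+ 2 * T)) * (k.+1%:R * h) * h); last by ring.
by rewrite hk.
Qed.

(** What freezing [y] on the grid changes in the drift term of the integration
    by parts. *)
Definition drift_error (omega : Omega) : R :=
  \sum_(0 <= i < k.+1) y (t_ i) omega * (f (t_ i.+1) - f (t_ i)) -
  \int[mu]_(s in `[0, T]) (y s omega * g s).

Let gy omega : mu.-integrable `[0, T] (EFin \o (fun s => y s omega * g s)).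
Proof.
apply: (continuous_process_integrable (X := fun s omega => y s omega * g s)).
apply: continuous_processM => //; apply: continuous_process_fun.
exact: continuous_subspaceT.
Qed.

Let gind (a b r : R) : mu.-integrable `[0, T] (EFin \o (fun s => r * (g s * \1_`[a, b[ s))).
Proof.
have ig : mu.-integrable `[0, T] (EFin \o g).
  by apply: continuous_compact_integrable; [exact: segment_compact|exact: continuous_subspaceT].
suff i1 : mu.-integrable `[0, T] (EFin \o (fun s => g s * \1_`[a, b[ s)).
  exact: (integrableZl _ r i1).
apply: (le_integrable _ _ _ ig) => //.
  apply/measurable_EFinP; apply: measurable_funM.
    by apply: measurable_funTS; exact: continuous_measurable_fun.
  by apply: measurable_funTS; exact: measurable_indic.
move=> s _; rewrite lee_fin indicE; case: (_ \in _); rewrite ?mulr1//.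
by rewrite mulr0 normr0 normr_ge0.
Qed.

(** An increment of [f] is the integral of [g] over the cell, so the frozen
    [y] is integrated against [g]. *)
Let drift_errorE omega : drift_error omega =
  \int[mu]_(s in `[0, T]) (g s * (step_fun (grid_step (fun=> 1) k) s omega - y s omega)).
Proof.
have -> : \int[mu]_(s in `[0, T]) (g s * (step_fun (grid_step (fun=> 1) k) s omega - y s omega)) =
    \int[mu]_(s in `[0, T]) (\sum_(i < k.+1) y (t_ i) omega * (g s * \1_`[t_ i, t_ i.+1[ s) -
      y s omega * g s).
  apply: eq_Rintegral => s _; rewrite mulrBr [g s * y s omega]mulrC; congr (_ - _).
  rewrite /step_fun mulr_sumr; apply: eq_bigr => i _ /=.
  by rewrite mulr1; ring.
rewrite RintegralB//; last exact: integrable_sum_EFin (fun i => gind _ _ _) _.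
congr (_ - _); rewrite big_mkord Rintegral_sum//.
apply: eq_bigr => i _.
rewrite -(Rintegral_derive_indic df cg (t0 i) (tS i) (grid_time_leT (ltn_ord i))).
rewrite RintegralZl//; have := gind (t_ i) (t_ i.+1) 1.
by congr (_.-integrable _ (EFin \o _)); apply/funext => s; rewrite mul1r.
Qed.

Let step_bounded omega : exists B, forall s, 0 <= s -> s <= T ->
  `|step_fun (grid_step (fun=> 1) k) s omega - y s omega| <= B.
Proof.
have cy : {within `[0, T], continuous (fun s => `|y s omega|)}.
  have /subspace_continuousP cy' := continuous_process_path (T := T) (omega := omega) yproc.
  by apply/subspace_continuousP => s sT; apply: cvg_norm; exact: cy'.
have [s1 _ hs1] := EVT_max T0 cy.
exists (\sum_(i < k.+1) `|y (t_ i) omega * 1| + `|y s1 omega|) => s s0 sT.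
apply: (le_trans (ler_normB _ _)); apply: lerD; last by apply: hs1; rewrite in_itv/= s0.
apply: (le_trans (ler_norm_sum _ _ _)); apply: ler_sum => i _ /=.
rewrite normrM ler_piMr// indicE; case: (_ \in _); by rewrite ?normr1 ?normr0.
Qed.

Let drift_path_measurable omega :
  measurable_fun [set: R] (fun s => g s * (step_fun (grid_step (fun=> 1) k) s omega - y (Num.max 0 s) omega)).
Proof.
apply: measurable_funM; first exact: continuous_measurable_fun.
apply: (@jointly_measurable_section _ _ _ (fun s omega =>
  step_fun (grid_step (fun=> 1) k) s omega - y (Num.max 0 s) omega)).
apply: jointly_measurableB; first exact: step_fun_measurable.
exact: continuous_process_measurable yproc.
Qed.

Let drift_path omega s := g s * (step_fun (grid_step (fun=> 1) k) s omega - y s omega).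

Let drift_path_integrable omega (n : nat) :
  mu.-integrable `[0, T] (EFin \o (fun s => drift_path omega s ^+ n)).
Proof.
have [B hB] := step_bounded omega.
apply: (@le_integrable _ _ _ mu `[0, T] _ _ (EFin \o (fun _ : R => (M * `|B|) ^+ n))) => //.
- apply/measurable_EFinP; apply: measurable_funX.
  apply: (eq_measurable_fun (fun s =>
      g s * (step_fun (grid_step (fun=> 1) k) s omega - y (Num.max 0 s) omega))).
    by move=> s; rewrite inE/= in_itv/= => /andP[s0 _]; rewrite /drift_path (max_r s0).
  apply: measurable_funTS; exact: drift_path_measurable.
- move=> s; rewrite /= in_itv/= => /andP[s0 sT].
  rewrite lee_fin !normrX lerXn2r ?nnegrE//.
  rewrite !normrM normr_id ler_pM//; last by rewrite (le_trans (hB s s0 sT)) ?ler_norm.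
  by have [_ _ gM _] := fgM s0 (lexx s) sT; rewrite (le_trans gM) ?ler_norm.
- apply: continuous_compact_integrable; first exact: segment_compact.
  by move=> s; exact: cvg_cst.
Qed.

Lemma drift_error_measurable : measurable_fun setT drift_error.
Proof.
apply: measurable_funB.
  by apply: measurable_sum => i; apply: measurable_funM => //; exact: (yL2 (t0 i)).1.
apply: (measurable_Rintegral_time (X := fun s omega => y s omega * g s)).
apply: continuous_processM => //; apply: continuous_process_fun.
exact: continuous_subspaceT.
Qed.

(** Cauchy-Schwarz in time; the freezing of [y] alone is the case of the
    constant function 1 in [grid_step]. *)
Lemma drift_error_mean_sq :
  (ms drift_error <= (T * M ^+ 2)%:E *
   tms T (fun s omega => (y s omega * 1 - step_fun (grid_step (fun=> 1) k) s omega)%R))%E.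
Proof.
pose D s omega := (y (Num.max 0 s) omega * 1 - step_fun (grid_step (fun=> 1) k) s omega) ^+ 2.
have mD : jointly_measurable D.
  apply: jointly_measurable_sqr; apply: jointly_measurableB; last exact: step_fun_measurable.
  apply: measurable_funM => //; exact: continuous_process_measurable yproc.
have D0 s omega : 0 <= D s omega by exact: sqr_ge0.
have mDs omega : measurable_fun [set: R] (D ^~ omega) by exact: jointly_measurable_section.
rewrite [X in (_ <= _ * X)%E](_ : _ = \int[P]_omega \int[mu]_(s in `[0%R, T]) (D s omega)%:E)%E; last first.
  apply: eq_integral => omega _; apply: eq_integral => s.
  by rewrite inE/= in_itv/= => /andP[s0 _]; rewrite /D (max_r s0).
have mI : measurable_fun setT (fun omega => \int[mu]_(s in `[0%R, T]) (D s omega)%:E)%E.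
  exact: measurable_time_integral.
have I0 omega : (0 <= \int[mu]_(s in `[0%R, T]) (D s omega)%:E)%E.
  by apply: integral_ge0 => s _; rewrite lee_fin.
rewrite -ge0_integralZl//; last by rewrite lee_fin mulr_ge0// sqr_ge0.
apply: ge0_le_integral => //.
- by move=> omega _; rewrite lee_fin sqr_ge0.
- by apply/measurable_EFinP; apply: measurable_funX; exact: drift_error_measurable.
- exact: measurable_funeM.
move=> omega _; rewrite drift_errorE.
have i1 : mu.-integrable `[0, T] (EFin \o drift_path omega).
  exact: (drift_path_integrable omega 1).
apply: (le_trans (sqr_time_integral_le T0 i1 (drift_path_integrable omega 2))).
rewrite EFinM -muleA lee_wpmul2l//.
rewrite -ge0_integralZl//; last 3 first.
- by apply/measurable_EFinP; apply: measurable_funTS; exact: mDs.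
- by move=> s _; rewrite lee_fin.
- by rewrite lee_fin sqr_ge0.
apply: ge0_le_integral => //.
- by move=> s _; rewrite lee_fin sqr_ge0.
- exact: measurable_int (drift_path_integrable omega 2).
- by apply: measurable_funeM; apply/measurable_EFinP; apply: measurable_funTS; exact: mDs.
move=> s /=; rewrite in_itv/= => /andP[s0 sT].
have [_ _ gM _] := fgM s0 (lexx s) sT.
rewrite -EFinM lee_fin /drift_path /D (max_r s0) exprMn mulr1 -(opprB (y s omega)) sqrrN.
by rewrite ler_wpM2r ?sqr_ge0// -real_normK ?num_real// lerXn2r ?nnegrE.
Qed.

End fixed_grid.

Lemma cvge_mesh (u : nat -> \bar R) (C : R) : (forall k, (0 <= u k)%E) ->
  (forall k, (u k <= (C * (T / k.+1%:R))%:E)%E) -> u @ \oo --> 0%E.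
Proof.
move=> u0 uC.
apply: (squeeze_cvge (f := fun=> 0%E) (h := fun k => (C * (T / k.+1%:R))%:E)).
- by apply: nearW => k; rewrite u0 uC.
- exact: cvg_cst.
- apply: cvg_EFin; first exact: nearW.
  rewrite -[X in _ --> X](mulr0 C); apply: cvgM; first exact: cvg_cst.
  rewrite -[X in _ --> X](mulr0 T); apply: cvgM; first exact: cvg_cst.
  exact: cvg_harmonic.
Qed.

(** Integration by parts for the product of [y] and a smooth [f]. The error of
    the elementary integrals is the sum of the cell errors [ito_error] and of
    [drift_error]. *)
Lemma exp_mart_ito_integral (J : {RV P >-> R}) :
  (forall omega, J omega = y T omega * f T - y 0 omega * f 0 -
     \int[mu]_(s in `[0, T]) (y s omega * g s)) ->
  is_ito_integral w (fun s omega => c * (y s omega * f s)) T J.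
Proof.
move=> JE; have cf := derive_continuous df.
exists (fun k => grid_step (fun s => c * f s) k); split.
  apply: (@cvge_mesh _ (E * (`|c| * M) ^+ 2 * (T + c ^+ 2 * E) * T)) => k.
    by apply: integral_ge0 => omega _; apply: integral_ge0 => s _; rewrite lee_fin sqr_ge0.
  apply: le_trans (@grid_step_approx (fun s => c * f s) (`|c| * M) _ _ _ k); last 3 first.
  - by rewrite mulr_ge0.
  - move=> s u s0 su uT; have [_ fu _ fsu] := fgM s0 su uT.
    by rewrite -mulrBr !normrM -mulrA !ler_wpM2l.
  - by move=> s; apply: cvgM; [exact: cvg_cst|exact: cf].
  rewrite le_eqVlt; apply/orP; left; apply/eqP.
  apply: eq_integral => omega _; apply: eq_integral => s _.
  by congr ((_ - _) ^+ 2)%:E; ring.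
pose C1 := E * (M ^+ 2 * (c ^+ 4 * E + c ^+ 2 * T)) * T.
pose C2 := (T * M ^+ 2) * (E * 1 ^+ 2 * (T + c ^+ 2 * E) * T).
apply: (@cvge_mesh _ (3 * (C1 + C2))) => k.
  by apply: integral_ge0 => omega _; rewrite lee_fin sqr_ge0.
pose S omega := \sum_(0 <= i < k.+1) ito_error k i omega.
have JS omega : J omega - step_integral (grid_step (fun s => c * f s) k) omega =
    S omega + drift_error k omega + 0.
  have step i : ito_error k i omega = y (grid_time k i.+1) omega * f (grid_time k i.+1) -
      y (grid_time k i) omega * f (grid_time k i) -
      y (grid_time k i) omega * (f (grid_time k i.+1) - f (grid_time k i)) -
      y (grid_time k i) omega * (c * f (grid_time k i)) *
        inc (grid_time k i) (grid_time k i.+1) omega.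
    rewrite (exp_martE w N c (grid_time k i) (grid_time k i.+1)) /ito_error /growth_comb; ring.
  rewrite /S; under eq_bigr do rewrite step.
  have tel : \sum_(0 <= i < k.+1) (y (grid_time k i.+1) omega * f (grid_time k i.+1) -
        y (grid_time k i) omega * f (grid_time k i)) =
      y (grid_time k k.+1) omega * f (grid_time k k.+1) - y (grid_time k 0) omega * f (grid_time k 0).
    exact: (telescope_sumr (fun i => y (grid_time k i) omega * f (grid_time k i)) (leq0n _)).
  rewrite sumrB sumrB tel grid_time_last /grid_time mul0r JE /drift_error /step_integral /= big_mkord.
  rewrite [in RHS]big_mkord; ring.
have msS : (ms S <= (C1 * (T / k.+1%:R))%:E)%E by exact: ito_errors_mean_sq.
have msD : (ms (drift_error k) <= (C2 * (T / k.+1%:R))%:E)%E.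
  apply: (le_trans (drift_error_mean_sq k)).
  rewrite /C2 -[X in (_ <= X%:E)%E]mulrA [X in (_ <= X)%E]EFinM.
  apply: lee_wpmul2l; first by rewrite lee_fin mulr_ge0 ?sqr_ge0.
  apply: grid_step_approx => //; last by move=> s; exact: cvg_cst.
  by move=> s u s0 su uT; rewrite subrr normr0 normr1 mul1r subr_ge0.
rewrite (_ : (\int[P]_omega _)%E = \int[P]_omega ((S omega + drift_error k omega + 0) ^+ 2)%:E)%E; last first.
  by apply: eq_integral => omega _; rewrite JS.
have mS : measurable_fun setT S.
  by apply: measurable_sum => i; apply: L1_measurable; apply: L2_L1; exact: ito_error_L2.
have := integral_sqr_add3 P measurableT mS (drift_error_measurable k) (@measurable_cst _ _ Omega R setT 0).
move/le_trans; apply.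
rewrite [X in (_ + _ + X)%E](_ : _ = 0%E); last first.
  by apply: integral0_eq => omega _; rewrite expr0n.
rewrite adde0 (_ : 3 * (C1 + C2) * (T / k.+1%:R) =
  3 * (C1 * (T / k.+1%:R) + C2 * (T / k.+1%:R))); last by ring.
rewrite [leRHS]EFinM; apply: lee_wpmul2l => //.
by rewrite EFinD; exact: leeD.
Qed.

End ito_formula.

End ito_of_exponential.

(** * The explicit solution for scalar noise *)

Section explicit_solution.
Context {R : realType} {d : measure_display} {Omega : measurableType d}.
Variable P : probability Omega R.
Variable w : R -> {RV P >-> R}.
Hypothesis hw : standard_wiener w.
Variables (n : nat) (F : 'M[R]_n) (c : R) (x0 : 'cV[R]_n).
Variable phi : R -> 'cV[R]_n.
Hypothesis phi0 : phi 0 = x0.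
Hypothesis dphi : forall (t : R) i, is_derive t 1 (fun s => phi s i 0) ((F *m phi t) i 0).
Local Notation mu := (@lebesgue_measure R).

Lemma flow_continuous i : continuous (fun s => phi s i 0).
Proof. exact: (derive_continuous (fun t => dphi t i)). Qed.

Lemma flow_drift_continuous i : continuous (fun s => (F *m phi s) i 0).
Proof.
under eq_fun do rewrite mxE.
move=> t; apply: cvg_big => [|j _]; first exact: add_continuous.
by apply: cvgM; [exact: cvg_cst|exact: flow_continuous].
Qed.

Section off_exceptional.
Variable N : set Omega.
Hypotheses (mN : measurable N) (N0 : P N = 0%E).
Hypothesis good : forall omega, ~ N omega -> w 0 omega = 0 /\
    {within `[0, +oo[, continuous (fun t : R => w t omega)}.
Local Notation y := (exp_mart w N c).

Definition flow_mart t omega : 'cV[R]_n := y t omega *: phi t.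

Let yproc : continuous_process y := exp_mart_process mN N0 good c.

Let yg_process (g : R -> R) : continuous g -> continuous_process (fun t omega => y t omega * g t).
Proof.
move=> cg; apply: continuous_processM => //; apply: continuous_process_fun.
exact: continuous_subspaceT.
Qed.

Lemma flow_mart_square_integrable T i : 0 <= T ->
  (time_mean_sq P T (fun s omega => flow_mart s omega i 0%R) < +oo)%E.
Proof.
move=> T0; have [M M0 hM] := derive_bounds T (fun t => dphi t i) (@flow_drift_continuous i).
pose X s omega := (y (Num.max 0 s) omega * phi (Num.max 0 s) i 0) ^+ 2.
have mX : jointly_measurable X.
  apply: jointly_measurable_sqr.
  exact: (continuous_process_measurable (yg_process (@flow_continuous i))).
have X0 s omega : 0 <= X s omega by exact: sqr_ge0.
rewrite (_ : time_mean_sq _ _ _ = \int[P]_omega \int[mu]_(s in `[0%R, T]) (X s omega)%:E)%E; last first.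
  apply: eq_integral => omega _; apply: eq_integral => s.
  by rewrite inE/= in_itv/= => /andP[s0 _]; rewrite /X (max_r s0) mxE.
rewrite process_tonelli//.
apply: (@le_lt_trans _ _ (\int[mu]_(s in `[0%R, T]) (M ^+ 2 * expR (c ^+ 2 * T))%:E)%E); last first.
  rewrite integral_cst//= lebesgue_measure_itv/= lte_fin.
  by case: ifP => _; rewrite ?mule0 ?ltry// oppr0 adde0 -EFinM ltry.
apply: ge0_le_integral => //.
- by move=> s _; apply: integral_ge0 => omega _; rewrite lee_fin.
- by apply: measurable_funTS; exact: measurable_expectation_process.
move=> s; rewrite /= in_itv/= => /andP[s0 sT]; rewrite /X (max_r s0).
have yL := exp_mart_L2 hw mN N0 good c s0.
under eq_integral do rewrite exprMn mulrC.
rewrite EFin_expectation; last by apply: L1Z; exact: yL.2.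
rewrite RintegralZl//; last exact: yL.2.
rewrite (exp_mart_sqr hw mN N0 good c s0) lee_fin; apply: ler_pM => //.
- exact: sqr_ge0.
- by have [h _ _ _] := hM s s s0 (lexx s) sT; rewrite -real_normK ?num_real// lerXn2r ?nnegrE.
- by rewrite ler_expR ler_wpM2l// sqr_ge0.
Qed.

Lemma flow_mart_solution : linear_sde_solution w F c%:M x0 flow_mart.
Proof.
split.
- move=> t i t0; under eq_fun do rewrite mxE.
  apply: known_atM; first exact: exp_mart_known.
  exact: known_at_cst.
- move=> omega i.
  rewrite (_ : (fun t => _) = (fun t => y t omega * phi t i 0)); last first.
    by apply/funext => t; rewrite mxE.
  exact: (yg_process (@flow_continuous i)).2.
- by move=> T i T0; exact: flow_mart_square_integrable.
move=> t i t0.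
pose f s := phi s i 0; pose g s := (F *m phi s) i 0.
pose J0 omega := y t omega * f t - y 0 omega * f 0 - \int[mu]_(s in `[0, t]) (y s omega * g s).
have mJ : measurable_fun setT J0.
  apply: measurable_funB; last first.
    exact: (measurable_Rintegral_time (X := fun s omega => y s omega * g s)
      _ (yg_process (@flow_drift_continuous i))).
  apply: measurable_funB; apply: measurable_funM => //; exact: yproc.1.
pose J : {RV P >-> R} := HB.pack J0 (isMeasurableFun.Build _ _ _ _ J0 mJ).
have [M M0 hM] := derive_bounds t (fun t => dphi t i) (@flow_drift_continuous i).
exists J.
  rewrite (_ : (fun s omega => _) = (fun s omega => c * (y s omega * f s))); last first.
    by apply/funext => s; apply/funext => omega; rewrite mul_scalar_mx !mxE.
  exact: (exp_mart_ito_integral hw mN N0 good t0 (fun t => dphi t i)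
    (@flow_drift_continuous i) M0 hM).
apply: filterS (exp_mart0_ae mN N0 good c) => omega y1.
rewrite [J omega]/(J0 omega) /J0 y1 mul1r /f phi0 mxE.
rewrite (_ : \int[mu]_(s in `[0, t]) (F *m flow_mart s omega) i 0 =
             \int[mu]_(s in `[0, t]) (y s omega * g s)).
  by ring.
by apply: eq_Rintegral => s _; rewrite -scalemxAr mxE.
Qed.

Lemma flow_mart_second_moment t i j : 0 <= t ->
  (\int[P]_omega (flow_mart t omega i 0%R * flow_mart t omega j 0%R)%:E)%E =
  (expR (c ^+ 2 * t) * (phi t i 0 * phi t j 0))%:E.
Proof.
move=> t0; have yL := exp_mart_L2 hw mN N0 good c t0.
transitivity (\int[P]_omega ((phi t i 0 * phi t j 0) * y t omega ^+ 2)%:E)%E.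
  by apply: eq_integral => omega _; congr EFin; rewrite !mxE; ring.
rewrite EFin_expectation; last by apply: L1Z; exact: yL.2.
rewrite RintegralZl//; last exact: yL.2.
by rewrite (exp_mart_sqr hw mN N0 good c t0) mulrC.
Qed.

End off_exceptional.

Theorem sde_exists : exists x, linear_sde_solution w F c%:M x0 x.
Proof.
have [N [mN N0 good]] := wiener_exceptional_set hw.
by exists (flow_mart N); exact: flow_mart_solution.
Qed.

(** By uniqueness the formula for the explicit solution applies to every
    solution. *)
Theorem sde_second_moment x t i j : linear_sde_solution w F c%:M x0 x -> 0 <= t ->
  ('E_P[fun omega => (x t omega *m (x t omega)^T) i j] =
  (expR (c ^+ 2 * t) * (phi t i 0 * phi t j 0))%:E)%E.
Proof.
move=> sx t0; have [N [mN N0 good]] := wiener_exceptional_set hw.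
have sz := flow_mart_solution mN N0 good.
rewrite -(flow_mart_second_moment mN N0 good)// unlock.
have mx k := (sde_continuous_process k sx).1 t t0.
have mz k := (sde_continuous_process k sz).1 t t0.
apply: ae_eq_integral => //.
- apply/measurable_EFinP.
  under eq_fun do rewrite mxE big_ord1 mxE; exact: measurable_funM.
- by apply/measurable_EFinP; exact: measurable_funM.
apply: filterS2 (sde_unique hw sx sz i t0) (sde_unique hw sx sz j t0) => omega e1 e2 _.
by rewrite mxE big_ord1 mxE e1 e2.
Qed.

End explicit_solution.

(** * The exponential flow of a matrix *)

Section matrix_exponential.
Context {R : realType}.
Variables (n : nat) (F : 'M[R]_n).
Implicit Type v : 'cV[R]_n.

Definition exp_flow_coef v (i : 'I_n) (k : nat) : R := iter k (mulmx F) v i 0 / k`!%:R.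

(** The exponential series applied to [v], coordinate by coordinate: a scalar
    power series can be differentiated termwise. *)
Definition exp_flow v (t : R) : 'cV[R]_n := \col_i limn (pseries (exp_flow_coef v i) t).

(** Differentiating the series replaces [v] by [F *m v], so all derivatives
    are again series of the same kind. *)
Lemma exp_flow_coef_diffs v i :
  pseries_diffs (exp_flow_coef v i) = exp_flow_coef (F *m v) i.
Proof.
apply/funext => k; rewrite /pseries_diffs /exp_flow_coef iterSr factS natrM.
by rewrite invfM mulrCA mulrA mulrA mulfK.
Qed.

Lemma iter_mulmx_bound v : exists K B, [/\ 0 <= K, 0 <= B &
  forall k i, `|iter k (mulmx F) v i 0| <= K * B ^+ k].
Proof.
exists (\sum_j `|v j 0|), (\sum_i \sum_j `|F i j|); split; first exact: sumr_ge0.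
  by apply: sumr_ge0 => i _; exact: sumr_ge0.
move=> k; set B := \sum_i _; set K := \sum_j _.
suff h : \sum_i `|iter k (mulmx F) v i 0| <= K * B ^+ k.
  move=> i; apply: le_trans h; rewrite (bigD1 i)//= lerDl; exact: sumr_ge0.
elim: k => [|k ih]; first by rewrite expr0 mulr1.
rewrite exprS mulrCA; apply: (@le_trans _ _ (B * \sum_j `|iter k (mulmx F) v j 0|)).
  rewrite /B mulr_suml; apply: ler_sum => i _; rewrite iterS mxE.
  apply: (le_trans (ler_norm_sum _ _ _)); rewrite mulr_suml; apply: ler_sum => j _.
  rewrite normrM ler_wpM2l// (bigD1 j)//= lerDl; exact: sumr_ge0.
by rewrite ler_wpM2l//; apply: sumr_ge0 => i _; exact: sumr_ge0.
Qed.

Lemma exp_flow_cvg v i (t : R) : cvgn (pseries (exp_flow_coef v i) t).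
Proof.
have [K [B [K0 B0 hKB]]] := iter_mulmx_bound v.
apply: normed_cvg; rewrite /pseries.
apply: (@series_le_cvg _ _ (fun k => K * exp_coeff (B * `|t|) k)) => [k|k|k|].
- exact: normr_ge0.
- by rewrite mulr_ge0// exp_coeff_ge0// mulr_ge0.
- rewrite /exp_flow_coef /exp_coeff /= normrM normrM normrX exprMn.
  rewrite normfV normr_nat mulrAC -!mulrA [K * _]mulrA.
  by apply: ler_pM => //; rewrite ?mulr_ge0.
- exact: is_cvg_seriesZ (@is_cvg_series_exp_coeff _ _).
Qed.

Lemma exp_flow0 v : exp_flow v 0 = v.
Proof.
apply/colP => i; rewrite mxE; apply: cvg_lim => //.
rewrite -cvg_shiftS (_ : (fun k => _) = cst (v i 0)); first exact: cvg_cst.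
apply/funext => k; rewrite /pseries /series /= big_nat_recl// expr0 mulr1 big1 => [|j _].
  by rewrite addr0 /exp_flow_coef divr1.
by rewrite exprS mul0r mulr0.
Qed.

Lemma exp_flow_mulmx v t : exp_flow (F *m v) t = F *m exp_flow v t.
Proof.
apply/colP => i; rewrite !mxE; apply: cvg_lim => //.
rewrite (_ : pseries _ _ = (fun m => \sum_j F i j * pseries (exp_flow_coef v j) t m)).
  apply: cvg_big => [|j _]; first exact: add_continuous.
  by apply: cvgM; [exact: cvg_cst|rewrite mxE; exact: exp_flow_cvg].
apply/funext => m; rewrite /pseries /series /=.
under [RHS]eq_bigr do rewrite mulr_sumr.
rewrite exchange_big /=; apply: eq_bigr => k _.
rewrite /exp_flow_coef -iterSr iterS mxE !mulr_suml; apply: eq_bigr => j _; ring.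
Qed.

Lemma exp_flow_derive v (t : R) i :
  is_derive t 1 (fun s => exp_flow v s i 0) ((F *m exp_flow v t) i 0).
Proof.
rewrite -exp_flow_mulmx mxE -exp_flow_coef_diffs.
rewrite (_ : (fun s => _) = (fun s => limn (pseries (exp_flow_coef v i) s))); last first.
  by apply/funext => s; rewrite mxE.
apply: (@pseries_snd_diffs _ _ (`|t| + 1)); rewrite ?exp_flow_coef_diffs; try exact: exp_flow_cvg.
by rewrite [ltRHS]ger0_norm ?addr_ge0// ltrDl.
Qed.

End matrix_exponential.

(** * The Hautus test and the Lyapunov inequality *)

Section lyapunov.
Local Open Scope sesquilinear_scope.
Variable C : numClosedFieldType.
Local Notation "''[' u ]" := (dotmx u u) : ring_scope.

Lemma adjM m n p (M : 'M[C]_(m, n)) (N : 'M[C]_(n, p)) : (M *m N)^t* = N^t* *m M^t*.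
Proof. by rewrite trmx_mul map_mxM. Qed.

Lemma adjN m n (M : 'M[C]_(m, n)) : (- M)^t* = - M^t*.
Proof. by rewrite raddfN map_mxN. Qed.

Lemma adjZ m n a (M : 'M[C]_(m, n)) : (a *: M)^t* = a^* *: M^t*.
Proof. by rewrite linearZ map_mxZ. Qed.

Definition qform n (Q : 'M[C]_n) (u : 'rV[C]_n) : C := (u *m Q *m u^t*) 0 0.

(** The inequality is in the partial order of [C], so it also says that the
    form takes real values. *)
Definition coercive n (Q : 'M[C]_n) :=
  exists2 e : C, 0 < e & forall u, e * '[u] <= qform Q u.

Lemma qformD n (Q Q' : 'M[C]_n) u : qform (Q + Q') u = qform Q u + qform Q' u.
Proof. by rewrite /qform mulmxDr mulmxDl mxE. Qed.

Lemma qformN n (Q : 'M[C]_n) u : qform (- Q) u = - qform Q u.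
Proof. by rewrite /qform mulmxN mulNmx mxE. Qed.

Lemma qformZ n a (Q : 'M[C]_n) u : qform (a *: Q) u = a * qform Q u.
Proof. by rewrite /qform -scalemxAr -scalemxAl mxE. Qed.

Lemma qform_adj n (Q : 'M[C]_n) u : qform (Q^t*) u = (qform Q u)^*.
Proof.
rewrite /qform -[LHS]trace_mx11 -mxtrace_tr trace_mx11.
rewrite (_ : (_ *m _)^T = (u *m Q *m u^t*) ^ Num.conj); first by rewrite mxE.
rewrite !trmx_mul !map_mxM /= !map_trmx !trmxK mulmxA.
congr (_ *m _); apply/matrixP => i j; by rewrite !mxE /= conjCK.
Qed.

Lemma coercive_gt0 n (Q : 'M[C]_n) u : coercive Q -> u != 0 -> 0 < qform Q u.
Proof.
by move=> [e e0 h] u0; apply: lt_le_trans (h u); rewrite mulr_gt0// dnorm_gt0.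
Qed.

Lemma coercive_unitmx n (Q : 'M[C]_n) : coercive Q -> Q \in unitmx.
Proof.
move=> cQ; rewrite -row_free_unit -kermx_eq0; apply/negPn/negP => /rowV0Pn[u].
rewrite sub_kermx => /eqP uQ u0; have := coercive_gt0 cQ u0.
by rewrite /qform uQ mul0mx mxE ltxx.
Qed.

Lemma coerciveZ n a (Q : 'M[C]_n) : 0 < a -> coercive Q -> coercive (a *: Q).
Proof.
move=> a0 [e e0 h]; exists (a * e); first exact: mulr_gt0.
by move=> u; rewrite qformZ -mulrA ler_wpM2l// ltW.
Qed.

(** Cauchy-Schwarz against each column. *)
Lemma dnorm_mulmx_le m n (S : 'M[C]_(m, n)) : exists2 c, 0 <= c &
  forall u : 'rV[C]_m, '[u *m S] <= c * '[u].
Proof.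
exists (\sum_j '[(col j S)^t*]); first by apply: sumr_ge0 => j _; exact: dnorm_ge0.
move=> u; rewrite mulr_suml dotmxE mxE; apply: ler_sum => j _.
rewrite !mxE -normCK mulrC.
have := (CauchySchwarz (@dotmx C m) u ((col j S)^t*)).1; congr (`|_| ^+ 2 <= _).
by rewrite /= dotmxE trmxCK mxE; apply: eq_bigr => i _; rewrite mxE.
Qed.

Lemma coercive_congr n (S Q : 'M[C]_n) : S \in unitmx -> coercive Q ->
  coercive (S *m Q *m S^t*).
Proof.
move=> uS [e e0 h]; have [c c0 hc] := dnorm_mulmx_le (invmx S).
exists (e / (c + 1)) => [|u]; first by rewrite divr_gt0// ltr_wpDl.
have -> : qform (S *m Q *m S^t*) u = qform Q (u *m S) by rewrite /qform adjM !mulmxA.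
apply: le_trans (h _); rewrite -mulrA; apply: ler_wpM2l; first exact: ltW.
rewrite mulrC ler_pdivrMr ?ltr_wpDl//.
have := hc (u *m S); rewrite mulmxK// => h1; apply: le_trans h1 _.
by rewrite mulrDr mulr1 mulrC lerDl dnorm_ge0.
Qed.

Lemma dnorm0 n : '[0 : 'rV[C]_n] = 0.
Proof. by rewrite dotmxE mul0mx mxE. Qed.

Lemma dotmx_row n1 n2 (u v : 'rV[C]_n1) (x y : 'rV[C]_n2) :
  dotmx (row_mx u x) (row_mx v y) = dotmx u v + dotmx x y.
Proof. by rewrite !dotmxE tr_row_mx map_col_mx mul_row_col mxE. Qed.

Lemma qform_block n (Q : 'M[C]_n) (g : 'rV[C]_n) (q x : C) (u : 'rV[C]_n) :
  qform (block_mx Q (g^t*) g q%:M) (row_mx u x%:M) =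
  qform Q u + (x * dotmx g u + (x * dotmx g u)^*) + q * (x * x^*).
Proof.
rewrite /qform mul_row_block tr_row_mx map_col_mx mul_row_col !mulmxDl.
have D (X Y : 'M[C]_1) : (X + Y) 0 0 = X 0 0 + Y 0 0 by rewrite mxE.
rewrite !D tr_scalar_mx map_scalar_mx.
have e1 : (x%:M *m g *m u^t*) 0 0 = x * dotmx g u.
  by rewrite mul_scalar_mx -scalemxAl mxE dotmxE.
have e2 : (u *m g^t* *m x^*%:M) 0 0 = (x * dotmx g u)^*.
  rewrite mul_mx_scalar mxE rmorphM; congr (_ * _).
  rewrite dotmxE !mxE rmorph_sum; apply: eq_bigr => i _ /=.
  by rewrite !mxE rmorphM /= conjCK mulrC.
have e3 : (x%:M *m q%:M *m (x^*%:M : 'M[C]_1)) 0 0 = q * (x * x^*).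
  by rewrite -!scalar_mxM mxE eqxx mulr1n; ring.
by rewrite e1 e2 e3; ring.
Qed.

(** Completing the square in [u]: half of the coercivity of [Q] absorbs the
    cross terms, at the price of [2 / e * |g| ^ 2] in the last coordinate. *)
Lemma block_coercive n (Q : 'M[C]_n) (g : 'rV[C]_n) (q e : C) :
  0 < e -> (forall u, e * '[u] <= qform Q u) -> 2 / e * '[g] < q ->
  coercive (block_mx Q (g^t*) g q%:M).
Proof.
move=> e0 hQ gq; set r := q - 2 / e * '[g]; have r0 : 0 < r by rewrite subr_gt0.
have qE : q = r + 2 / e * '[g] by rewrite subrK.
clearbody r.
have e20 : 0 < e / 2 by rewrite divr_gt0.
have s0 : 0 < e / 2 + r by exact: addr_gt0.
exists ((e / 2) * r / (e / 2 + r)); first by rewrite divr_gt0// mulr_gt0.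
move=> U; rewrite -(hsubmxK U) (mx11_scalar (rsubmx U)).
set u := lsubmx U; set x := rsubmx U 0 0.
rewrite qform_block dotmx_row.
have -> : '[x%:M : 'rV[C]_1] = x * x^*.
  by rewrite dotmxE tr_scalar_mx map_scalar_mx -scalar_mxM mxE eqxx mulr1n.
have x0 : 0 <= x * x^* by rewrite -normCK exprn_ge0.
have u0 : 0 <= '[u] by exact: dnorm_ge0.
have key : 0 <= e / 2 * '[u] + (x * dotmx g u + (x * dotmx g u)^*) + 2 / e * '[g] * (x * x^*).
  have h : 0 <= e / 2 * '[u + (2 / e * x) *: g] by rewrite mulr_ge0 ?dnorm_ge0// ltW.
  apply: le_trans h _; rewrite le_eqVlt; apply/orP; left; apply/eqP.
  have ug a : dotmx u (a *: g) = a^* * (dotmx g u)^*.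
    rewrite -rmorphM /= !dotmxE adjZ -scalemxAr mxE rmorphM; congr (_ * _).
    by rewrite !mxE rmorph_sum; apply: eq_bigr => i _; rewrite !mxE rmorphM /= conjCK mulrC.
  have re : e^* = e by exact: conj_Creal (gtr0_real e0).
  rewrite dnormD /= dnormZ /= normCK ug !rmorphM /= !fmorphV /= !conjCK !conjC_nat !re.
  by field; rewrite ?gt_eqF.
have -> : e / 2 * r / (e / 2 + r) * ('[u] + x * x^*) =
  e / 2 * '[u] - (e / 2) ^+ 2 / (e / 2 + r) * '[u] + (r * (x * x^*) - r ^+ 2 / (e / 2 + r) * (x * x^*)).
  have er : e + r * 2 != 0 by rewrite gt_eqF// addr_gt0// mulr_gt0.
  by field.
apply: (@le_trans _ _ (e / 2 * '[u] + r * (x * x^*))).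
  by rewrite lerD// gerBl mulr_ge0// divr_ge0 ?exprn_ge0 ?ltW.
rewrite -subr_ge0; apply: le_trans key _; rewrite -subr_ge0.
have := hQ u; rewrite -subr_ge0; congr (0 <= _).
by rewrite qE; field; rewrite gt_eqF.
Qed.

Lemma block_diag_coercive n (Q : 'M[C]_n) (q : C) : 0 < q -> coercive Q ->
  coercive (block_mx Q 0 0 q%:M : 'M[C]_(n + 1)).
Proof.
move=> q0 [e e0 h]; rewrite [X in block_mx _ X](_ : 0 = (0 : 'rV[C]_n)^t*).
  by apply: (block_coercive e0 h); rewrite dnorm0 mulr0.
by rewrite trmx0 map_mx0.
Qed.

(** With [Y = K *m P] this is the closed-loop matrix [A + B *m K] times [P].
    The Lyapunov inequality is linear in [P] and [Y], which is what makes
    taking real parts possible at the end. *)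
Definition closed_loop_mx n m (A : 'M[C]_n) (B : 'M[C]_(n, m)) (P : 'M[C]_n) (Y : 'M[C]_(m, n)) :=
  A *m P + B *m Y.

Definition lyapunov_feasible n m (A : 'M[C]_n) (B : 'M[C]_(n, m)) :=
  exists P Y, [/\ P^t* = P, coercive P &
    coercive (- (closed_loop_mx A B P Y + (closed_loop_mx A B P Y)^t* ))].

(** Every mode that the input cannot reach is stable. *)
Definition hautus_stable n m (A : 'M[C]_n) (B : 'M[C]_(n, m)) :=
  forall (v : 'rV[C]_n) mu, v != 0 -> v *m A = mu *: v -> v *m B = 0 -> 'Re mu < 0.

Lemma lyapunov_feasible_feedback n m (A : 'M[C]_n) (B : 'M[C]_(n, m)) K :
  lyapunov_feasible (A + B *m K) B -> lyapunov_feasible A B.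
Proof.
move=> [P [Y [PH cP cM]]]; exists P, (K *m P + Y); split => //.
by rewrite /closed_loop_mx mulmxDr mulmxA addrA -mulmxDl.
Qed.

Lemma lyapunov_feasible_similar n m (A T : 'M[C]_n) (B : 'M[C]_(n, m)) : T \in unitmx ->
  lyapunov_feasible (T *m A *m invmx T) (T *m B) -> lyapunov_feasible A B.
Proof.
move=> uT [P [Y [PH cP cM]]]; have uS : invmx T \in unitmx by rewrite unitmx_inv.
set S := invmx T in uS *.
exists (S *m P *m S^t*), (Y *m S^t*); split; last 2 first.
- exact: coercive_congr.
- have -> : closed_loop_mx A B (S *m P *m S^t*) (Y *m S^t*) =
      S *m closed_loop_mx (T *m A *m S) (T *m B) P Y *m S^t*.
    rewrite /closed_loop_mx mulmxDr mulmxDl !mulmxA mulVmx// mul1mx.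
    by rewrite mul1mx.
  set M := closed_loop_mx _ _ _ _ in cM *.
  clearbody M.
  rewrite (_ : - _ = S *m (- (M + M^t*)) *m S^t*); first exact: coercive_congr.
  by rewrite !adjM trmxCK mulmxN mulNmx mulmxDr mulmxDl !mulmxA.
- by rewrite !adjM trmxCK PH mulmxA.
Qed.

Lemma hautus_stable_feedback n m (A : 'M[C]_n) (B : 'M[C]_(n, m)) K :
  hautus_stable A B -> hautus_stable (A + B *m K) B.
Proof.
move=> cAB v mu v0 vA vB; apply: (cAB v mu v0 _ vB).
by rewrite -vA mulmxDr mulmxA vB mul0mx addr0.
Qed.

Lemma hautus_stable_similar n m (A T : 'M[C]_n) (B : 'M[C]_(n, m)) : T \in unitmx ->
  hautus_stable A B -> hautus_stable (T *m A *m invmx T) (T *m B).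
Proof.
move=> uT cAB v mu v0 vA vB; apply: (cAB (v *m T)); last by rewrite -mulmxA.
  by apply: contra v0 => /eqP vT; rewrite -(mulmxK uT v) vT mul0mx.
by rewrite scalemxAl -vA !mulmxA mulmxKV.
Qed.

(** The weight [p] of the stable mode is taken so large that its decay
    dominates the coupling with the other modes. *)
Lemma lyapunov_feasible_stable_mode n m (A : 'M[C]_n) (B : 'M[C]_(n, m)) c mu b :
  'Re mu < 0 -> lyapunov_feasible A B ->
  lyapunov_feasible (block_mx A 0 c mu%:M : 'M[C]_(n + 1)) (col_mx B b).
Proof.
move=> mu0 [P [Y [PH cP cM]]]; case: (cM) => e e0 he.
set g := c *m P + b *m Y.
pose p : C := (e^-1 * '[g] + 1) / (- 'Re mu).
have nmu : 0 < - 'Re mu by rewrite oppr_gt0.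
have p0 : 0 < p.
  by rewrite divr_gt0// ltr_wpDl// mulr_ge0 ?dnorm_ge0// invr_ge0 ltW.
have pr : p^* = p by exact: conj_Creal (gtr0_real p0).
exists (block_mx P 0 0 p%:M), (row_mx Y 0); split.
- by rewrite tr_block_mx map_block_mx /= PH !trmx0 !map_mx0 tr_scalar_mx map_scalar_mx /= pr.
- exact: block_diag_coercive.
rewrite (_ : - _ = block_mx (- (closed_loop_mx A B P Y + (closed_loop_mx A B P Y)^t* ))
    ((- g)^t*) (- g) (- (p * (mu + mu^*)))%:M).
  apply: (block_coercive e0 he); rewrite -scaleN1r dnormZ normrN1 expr1n mul1r.
  rewrite (_ : - (p * _) = 2 * (p * - 'Re mu)); last by rewrite ReE; field.
  rewrite -mulrA ltr_pM2l// /p divfK ?gt_eqF// ltrDl//.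
rewrite /closed_loop_mx mul_col_row mulmx_block add_block_mx.
rewrite tr_block_mx map_block_mx /= add_block_mx opp_block_mx.
rewrite !mulmx0 !mul0mx !addr0 ?add0r.
rewrite !trmx0 !map_mx0 ?addr0 ?add0r adjN; congr block_mx.
by rewrite -scalar_mxM tr_scalar_mx map_scalar_mx /= -!raddfD -raddfN /= rmorphM /= pr; congr (_%:M); ring.
Qed.

(** The feedback [y] moves the real part of the mode to [-1]. It also disturbs
    the other modes, which is compensated by the large weight [tau] given to
    them. *)
Lemma lyapunov_feasible_reached_mode n m (A : 'M[C]_n) (B : 'M[C]_(n, m)) mu (b : 'rV[C]_m) P :
  P^t* = P -> coercive P -> coercive (- (A *m P + (A *m P)^t*)) -> b != 0 ->
  lyapunov_feasible (block_mx A 0 0 mu%:M : 'M[C]_(n + 1)) (col_mx B b).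
Proof.
move=> PH cP [e e0 he] b0.
have nb : 0 < '[b] by rewrite dnorm_gt0.
pose t := ('Re mu + 1) / '[b].
pose y : 'cV[C]_m := - t *: b^t*.
have by_ : b *m y = (- ('Re mu + 1))%:M.
  rewrite /y -scalemxAr [b *m _]mx11_scalar -dotmxE.
  by rewrite scale_scalar_mx /t mulNr divfK// gt_eqF.
set g : 'rV[C]_n := - ((B *m y)^t*).
pose tau : C := '[g] / e + 1.
have tau0 : 0 < tau by rewrite ltr_wpDl// divr_ge0 ?dnorm_ge0// ltW.
have tr : tau^* = tau by exact: conj_Creal (gtr0_real tau0).
exists (block_mx (tau *: P) 0 0 1%:M), (row_mx 0 y); split.
- by rewrite tr_block_mx map_block_mx /= adjZ /= PH tr !trmx0 !map_mx0 tr_scalar_mx map_scalar_mx /= rmorph1.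
- by apply: block_diag_coercive => //; exact: coerciveZ.
rewrite (_ : - _ = block_mx (tau *: (- (A *m P + (A *m P)^t*)))
    (g^t*) g 2%:M).
  apply: (block_coercive (e := tau * e)) => [|u|]; first exact: mulr_gt0.
    by rewrite qformZ -mulrA ler_wpM2l// ltW.
  rewrite -mulrA gtr_pMr// mulrC ltr_pdivrMr ?mulr_gt0// mul1r /tau mulrDl mul1r divfK ?gt_eqF// ltrDl//.
rewrite /closed_loop_mx mul_col_row mulmx_block add_block_mx.
rewrite tr_block_mx map_block_mx /= add_block_mx opp_block_mx.
rewrite !mulmx0 !mul0mx !addr0 ?add0r.
rewrite !trmx0 !map_mx0 ?addr0 ?add0r; congr block_mx.
- by rewrite -scalemxAr adjZ /= tr scalerN scalerDr.
- by rewrite /g adjN trmxCK.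
rewrite mulmx1 by_ -raddfD /= tr_scalar_mx map_scalar_mx -!raddfD -raddfN /=; congr (_%:M).
by rewrite rmorphB rmorphD rmorph1 /= (conj_Creal (Creal_Re mu)) ReE; field.
Qed.

(** A triangular form isolates a last mode [mu]; the other modes satisfy the
    hypothesis again. If [mu] is unstable, a feedback on the other modes makes
    them stable, so that [mu] is no longer an eigenvalue of their block and
    the last mode can be decoupled from them by a change of basis; by
    hypothesis the input reaches it. *)
Theorem hautus_stable_feasible n m (A : 'M[C]_n) (B : 'M[C]_(n, m)) :
  hautus_stable A B -> lyapunov_feasible A B.
Proof.
elim: n => [|n ih] in A B *.
  move=> _; have c0 (Q : 'M[C]_0) : coercive Q.
    by exists 1 => // u; rewrite (thinmx0 u) /qform mul0mx mul0mx mxE dnorm0 mulr0.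
  exists 0, 0; split => //; by rewrite trmx0 map_mx0.
have [T Tu] := Schur A isT; rewrite /similar_to conjumx ?unitarymx_unit//.
have uT := unitarymx_unit Tu.
move=> trigA /(hautus_stable_similar uT) cAB; apply: (lyapunov_feasible_similar uT).
move: cAB trigA; move: (T *m A *m invmx T) (T *m B) => {A B T Tu uT}.
rewrite -(addn1 n) => A B.
rewrite -(submxK A) -(vsubmxK B) is_trig_block_mx//.
set A1 := ulsubmx A; set c := dlsubmx A; set B1 := usubmx B; set b := dsubmx B.
rewrite [drsubmx A]mx11_scalar; set mu := drsubmx A 0 0.
move=> cAB /andP[/eqP ur0 _]; rewrite ur0 in cAB *.
have feas1 : lyapunov_feasible A1 B1.
  apply: ih => v nu v0 vA vB; apply: (cAB (row_mx v 0)).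
  - by apply: contra v0 => /eqP h; rewrite -(row_mxKl v (0 : 'rV[C]_1)) h linear0.
  - by rewrite mul_row_block !mul0mx !addr0 vA mulmx0 scale_row_mx scaler0.
  - by rewrite mul_row_col vB mul0mx addr0.
have [mu0|mu0] : 'Re mu < 0 \/ 0 <= 'Re mu.
- by apply/orP; rewrite real_ltNge ?Creal_Re// ?real0// orNb.
- exact: lyapunov_feasible_stable_mode.
have [P [Y [PH cP cM]]] := feas1.
have uP := coercive_unitmx cP.
pose K := row_mx (Y *m invmx P) 0 : 'M[C]_(m, n + 1).
apply: (@lyapunov_feasible_feedback _ _ _ _ K).
move/(@hautus_stable_feedback _ _ _ _ K) : cAB.
rewrite mul_col_row add_block_mx !mulmx0 !addr0.
set F := A1 + _ in cM *; set c' := c + _.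
have FP : closed_loop_mx A1 B1 P Y = F *m P.
  by rewrite /closed_loop_mx /F mulmxDl !mulmxA mulmxKV.
rewrite FP in cM.
(* an eigenvector of [F] for [mu] would contradict the Lyapunov inequality *)
have uF : mu%:M - F \in unitmx.
  rewrite -row_free_unit -kermx_eq0; apply/negPn/negP => /rowV0Pn[u].
  rewrite sub_kermx mulmxBr subr_eq0 mul_mx_scalar => /eqP uF u0.
  have := coercive_gt0 cM u0.
  rewrite qformN qformD qform_adj /qform mulmxA -uF -!scalemxAl mxE.
  have Pu := coercive_gt0 cP u0; rewrite -/(qform P u) rmorphM /=.
  rewrite (conj_Creal (gtr0_real Pu)) -mulrDl oppr_gt0 pmulr_llt0// => h.
  by move: mu0; rewrite ReE pmulr_lge0 ?invr_gt0// => /le_lt_trans/(_ h); rewrite ltxx.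
(* [(s, 1)] is a left eigenvector for [mu] *)
set s := c' *m invmx (mu%:M - F).
have sF : s *m F + c' = mu *: s.
  have : s *m (mu%:M - F) = c' by rewrite mulmxKV.
  by move=> <-; rewrite mulmxBr mul_mx_scalar addrC subrK.
pose T : 'M[C]_(n + 1) := block_mx 1%:M 0 s 1%:M.
pose Ti : 'M[C]_(n + 1) := block_mx 1%:M 0 (- s) 1%:M.
have TTi : T *m Ti = 1%:M.
  rewrite mulmx_block !mulmx0 !mul0mx !mulmx1 !mul1mx !addr0 add0r subrr.
  by rewrite -scalar_mx_block.
have uT : T \in unitmx by case/mulmx1_unit: TTi.
have TiE : invmx T = Ti by rewrite -[LHS]mulmx1 -TTi mulKmx.
move/(hautus_stable_similar uT) => cAB; apply: (lyapunov_feasible_similar uT).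
move: cAB; rewrite TiE /T /Ti !mulmx_block mul_block_col.
rewrite !mulmx0 !mul0mx !mulmx1 !mul1mx !addr0 ?add0r.
rewrite sF !mulmxN mul0mx oppr0 addr0 mul_scalar_mx subrr.
set b' := s *m B1 + b => cAB.
apply: (lyapunov_feasible_reached_mode _ _ PH cP cM).
apply/eqP => b0; have : 'Re mu < 0.
  apply: (cAB (row_mx 0 1%:M)).
  - apply/eqP => h; have := congr1 rsubmx h; rewrite row_mxKr linear0 => /matrixP/(_ 0 0).
    by rewrite !mxE eqxx; apply/eqP; rewrite oner_eq0.
  - by rewrite mul_row_block !mul0mx !mul1mx !add0r scale_row_mx scaler0 scalemx1.
  - by rewrite mul_row_col mul0mx mul1mx b0 addr0.
by move=> /(le_lt_trans mu0); rewrite ltxx.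
Qed.

End lyapunov.

(** * Symmetric eigenmatrices and scalar noise *)

Section complexification.
Variable R : realType.
Local Notation toC := (@complexify R _ _).

Lemma complexifyM m n p (M : 'M[R]_(m, n)) (N : 'M[R]_(n, p)) :
  complexify (M *m N) = complexify M *m complexify N.
Proof. exact: map_mxM. Qed.

Lemma complexifyD m n (M N : 'M[R]_(m, n)) : complexify (M + N) = complexify M + complexify N.
Proof. exact: map_mxD. Qed.

Lemma complexify_tr m n (M : 'M[R]_(m, n)) : complexify M^T = (complexify M)^T.
Proof. by rewrite /complexify map_trmx. Qed.

Lemma complexify_inj m n : injective (@complexify R m n).
Proof. exact: map_mx_inj. Qed.

Lemma complexify_scalar n (a : R) : complexify (a%:M : 'M[R]_n) = (real_complex R a)%:M.
Proof. exact: map_scalar_mx. Qed.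

Lemma tr_addmx (V : nmodType) m n (M N : 'M[V]_(m, n)) : (M + N)^T = M^T + N^T.
Proof. by apply/matrixP => i j; rewrite !mxE. Qed.

Lemma intertwining_scalar n (C : 'M[R]_n) :
  (exists C1 : 'M[R]_n, forall X : 'M[R[i]]_n, X^T = X ->
       (complexify C)^T *m X *m complexify C
       = X *m complexify C1 + (complexify C1)^T *m X) ->
  exists c, C = c%:M.
Proof.
move=> [C1 h].
have hR (X : 'M[R]_n) : X^T = X -> C^T *m X *m C = X *m C1 + C1^T *m X.
  move=> XT; apply: complexify_inj.
  by rewrite !(complexifyM, complexifyD, complexify_tr) h// -complexify_tr XT.
have dsym i j : (delta_mx i j + delta_mx j i : 'M[R]_n)^T = delta_mx i j + delta_mx j i.
  by rewrite raddfD /= !trmx_delta addrC.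
have dl (D : 'M[R]_n) i j k l : (delta_mx i j *m D) k l = (k == i)%:R * D j l.
  rewrite mxE (bigD1 j)//= big1 => [|a /negPf aj]; first by rewrite !mxE eqxx andbT addr0.
  by rewrite !mxE aj andbF mul0r.
have dr (D : 'M[R]_n) i j k l : (D *m delta_mx i j) k l = D k i * (l == j)%:R.
  rewrite mxE (bigD1 i)//= big1 => [|a /negPf aj]; first by rewrite !mxE eqxx addr0.
  by rewrite !mxE aj mulr0.
have hE i j k l : C i k * C j l + C j k * C i l =
    (k == i)%:R * C1 j l + (k == j)%:R * C1 i l +
    (C1 i k * (l == j)%:R + C1 j k * (l == i)%:R).
  have := hR _ (dsym i j); move/matrixP/(_ k l).
  rewrite mulmxDr mulmxDl -!mulmxA mulmxDl mulmxDr.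
  have D (M N : 'M[R]_n) : (M + N) k l = M k l + N k l by rewrite mxE.
  rewrite !D !dl !dr [C1^T k i]mxE [C1^T k j]mxE.
  have rk (p q : 'I_n) : (C^T *m (delta_mx p q *m C)) k l = C p k * C q l.
    rewrite mxE (bigD1 p)//= big1 => [|a /negPf ap]; last by rewrite dl ap mul0r mulr0.
    by rewrite dl eqxx mul1r mxE addr0.
  by rewrite !rk.
have diag i k : k != i -> C i k = 0.
  move=> /negPf ki; have := hE i i k k; rewrite ki !mul0r !mulr0 !addr0 => /eqP.
  by rewrite -mulr2n mulrn_eq0 /= mulf_eq0 orbb => /eqP.
have hd i : C i i ^+ 2 = 2 * C1 i i.
  by have := hE i i i i; rewrite eqxx expr2 /=; lra.
have same i j : C i i = C j j.
  have [->//|ij] := eqVneq i j.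
  have := hE i j i j; rewrite !eqxx (diag j i)// (negPf ij) eq_sym (negPf ij).
  rewrite !(mul0r, mulr0, mul1r, mulr1, addr0, add0r) => e.
  have : (C i i - C j j) ^+ 2 = 0 by rewrite sqrrB !hd -mulrnAl mulr2n; lra.
  by move/eqP; rewrite sqrf_eq0 subr_eq0 => /eqP.
have [i0 _|no] := pickP 'I_n; last first.
  by exists 0; apply/matrixP => i; have := no i.
exists (C i0 i0); apply/matrixP => i j; rewrite mxE.
have [<-|ij] := eqVneq i j; first by rewrite mulr1n (same i i0).
by rewrite mulr0n diag// eq_sym.
Qed.

(** The difference between the equations for [K] and for [0] is
    [Z K + (Z K)^T = 0], with [Z = X B]; for the matrix unit [K] at [(k, a)],
    its entry [(a, a)] is twice [Z a k]. *)
Lemma unremovable_spectrumP n m (A : 'M[R]_n) (B : 'M[R]_(n, m)) (C : 'M[R]_n) lambda :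
  unremovable_spectrum A B C lambda <-> exists X : 'M[R[i]]_n,
    [/\ X^T = X, X != 0,
        X *m complexify A + (complexify A)^T *m X
        + (complexify C)^T *m X *m complexify C = lambda *: X &
        X *m complexify B = 0].
Proof.
split=> [[X [XT X0 hX]]|[X [XT X0 hX XB]]]; exists X; split; [exact: XT|exact: X0| | |exact: XT|exact: X0|].
- by rewrite -(hX 0) mulmx0 addr0.
- have e K : X *m (complexify B *m complexify K) + (complexify B *m complexify K)^T *m X = 0.
    have := hX K; rewrite -(hX 0) mulmx0 addr0 => /(addIr _).
    rewrite complexifyD complexifyM tr_addmx mulmxDr mulmxDl addrACA.
    by rewrite -[RHS]addr0 => /addrI.
  set Z := X *m complexify B; apply/matrixP => a k.
  have := e (delta_mx k a); move/matrixP/(_ a a).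
  have -> : X *m (complexify B *m complexify (delta_mx k a)) = Z *m delta_mx k a.
    by rewrite mulmxA /complexify map_delta_mx.
  have -> : (complexify B *m complexify (delta_mx k a))^T *m X = (Z *m delta_mx k a)^T.
    by rewrite /Z -mulmxA [in RHS]trmx_mul XT /complexify map_delta_mx.
  have zz : (Z *m delta_mx k a) a a = Z a k.
    rewrite mxE (bigD1 k)//= big1 => [|b /negPf bk]; first by rewrite !mxE !eqxx addr0 mulr1.
    by rewrite !mxE bk mulr0.
  rewrite mxE [X in _ + X]mxE zz [RHS]mxE -mulr2n => /eqP.
  by rewrite mulrn_eq0 /= => /eqP ->; rewrite mxE.
- move=> K; rewrite complexifyD complexifyM tr_addmx mulmxDr mulmxDl mulmxA XB mul0mx addr0.
  have -> : (complexify B *m complexify K)^T *m X = 0.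
    by rewrite -[X in _ *m X]XT -trmx_mul mulmxA XB mul0mx trmx0.
  by rewrite addr0.
Qed.

Lemma Re_complexE (z : R[i]) : 'Re z = (complex.Re z)%:C%C.
Proof. by rewrite ReE ReJ_add. Qed.

Definition shifted n (A : 'M[R]_n) (c : R) : 'M[R]_n := A + (c ^+ 2 / 2)%:M.

(** The quadratic term [C^T X C = c ^ 2 X] is split evenly between the two
    linear terms. *)
Lemma shifted_lyapunov n (A : 'M[R]_n) c (X : 'M[R[i]]_n) :
  X *m complexify A + (complexify A)^T *m X
    + (complexify c%:M)^T *m X *m complexify c%:M =
  X *m complexify (shifted A c) + (complexify (shifted A c))^T *m X.
Proof.
rewrite /shifted complexifyD !complexify_scalar tr_addmx !tr_scalar_mx.
rewrite mulmxDr mulmxDl !mul_mx_scalar !mul_scalar_mx scalerA.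
set s := real_complex R c; set h := real_complex R _.
have -> : s * s = h + h by rewrite -rmorphM -rmorphD /=; congr real_complex_def; field.
by rewrite scalerDl addrACA.
Qed.

(** A left eigenvector [v] for [mu] gives the symmetric matrix [v^T v] with
    eigenvalue [2 mu]; transposition is not accompanied by conjugation, so the
    eigenvalues add up to [2 mu] and not to [2 Re mu]. *)
Lemma no_bad_spectrum_hautus n m (A : 'M[R]_n) (B : 'M[R]_(n, m)) c :
  ~ (exists (X : 'M[R[i]]_n) (lambda : R[i]),
         [/\ X^T = X, X != 0,
             X *m complexify (shifted A c) + (complexify (shifted A c))^T *m X = lambda *: X,
             X *m complexify B = 0 & 0 <= complex.Re lambda]) ->
  hautus_stable (complexify (shifted A c)) (complexify B).
Proof.
move=> no v mu v0 vA vB; rewrite Re_complexE ltcR ltNge; apply/negP => mu0.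
apply: no; exists (v^T *m v), (mu *+ 2); split.
- by rewrite trmx_mul trmxK.
- apply: contra v0 => /eqP vv; apply/eqP/rowP => i.
  have := congr1 (fun M : 'M[R[i]]_n => M i i) vv; rewrite !mxE big_ord1 !mxE => /eqP.
  by rewrite mulf_eq0 orbb => /eqP.
- have vT : (mu *: v)^T = mu *: v^T by apply/matrixP => i j; rewrite !mxE.
  by rewrite -mulmxA vA mulmxA -trmx_mul vA vT -scalemxAr -scalemxAl -scalerDl mulr2n.
- by rewrite -mulmxA vB mulmx0.
- by rewrite mulr2n raddfD /= addr_ge0.
Qed.

End complexification.

(** * Real stabilizing feedback *)

Section real_feedback.
Local Open Scope sesquilinear_scope.
Variable R : realType.

Definition Re_mx m n (M : 'M[R[i]]_(m, n)) : 'M[R]_(m, n) := map_mx (@complex.Re R) M.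

Lemma Re_sum (I : finType) (f : I -> R[i]) :
  complex.Re (\sum_i f i) = \sum_i complex.Re (f i).
Proof. by apply: (big_morph (@complex.Re R)) => // -[? ?] [? ?]. Qed.

Lemma Re_complexify_mul m n p (M : 'M[R]_(m, n)) (Q : 'M[R[i]]_(n, p)) :
  Re_mx (complexify M *m Q) = M *m Re_mx Q.
Proof.
apply/matrixP => i j; rewrite !mxE Re_sum; apply: eq_bigr => k _.
by rewrite !mxE; case: (Q k j) => a b /=; rewrite mul0r subr0.
Qed.

Lemma Re_mul_complexify m n p (Q : 'M[R[i]]_(m, n)) (M : 'M[R]_(n, p)) :
  Re_mx (Q *m complexify M) = Re_mx Q *m M.
Proof.
apply/matrixP => i j; rewrite !mxE Re_sum; apply: eq_bigr => k _.
by rewrite !mxE; case: (Q i k) => a b /=; rewrite mulr0 subr0.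
Qed.

Lemma Re_mxD m n (M N : 'M[R[i]]_(m, n)) : Re_mx (M + N) = Re_mx M + Re_mx N.
Proof. by apply/matrixP => i j; rewrite !mxE; case: (M i j) (N i j) => ? ? []. Qed.

Lemma complexify_adj m n (M : 'M[R]_(m, n)) : (complexify M)^t* = complexify M^T.
Proof.
apply/matrixP => i j; rewrite !mxE.
by apply: conj_Creal; rewrite complex_real.
Qed.

Definition sqnorm n (u : 'rV[R]_n) : R := (u *m u^T) 0 0.

Lemma Re_qform n (Q : 'M[R[i]]_n) (u : 'rV[R]_n) :
  complex.Re (qform Q (complexify u)) = (u *m Re_mx Q *m u^T) 0 0.
Proof.
by rewrite /qform complexify_adj -Re_complexify_mul -Re_mul_complexify [in RHS]mxE.
Qed.

Lemma dnorm_complexify n (u : 'rV[R]_n) :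
  dotmx (complexify u) (complexify u) = real_complex R (sqnorm u).
Proof. by rewrite dotmxE complexify_adj -complexifyM mxE. Qed.

Lemma Re_mx_coercive n (Q : 'M[R[i]]_n) : coercive Q ->
  exists2 e : R, 0 < e & forall u, e * sqnorm u <= (u *m Re_mx Q *m u^T) 0 0.
Proof.
move=> [e e0 h]; have eE := RRe_real (gtr0_real e0).
exists (complex.Re e); first by rewrite -ltcR eE.
move=> u; have := h (complexify u); rewrite dnorm_complexify -eE -rmorphM -Re_qform.
by rewrite lecE => /andP[].
Qed.

(** Coercivity of [P] and of the opposite of the symmetric part of [F *m P],
    with a common constant. *)
Definition lyapunov_certificate n (F P : 'M[R]_n) (e : R) :=
  [/\ 0 < e, P^T = P, (forall u, e * sqnorm u <= (u *m P *m u^T) 0 0) &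
      forall u, (u *m (F *m P) *m u^T) 0 0 <= - (e * sqnorm u)].

Lemma sqnorm_ge0 n (u : 'rV[R]_n) : 0 <= sqnorm u.
Proof. by rewrite /sqnorm mxE; apply: sumr_ge0 => i _; rewrite mxE -expr2 sqr_ge0. Qed.

Lemma sqnorm_eq0 n (u : 'rV[R]_n) : sqnorm u = 0 -> u = 0.
Proof.
rewrite /sqnorm mxE => /eqP; rewrite psumr_eq0 => [/allP h|i _]; last by rewrite mxE -expr2 sqr_ge0.
apply/rowP => i; have := h i (mem_index_enum _); rewrite !mxE -expr2 sqrf_eq0 => /eqP.
by [].
Qed.

Lemma certificate_unitmx n (F P : 'M[R]_n) e : lyapunov_certificate F P e -> P \in unitmx.
Proof.
move=> [e0 _ h _]; rewrite -row_free_unit -kermx_eq0; apply/negPn/negP => /rowV0Pn[u].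
rewrite sub_kermx => /eqP uP /eqP u0; apply/u0/sqnorm_eq0/eqP.
have := h u; rewrite uP mul0mx mxE pmulr_rle0// => h'.
by rewrite eq_le h' sqnorm_ge0.
Qed.

(** On real vectors the real part of a form is the form of the real part of
    its matrix, and [A], [B] are real, so the real parts of [P] and [Y] still
    satisfy the inequality. *)
Theorem hautus_feedback n m (A : 'M[R]_n) (B : 'M[R]_(n, m)) :
  hautus_stable (complexify A) (complexify B) ->
  exists K P e, lyapunov_certificate (A + B *m K) P e.
Proof.
move=> /hautus_stable_feasible[P0 [Y0 [PH cP cM]]].
have [e1 e10 h1] := Re_mx_coercive cP.
have [e2 e20 h2] := Re_mx_coercive cM.
set P := Re_mx P0 in h1; set Y := Re_mx Y0.
have Pu : P \in unitmx.
  rewrite -row_free_unit -kermx_eq0; apply/negPn/negP => /rowV0Pn[u].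
  rewrite sub_kermx => /eqP uP /eqP u0; apply/u0/sqnorm_eq0/eqP.
  have := h1 u; rewrite uP mul0mx mxE pmulr_rle0// => h'.
  by rewrite eq_le h' sqnorm_ge0.
pose e := Num.min e1 (e2 / 2).
have e0 : 0 < e by rewrite lt_min e10 divr_gt0.
exists (Y *m invmx P), P, e; split => //.
- apply/matrixP => i j; rewrite !mxE -[in RHS]PH !mxE.
  by case: (P0 j i).
- by move=> u; apply: le_trans (h1 u); rewrite ler_wpM2r ?sqnorm_ge0// ge_min lexx.
move=> u.
have -> : (A + B *m (Y *m invmx P)) *m P = A *m P + B *m Y.
  by rewrite mulmxDl -!mulmxA mulVmx// mulmx1.
have := h2 u; rewrite -Re_qform qformN qformD qform_adj.
rewrite (_ : complex.Re _ = - (2 * complex.Re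
  (qform (closed_loop_mx (complexify A) (complexify B) P0 Y0) (complexify u)))); last first.
  case: (qform _ _) => a b; rewrite [RHS]/=.
  rewrite (_ : (a +i* b)%C^* = (a -i* b)%C)//=; ring.
rewrite Re_qform /closed_loop_mx Re_mxD !Re_complexify_mul => h.
have : e * sqnorm u <= e2 / 2 * sqnorm u by rewrite ler_wpM2r ?sqnorm_ge0// ge_min lexx orbT.
rewrite -/P -/Y in h *; lra.
Qed.

End real_feedback.

(** * Decay of the closed loop *)

Section flow.
Variable R : realType.

Definition is_derive_mx m n (M : R -> 'M[R]_(m, n)) (t : R) (dM : 'M[R]_(m, n)) :=
  forall i j, is_derive (t : R) 1 (fun s : R => M s i j) (dM i j).

Lemma is_derive_mulmx m n p (M : R -> 'M[R]_(m, n)) (N : R -> 'M[R]_(n, p)) (t : R) dM dN :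
  is_derive_mx M t dM -> is_derive_mx N t dN ->
  is_derive_mx (fun s => M s *m N s) t (dM *m N t + M t *m dN).
Proof.
move=> hM hN i j.
rewrite (_ : (fun s => _) = \sum_(k < n) ((fun s : R => M s i k) * (fun s => N s k j))); last first.
  by apply/funext => s; rewrite mxE fct_sumE.
have h := @is_derive_sum _ _ _ _ (fun k => (fun s : R => M s i k) * (fun s : R => N s k j)) t 1 _
  (fun k => is_deriveM (hM i k) (hN k j)).
apply: (is_derive_eq h); rewrite !mxE -big_split; apply: eq_bigr => k _ /=.
by rewrite /GRing.scale /=; ring.
Qed.

Lemma is_derive_mx_cst m n (M : 'M[R]_(m, n)) (t : R) : is_derive_mx (fun=> M) t 0.
Proof. by move=> i j; rewrite mxE; exact: is_derive_cst. Qed.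

Lemma is_derive_mx_tr m n (M : R -> 'M[R]_(m, n)) (t : R) dM :
  is_derive_mx M t dM -> is_derive_mx (fun s => (M s)^T) t dM^T.
Proof.
move=> h i j; rewrite mxE (_ : (fun s => _) = (fun s => M s j i)); first exact: h.
by apply/funext => s; rewrite mxE.
Qed.

Lemma derive_ge0_le (f g : R -> R) (s t : R) : (forall t : R, is_derive t 1 f (g t)) ->
  (forall t, 0 <= g t) -> s <= t -> f s <= f t.
Proof.
move=> df g0 st; have [|c cI e] := MVT_segment st (fun x _ => df x).
  exact/continuous_subspaceT/(derive_continuous df).
by rewrite -subr_ge0 e mulr_ge0// subr_ge0.
Qed.

Variables (n : nat) (G : 'M[R]_n) (z : R -> 'cV[R]_n).
Hypothesis dz : forall (t : R) i, is_derive t 1 (fun s => z s i 0) ((G *m z t) i 0).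

Definition flow_form (X : 'M[R]_n) (t : R) : R := ((z t)^T *m X *m z t) 0 0.

Lemma flow_form_derive X (t : R) :
  is_derive t 1 (flow_form X) (flow_form (X *m G + G^T *m X) t).
Proof.
have dzm (s : R) : is_derive_mx z s (G *m z s) by move=> i j; rewrite ord1; exact: dz.
have := is_derive_mulmx (is_derive_mulmx (is_derive_mx_tr (dzm t)) (is_derive_mx_cst X t)) (dzm t).
move=> /(_ 0 0) h; apply: is_derive_eq; rewrite /flow_form; congr (_ 0 0).
by rewrite mulmx0 addr0 trmx_mul mulmxDr mulmxDl addrC !mulmxA.
Qed.

Lemma quadratic_bound (M : 'M[R]_n) : exists2 L, 0 <= L &
  forall u : 'rV[R]_n, (u *m M *m u^T) 0 0 <= L * sqnorm u.
Proof.
exists (\sum_j \sum_i `|M i j|); first by apply: sumr_ge0 => i _; exact: sumr_ge0.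
move=> u; rewrite mxE mulr_suml; apply: ler_sum => j _.
rewrite !mxE !mulr_suml; apply: ler_sum => i _.
have sq k : u 0 k ^+ 2 <= sqnorm u.
  rewrite /sqnorm mxE (bigD1 k)//= mxE -expr2 lerDl; apply: sumr_ge0 => a _.
  by rewrite mxE -expr2 sqr_ge0.
rewrite mulrAC mulrC (le_trans (ler_norm _))// normrM ler_wpM2l//.
have hi := sq i; have hj := sq j.
rewrite normrM; have := sqr_ge0 (`|u 0 i| - `|u 0 j|).
rewrite sqrrB !real_normK ?num_real// -mulr_natl; lra.
Qed.

Variables (P : 'M[R]_n) (e : R).
Hypothesis cert : lyapunov_certificate G P e.

Let Q := invmx P.

Let w (t : R) : 'rV[R]_n := (Q *m z t)^T.

Let flow_formE X t : flow_form X t = (w t *m (P *m X *m P) *m (w t)^T) 0 0.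
Proof.
have [_ PT _ _] := cert; have uP := certificate_unitmx cert.
have zE : z t = P *m (w t)^T by rewrite /w trmxK mulKVmx.
by rewrite /flow_form {1}zE trmx_mul PT trmxK {1}zE !mulmxA.
Qed.

Let lyapunov_function_derive t : flow_form (Q *m G + G^T *m Q) t <= - (2 * e) * sqnorm (w t).
Proof.
have [e0 PT _ h] := cert; have uP := certificate_unitmx cert.
rewrite flow_formE.
have -> : P *m (Q *m G + G^T *m Q) *m P = (G *m P) + (G *m P)^T.
  by rewrite mulmxDr mulmxDl mulKVmx// -!mulmxA mulVmx// mulmx1 trmx_mul PT.
rewrite mulmxDr mulmxDl mxE.
rewrite [X in _ + X](_ : _ = (w t *m (G *m P) *m (w t)^T) 0 0); last first.
  by move: (w t) => u; rewrite -[RHS]trace_mx11 -mxtrace_tr trace_mx11 !trmx_mul trmxK mulmxA.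
have := h (w t); lra.
Qed.

(** The Lyapunov function is [V = z^T P^-1 z = w P w^T], where [w^T = P^-1 z].
    Its derivative is at most [- 2 e |w| ^ 2], hence at most [- dl * V], so
    that [exp (dl * t) * V] does not increase; and [V] dominates the squares
    of the coordinates of [z]. *)
Theorem certificate_decay i j : z t i 0 * z t j 0 @[t --> +oo] --> 0.
Proof.
have [e0 PT hP _] := cert; have uP := certificate_unitmx cert.
have [L L0 hL] := quadratic_bound P.
pose V := flow_form Q.
have VE t : V t = (w t *m P *m (w t)^T) 0 0.
  by rewrite /V flow_formE mulmxV// mul1mx.
have L1 : 0 < L + 1 by rewrite ltr_wpDl.
pose dl := 2 * e / (L + 1).
have dl0 : 0 < dl by rewrite divr_gt0// mulr_gt0.
have decay (t : R) : 0 <= t -> V t <= V 0 * expR (- (dl * t)).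
  move=> t0; pose h s := - (expR (dl * s) * V s).
  have dh (s : R) : is_derive s 1 h (- (expR (dl * s) * (dl * V s + flow_form (Q *m G + G^T *m Q) s))).
    have dV := flow_form_derive Q s.
    have de : is_derive s 1 (fun s => expR (dl * s)) (expR (dl * s) * dl).
      by apply: is_derive_eq; rewrite /GRing.scale /= mulr1.
    apply: (is_derive_eq (is_deriveN (is_deriveM de dV))).
    by rewrite /V /GRing.scale /=; ring.
  have := derive_ge0_le dh _ t0; rewrite /h mulr0 expR0 mul1r lerN2 => h1.
  rewrite expRN mulrC ler_pdivlMl ?expR_gt0//; apply: h1 => s.
  rewrite oppr_ge0 pmulr_rle0 ?expR_gt0//.
  have h2 := lyapunov_function_derive s.
  have h3 : dl * V s <= 2 * e * sqnorm (w s).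
    have -> : 2 * e * sqnorm (w s) = dl * ((L + 1) * sqnorm (w s)).
      by rewrite /dl; field; rewrite gt_eqF.
    by rewrite VE ler_pM2l// (le_trans (hL _))// ler_wpM2r ?sqnorm_ge0// lerDl.
  by lra.
have coord k : exists2 K, 0 <= K & forall t, 0 <= t -> z t k 0 ^+ 2 <= K * expR (- (dl * t)).
  have [L2 L20 hL2] := quadratic_bound (P *m delta_mx k k *m P).
  have V0 : 0 <= V 0 by rewrite VE (le_trans _ (hP _))// mulr_ge0 ?sqnorm_ge0// ltW.
  exists (L2 / e * V 0) => [|t t0]; first by rewrite !mulr_ge0// invr_ge0 ltW.
  have -> : z t k 0 ^+ 2 = flow_form (delta_mx k k) t.
    rewrite /flow_form mxE (bigD1 k)//= big1 ?addr0 => [|a /negPf ak].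
      rewrite mxE (bigD1 k)//= big1 ?addr0 => [|b /negPf bk]; first by rewrite !mxE !eqxx mulr1.
      by rewrite !mxE bk mulr0.
    by rewrite mxE big1 ?mul0r// => b _; rewrite !mxE ak andbF mulr0.
  rewrite flow_formE (le_trans (hL2 _))// -mulrA -mulrA ler_wpM2l// ler_pdivlMl//.
  by rewrite (le_trans _ (decay t t0))// VE.
have [Ki Ki0 hi] := coord i; have [Kj Kj0 hj] := coord j.
pose b t := (Ki + Kj) * expR (- (dl * t)).
have b0 : b t @[t --> +oo] --> 0.
  rewrite -[X in _ --> X](mulr0 (Ki + Kj)); apply: cvgM; first exact: cvg_cst.
  apply: (@cvg_comp _ _ _ (fun t => dl * t) (fun t => expR (- t)) _ +oo); last exact: cvgr_expR.
  exact: gt0_cvgMry.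
apply: (@squeeze_cvgr _ _ _ _ (fun t => - b t) b) => //; last by rewrite -oppr0; exact: cvgN.
near=> t; have t0 : 0 <= t by near: t; exact: nbhs_pinfty_ge.
have h1 := hi t t0; have h2 := hj t t0.
rewrite -ler_norml /b mulrDl normrM.
have := sqr_ge0 (`|z t i 0| - `|z t j 0|); have := sqr_ge0 (z t i 0); have := sqr_ge0 (z t j 0).
rewrite sqrrB !real_normK ?num_real// -mulr_natl; lra.
Unshelve. all: by end_near. Qed.

End flow.

(** * Stabilizability and unremovable spectra *)

Section necessity.
Context {R : realType}.

(** Polarization. *)
Lemma symmetric_form_eq0 n (X : 'M[R]_n) : X^T = X ->
  (forall x : 'cV[R]_n, (x^T *m X *m x) 0 0 = 0) -> X = 0.
Proof.
move=> XT h; have ent i j : ((delta_mx i 0 : 'cV[R]_n)^T *m X *m (delta_mx j 0 : 'cV[R]_n)) 0 0 = X i j.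
  rewrite trmx_delta -rowE mxE (bigD1 j)//= big1 => [|k /negPf kj].
    by rewrite !mxE !eqxx mulr1 addr0.
  by rewrite !mxE kj mulr0.
apply/matrixP => i j; rewrite [RHS]mxE.
have := h (delta_mx i 0 + delta_mx j 0); rewrite tr_addmx !(mulmxDl, mulmxDr).
have D (M N : 'M[R]_1) : (M + N) 0 0 = M 0 0 + N 0 0 by rewrite mxE.
rewrite !D !h !ent add0r addr0.
have -> : X j i = X i j by rewrite -{1}XT mxE.
lra.
Qed.

Variables (n : nat) (G : 'M[R]_n) (z : R -> 'cV[R]_n).
Hypothesis dz : forall (t : R) i, is_derive t 1 (fun s => z s i 0) ((G *m z t) i 0).
Hypothesis decay : forall i j, z t i 0 * z t j 0 @[t --> +oo] --> 0.

Lemma flow_form_cvg0 (X : 'M[R]_n) : flow_form z X t @[t --> +oo] --> 0.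
Proof.
rewrite (_ : flow_form z X = fun t => \sum_j \sum_i X i j * (z t i 0 * z t j 0)); last first.
  apply/funext => t; rewrite /flow_form mxE; apply: eq_bigr => j _.
  by rewrite mxE mulr_suml; apply: eq_bigr => i _; rewrite mxE; ring.
rewrite [X in _ --> X](_ : 0 = \sum_(j < n) \sum_(i < n) (0 : R)); last first.
  by rewrite big1// => j _; rewrite big1.
apply: cvg_big => [|j _]; first exact: add_continuous.
apply: cvg_big => [|i _]; first exact: add_continuous.
by rewrite -[X in _ --> X](mulr0 (X i j)); apply: cvgM; [exact: cvg_cst|exact: decay].
Qed.

(** With [X = XR + i XI] and [lambda = l + i m], the two equations are the
    real and imaginary part of [X G + G^T X = lambda X]. The squared modulus
    [h] of [z^T X z] satisfies [dh/dt = 2 l h], so it does not decrease, yet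
    it tends to 0. *)
Lemma unstable_form_eq0 (XR XI : 'M[R]_n) (l m : R) : 0 <= l ->
  XR *m G + G^T *m XR = l *: XR - m *: XI ->
  XI *m G + G^T *m XI = l *: XI + m *: XR ->
  flow_form z XR 0 = 0 /\ flow_form z XI 0 = 0.
Proof.
move=> l0 hR hI; pose h (t : R) := flow_form z XR t ^+ 2 + flow_form z XI t ^+ 2.
have formL a b X Y t : flow_form z (a *: X + b *: Y) t = a * flow_form z X t + b * flow_form z Y t.
  by rewrite /flow_form mulmxDr mulmxDl -!scalemxAr -!scalemxAl !mxE.
have dh (t : R) : is_derive t 1 h (2 * l * h t).
  have dR := flow_form_derive dz XR t; have dI := flow_form_derive dz XI t.
  rewrite hR -scaleNr formL in dR; rewrite hI formL in dI.
  rewrite (_ : h = flow_form z XR * flow_form z XR + flow_form z XI * flow_form z XI); last first.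
    by apply/funext => s; rewrite /h !expr2.
  apply: (is_derive_eq (is_deriveD (is_deriveM dR dR) (is_deriveM dI dI))).
  rewrite -[RHS]/(2 * l * (flow_form z XR t * flow_form z XR t + flow_form z XI t * flow_form z XI t)).
  by rewrite /GRing.scale /=; ring.
have h0 t : 0 <= h t by rewrite addr_ge0 ?sqr_ge0.
have hmono t : 0 <= t -> h 0 <= h t.
  by move=> t0; apply: (derive_ge0_le dh) => // s; rewrite !mulr_ge0.
have hcvg : h t @[t --> +oo] --> 0.
  rewrite -[X in _ --> X](_ : 0 * 0 + 0 * 0 = 0 :> R); last by rewrite !mul0r addr0.
  by apply: cvgD; rewrite /h; (under eq_fun do rewrite expr2); apply: cvgM; exact: flow_form_cvg0.
have h00 : h 0 = 0.
  apply/eqP; rewrite eq_le h0 andbT.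
  apply: (cvgr_to_ge hcvg); near=> t; apply: hmono.
  by near: t; exact: nbhs_pinfty_ge.
move/eqP: h00; rewrite paddr_eq0 ?sqr_ge0// !sqrf_eq0 => /andP[/eqP -> /eqP ->].
by [].
Unshelve. all: by end_near. Qed.

End necessity.

Section stabilization.
Context {R : realType} {d : measure_display} {Omega : measurableType d}.
Variables (P : probability Omega R) (w : R -> {RV P >-> R}).
Hypothesis hw : standard_wiener w.
Variables (n m : nat) (A : 'M[R]_n) (B : 'M[R]_(n, m)) (c : R).

Local Notation closed K := (shifted A c + B *m K).

Let damped K x0 (t : R) : 'cV[R]_n := expR (- (c ^+ 2 / 2 * t)) *: exp_flow (closed K) x0 t.

Let damped_derive K x0 (t : R) i :
  is_derive t 1 (fun s => damped K x0 s i 0) (((A + B *m K) *m damped K x0 t) i 0).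
Proof.
have dz := exp_flow_derive (closed K) x0 t i.
have de : is_derive t 1 (fun s : R => expR (- (c ^+ 2 / 2 * s)))
    (- (c ^+ 2 / 2) * expR (- (c ^+ 2 / 2 * t))).
  by apply: is_derive_eq; rewrite /GRing.scale /= mulr1; ring.
rewrite (_ : (fun s => _) = (fun s : R => expR (- (c ^+ 2 / 2 * s))) *
    (fun s => exp_flow (closed K) x0 s i 0)); last by apply/funext => s; rewrite mxE.
apply: (is_derive_eq (is_deriveM de dz)); rewrite /damped.
rewrite -scalemxAr [RHS]mxE /shifted addrAC mulmxDl mul_scalar_mx.
have D (M N : 'cV[R]_n) : (M + N) i 0 = M i 0 + N i 0 by rewrite mxE.
rewrite D [X in _ *: (_ + X)]mxE /GRing.scale /=; ring.
Qed.

Let damped0 K x0 : damped K x0 0 = x0.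
Proof. by rewrite /damped mulr0 oppr0 expR0 scale1r exp_flow0. Qed.

(** The factor [exp (c ^ 2 t)] from the noise is absorbed by shifting the
    drift by [c ^ 2 / 2]. *)
Lemma closed_loop_moment K x0 x t i j :
  linear_sde_solution w (A + B *m K) c%:M x0 x -> 0 <= t ->
  ('E_P[fun omega => (x t omega *m (x t omega)^T) i j] =
  (exp_flow (closed K) x0 t i 0 * exp_flow (closed K) x0 t j 0)%:E)%E.
Proof.
move=> sx t0; rewrite (sde_second_moment hw (damped0 K x0) (damped_derive K x0) i j sx t0).
have dE k : damped K x0 t k 0 = expR (- (c ^+ 2 / 2 * t)) * exp_flow (closed K) x0 t k 0.
  by rewrite mxE.
congr EFin; rewrite !dE; move: (exp_flow _ _ _ i 0) (exp_flow _ _ _ j 0) => a b.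
rewrite (_ : expR (c ^+ 2 * t) * _ = (expR (c ^+ 2 * t) *
  (expR (- (c ^+ 2 / 2 * t)) * expR (- (c ^+ 2 / 2 * t)))) * (a * b)); last by ring.
rewrite -!expRD [X in expR X](_ : _ = 0) ?expR0 ?mul1r//; by field.
Qed.

Lemma stabilizable_flow : stabilizable w A B c%:M <-> exists K, forall x0 i j,
  exp_flow (closed K) x0 t i 0 * exp_flow (closed K) x0 t j 0 @[t --> +oo] --> 0.
Proof.
split=> -[K hK]; exists K => x0; last first.
  split; first exact: (sde_exists hw c (damped0 K x0) (damped_derive K x0)).
  move=> x sx i j.
  have h : (exp_flow (closed K) x0 t i 0 * exp_flow (closed K) x0 t j 0)%:E @[t --> +oo] --> (0 : R)%:E.
    by apply: cvg_EFin; [exact: nearW|exact: hK].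
  apply: cvg_trans h.
  apply: near_eq_cvg; near=> t.
  by rewrite /= (closed_loop_moment _ _ sx)//; near: t; exact: nbhs_pinfty_ge.
move=> i j; have [[x sx] /(_ x sx i j) h] := hK x0.
have h' : (exp_flow (closed K) x0 t i 0 * exp_flow (closed K) x0 t j 0)%:E @[t --> +oo] --> (0 : R)%:E.
  apply: cvg_trans h; apply: near_eq_cvg; near=> t.
  by rewrite /= (closed_loop_moment _ _ sx)//; near: t; exact: nbhs_pinfty_ge.
by have /fine_cvgP[_] := h'.
Unshelve. all: by end_near. Qed.

Definition unstable_spectrum (C : 'M[R]_n) (X : 'M[R[i]]_n) lambda :=
  [/\ X^T = X, X != 0,
      X *m complexify A + (complexify A)^T *m X
        + (complexify C)^T *m X *m complexify C = lambda *: X,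
      X *m complexify B = 0 & 0 <= complex.Re lambda].

Theorem stabilizable_spectrum :
  stabilizable w A B c%:M <-> ~ exists X lambda, unstable_spectrum c%:M X lambda.
Proof.
rewrite stabilizable_flow; split=> [[K hK] [X [lambda [XT X0 hX XB l0]]]|no]; last first.
  have : hautus_stable (complexify (shifted A c)) (complexify B).
    apply: no_bad_spectrum_hautus => -[X [lambda [XT X0 hX XB l0]]].
    by apply: no; exists X, lambda; split => //; rewrite shifted_lyapunov.
  move=> /hautus_feedback[K [Q [e cert]]]; exists K => x0 i j.
  exact: (certificate_decay (exp_flow_derive (closed K) x0) cert).
have hG : X *m complexify (closed K) + (complexify (closed K))^T *m X = lambda *: X.
  rewrite -hX shifted_lyapunov complexifyD complexifyM tr_addmx mulmxDr mulmxDl mulmxA XB mul0mx addr0.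
  rewrite (_ : (complexify B *m complexify K)^T *m X = 0) ?addr0//.
  by rewrite -[X in _ *m X]XT -trmx_mul mulmxA XB mul0mx trmx0.
have ReG (Y : 'M[R[i]]_n) : Re_mx (Y *m complexify (closed K) + (complexify (closed K))^T *m Y) =
    Re_mx Y *m closed K + (closed K)^T *m Re_mx Y.
  by rewrite Re_mxD Re_mul_complexify -complexify_tr Re_complexify_mul.
(* [- i X] satisfies the same equation, and its real part is the imaginary part of [X] *)
pose XR := Re_mx X; pose XI := Re_mx (- 'i%C *: X).
have XRT : XR^T = XR by rewrite /XR /Re_mx map_trmx XT.
have XIT : XI^T = XI by rewrite /XI /Re_mx map_trmx linearZ /= XT.
have hR : XR *m closed K + (closed K)^T *m XR = complex.Re lambda *: XR - complex.Im lambda *: XI.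
  rewrite -ReG hG; apply/matrixP => i j; rewrite !mxE.
  by case: (lambda) (X i j) => l m' [a b] /=; ring.
have hI : XI *m closed K + (closed K)^T *m XI = complex.Re lambda *: XI + complex.Im lambda *: XR.
  rewrite -ReG -scalemxAl -scalemxAr -scalerDr hG; apply/matrixP => i j; rewrite !mxE.
  by case: (lambda) (X i j) => l m' [a b] /=; ring.
have z0 (x0 : 'cV[R]_n) : (x0^T *m XR *m x0) 0 0 = 0 /\ (x0^T *m XI *m x0) 0 0 = 0.
  have := unstable_form_eq0 (exp_flow_derive (closed K) x0) (hK x0) l0 hR hI.
  by rewrite /flow_form exp_flow0.
have XR0 : XR = 0 by apply: symmetric_form_eq0 => // x0; case: (z0 x0).
have XI0 : XI = 0 by apply: symmetric_form_eq0 => // x0; case: (z0 x0).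
move/eqP: X0; apply; apply/matrixP => i j.
have := congr1 (fun M : 'M[R]_n => M i j) XR0; have := congr1 (fun M : 'M[R]_n => M i j) XI0.
rewrite !mxE; case: (X i j) => a b /=; rewrite !(mul0r, oppr0, mulN1r, mulr0, sub0r, opprK, add0r) => -> ->.
by [].
Qed.

End stabilization.

Theorem theorem3 (R : realType) (d : measure_display)
    (Omega : measurableType d) (P : probability Omega R)
    (w : R -> {RV P >-> R}) (hw : standard_wiener w)
    (n m : nat) (A : 'M[R]_n) (B : 'M[R]_(n, m)) (C : 'M[R]_n)
    (hC : exists C1 : 'M[R]_n, forall X : 'M[R[i]]_n, X^T = X ->
       (complexify C)^T *m X *m complexify C
       = X *m complexify C1 + (complexify C1)^T *m X) :
  (stabilizable w A B C <->
     forall lambda : R[i], unremovable_spectrum A B C lambda ->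
       complex.Re lambda < 0) /\
  (stabilizable w A B C <->
     ~ exists (X : 'M[R[i]]_n) (lambda : R[i]),
         [/\ X^T = X, X != 0,
             X *m complexify A + (complexify A)^T *m X
             + (complexify C)^T *m X *m complexify C = lambda *: X,
             X *m complexify B = 0 & 0 <= complex.Re lambda]).
Proof.
have [c ->] := intertwining_scalar hC.
have bad := stabilizable_spectrum hw A B c.
split; last exact: bad.
apply: (iff_trans bad); split.
  move=> no lambda /unremovable_spectrumP[X [XT X0 hX XB]].
  by rewrite ltNge; apply/negP => l0; apply: no; exists X, lambda.
move=> h [X [lambda [XT X0 hX XB l0]]].
have /h : unremovable_spectrum A B c%:M lambda by apply/unremovable_spectrumP; exists X.
by rewrite ltNge l0.
Qed.
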